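(* Let $G=N\rtimes H$ be a semidirect product of discrete groups with identity $e$, let $M$ be a normal subgroup of $N$, and let $P=\{a\in H: aMa^{-1}\subset M\}$. Assume that $H=PP^{-1}=P^{-1}P$, that $aMa^{-1}$ has finite index in $M$ for every $a\in P$, that $\bigcap_{a\in P}aMa^{-1}=\{e\}$, and that $N=\bigcup_{a\in P}a^{-1}Ma$. Then the $C^*$-algebra $\mathfrak{A}[N\rtimes H,M]$ is isomorphic to the full groupoid $C^*$-algebra $C^*(\overline{N}\rtimes G|_{\overline{M}})$.
   Context: Write $M_a=aMa^{-1}$ for $a\in P$ (a normal subgroup of $M$). $\mathfrak{A}[N\rtimes H,M]$ is the universal (unital) $C^*$-algebra generated by isometries $\{s_a:a\in P\}$ and unitaries $\{u(m):m\in M\}$ subject to: $s_as_b=s_{ab}$; $u(m)u(n)=u(mn)$; $s_au(m)=u(ama^{-1})s_a$; and, for every $a\in P$, $\sum_{k\in M/M_a}u(k)s_as_a^*u(k)^{-1}=1$. $\overline{M}=\{(r_a)\in\prod_{a\in P}M/M_a: r_{ab}\equiv r_a \bmod M_a \text{ for all }a,b\in P\}$, with the topology induced from the product of the finite discrete groups $M/M_a$; it is a compact group. For $a\in P$, $r\in\overline{M}$, the element $ara^{-1}\in\overline{M}$ is defined by: for $b\in P$ choose $c\in aP\cap bP$, write $c=a\alpha$ with $\alpha\in P$, and let $(ara^{-1})_b$ be the image of $r_\alpha$ under $M/M_\alpha\to M/M_c\to M/M_b$, where the first map is induced by conjugation by $a$ and the second is the quotient map (this is well defined). $\overline{N}=(\overline{M}\times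 P)/\!\sim$, where $(x,a)\sim(y,b)$ if there are $\alpha,\beta\in P$ with $\alpha a=\beta b$ and $\alpha x\alpha^{-1}=\beta y\beta^{-1}$, with the quotient topology ($P$ discrete) and product $[(x,a)][(y,b)]=[(\alpha x\alpha^{-1}\beta y\beta^{-1},\alpha a)]$ where $\alpha a=\beta b$. It is a locally compact Hausdorff group, containing $\overline{M}$ as a compact open subgroup via $x\mapsto[(x,e)]$. For $a\in P$ let $\phi_a([(x,b)])=[(\beta x\beta^{-1},\alpha)]$, where $\alpha a=\beta b$ (a homeomorphism with inverse $[(x,b)]\mapsto[(x,ba)]$); for $m\in M$ let $\psi_m([(x,a)])=[(ama^{-1}x,a)]$. Every $g\in G$ has the form $g=a^{-1}mb$ with $a,b\in P$, $m\in M$, and $gx:=\phi_a^{-1}\psi_m\phi_b(x)$ is a well-defined left action of $G$ on $\overline{N}$; the associated right action is $x.g=g^{-1}x$. $\overline{N}\rtimes G=\overline{N}\times G$ ($G$ discrete) is the transformation groupoid with range $r(x,g)=x$, source $s(x,g)=x.g$, product $(x,g)(x.g,h)=(x,gh)$, inverse $(x,g)^{-1}=(x.g,g^{-1})$; and $\overline{N}\rtimes G|_{\overline{M}}=\{(x,g):x\in\overline{M},\ x.g\in\overline{M}\}$. *)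

(* Defs.v *)
From HB Require Import structures.
From mathcomp Require Import all_boot all_order all_algebra.
From mathcomp Require Import complex.
From mathcomp Require Import all_classical all_reals all_analysis.
Import numFieldNormedType.Exports.

Set Implicit Arguments.
Unset Strict Implicit.
Unset Printing Implicit Defensive.

Import Order.TTheory GRing.Theory Num.Theory.
Local Open Scope classical_set_scope.

(* An algebraic groupoid with a topology on its arrows.  [gmul] is total, but
   only its values on composable pairs ([gsrc x = grng y]) are meaningful; by
   the axioms, units correspond to the points of the image of [grng].
   Continuity of the operations is not part of the structure: it plays no role
   in the definition of the convolution algebra. *)
Record topGroupoid := TopGroupoid {
  gobj : Type;
  garr :> topologicalType;
  grng : garr -> gobj;
  gsrc : garr -> gobj;
  gmul : garr -> garr -> garr;
  ginv : garr -> garr;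
  grng_mul : forall x y, gsrc x = grng y -> grng (gmul x y) = grng x;
  gsrc_mul : forall x y, gsrc x = grng y -> gsrc (gmul x y) = gsrc y;
  gmulA : forall x y z, gsrc x = grng y -> gsrc y = grng z ->
    gmul x (gmul y z) = gmul (gmul x y) z;
  grng_inv : forall x, grng (ginv x) = gsrc x;
  ginvK : involutive ginv;
  gmulKl : forall x y, gsrc x = grng y -> gmul (ginv x) (gmul x y) = y;
  gmulKr : forall x y, gsrc x = grng y -> gmul (gmul x y) (ginv y) = x
}.

Section GroupSide.
Local Open Scope group_scope.

Variables (G : groupType) (N H M : set G).

Definition setconj (a : G) (A : set G) : set G := [set a * x * a^-1 | x in A].

Definition lcos (x : G) (A : set G) : set G := [set x * y | y in A].

Definition Pset : set G := [set a | H a /\ setconj a M `<=` M].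

Definition Msub (a : G) : set G := setconj a M.

(* M/M_a, a coset being represented by the set of its elements. *)
Definition Mcosets (a : G) : set (set G) :=
  [set C | exists2 m, M m & C = lcos m (Msub a)].

Definition is_subgroup (A : set G) : Prop := group_closed (mem A).

(* Internal semidirect product: N normal in G, NH = G, N and H meet in 1. *)
Definition semidirect : Prop :=
  [/\ is_subgroup N, is_subgroup H,
      (forall g, setconj g N `<=` N),
      (forall g, exists n h, [/\ N n, H h & g = n * h])
    & N `&` H = [set 1]].

Definition normal_in (A B : set G) : Prop :=
  [/\ is_subgroup A, A `<=` B & forall b, B b -> setconj b A `<=` A].

Record CL_hypotheses : Prop := CLHypotheses {
  st_semidirect : semidirect;
  st_normal : normal_in M N;
  st_right_ore : H = [set a * b^-1 | a in Pset & b in Pset];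
  st_left_ore : H = [set a^-1 * b | a in Pset & b in Pset];
  st_finite : forall a, Pset a -> finite_set (Mcosets a);
  st_cap : \bigcap_(a in Pset) Msub a = [set 1];
  st_cup : N = \bigcup_(a in Pset) setconj a^-1 M
}.

Hypothesis st : CL_hypotheses.

Lemma sub1 (A : set G) : is_subgroup A -> A 1.
Proof. by case=> /set_mem. Qed.
Lemma subF (A : set G) x y : is_subgroup A -> A x -> A y -> A (x * y^-1).
Proof. by case=> _ h /mem_set hx /mem_set hy; apply/set_mem/h. Qed.
Lemma subV (A : set G) x : is_subgroup A -> A x -> A x^-1.
Proof. by move=> h hx; rewrite -[x^-1]mul1g; apply: subF (sub1 h) hx. Qed.
Lemma subM (A : set G) x y : is_subgroup A -> A x -> A y -> A (x * y).
Proof. by move=> h hx hy; rewrite -[y]invgK; apply: subF hx (subV h hy). Qed.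

Let sgH : is_subgroup H. Proof. by case: (st_semidirect st). Qed.
Let sgM : is_subgroup M. Proof. by case: (st_normal st). Qed.

Lemma setconjE a (A : set G) x : setconj a A x <-> A (a^-1 * x * a).
Proof.
split=> [[y Ay <-]|Ax]; first by rewrite !mulgA mulVg mul1g mulgVK.
by exists (a^-1 * x * a); rewrite // !mulgA mulgV mul1g mulgK.
Qed.

Lemma Pset1 : Pset 1.
Proof.
split; first exact: sub1.
by move=> x [y My <-]; rewrite mul1g invg1 mulg1.
Qed.

Lemma PsetM a b : Pset a -> Pset b -> Pset (a * b).
Proof.
move=> [Ha Ma] [Hb Mb]; split; first exact: subM.
move=> x [y My <-].
have : M (b * y * b^-1) by apply: Mb; exists y.
by move=> Mz; apply: Ma; exists (b * y * b^-1); rewrite // invgM !mulgA.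
Qed.

Lemma conj_in_M a m : Pset a -> M m -> M (a * m * a^-1).
Proof. by move=> [_ h] Mm; apply: h; exists m. Qed.

Local Notation PT := (set_type Pset).
Local Notation MT := (set_type M).

Definition P1 : PT := exist _ 1 (mem_set Pset1).
Definition Pmul (a b : PT) : PT :=
  exist _ (val a * val b) (mem_set (PsetM (set_valP a) (set_valP b))).
Definition Mconj (a : PT) (m : MT) : MT :=
  exist _ (val a * val m * (val a)^-1)
    (mem_set (conj_in_M (set_valP a) (set_valP m))).

Lemma HPset a : Pset a -> H a. Proof. by case. Qed.

Lemma ore_right (a b : PT) :
  exists p : PT * PT, val a * val p.1 = val b * val p.2.
Proof.
have : H ((val a)^-1 * val b).
  have Ha := HPset (set_valP a); have Hb := HPset (set_valP b).
  by apply: subM => //; apply: subV.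
rewrite {1}(st_right_ore st) => -[x Px [y Py e]].
exists (exist _ x (mem_set Px), exist _ y (mem_set Py)) => /=.
by apply: (@mulgI _ (val a)^-1); rewrite mulKg mulgA -e mulgVK.
Qed.

Lemma ore_left (a b : PT) :
  exists p : PT * PT, val p.1 * val a = val p.2 * val b.
Proof.
have : H (val a * (val b)^-1).
  have Ha := HPset (set_valP a); have Hb := HPset (set_valP b).
  exact: subF.
rewrite {1}(st_left_ore st) => -[x Px [y Py e]].
exists (exist _ x (mem_set Px), exist _ y (mem_set Py)) => /=.
by apply: (@mulIg _ (val b)^-1); rewrite mulgK -mulgA -e mulVKg.
Qed.

Lemma lcos_eq a x y : M x -> M y -> Pset a ->
  Msub a (x^-1 * y) -> lcos x (Msub a) = lcos y (Msub a).
Proof.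
move=> Mx My Pa /setconjE; set z := (X in M X) => Mz.
have hz : x^-1 * y = a * z * a^-1.
  by rewrite /z !mulgA mulgV mul1g mulgK.
clearbody z.
apply/seteqP; split=> _ [_ [k Mk <-] <-].
  exists (a * (z^-1 * k) * a^-1);
    first by exists (z^-1 * k) => //; apply: (subM sgM (subV sgM Mz) Mk).
  have -> : y = x * (a * z * a^-1) by rewrite -hz mulVKg.
  by rewrite !mulgA mulgVK mulgK.
exists (a * (z * k) * a^-1);
  first by exists (z * k) => //; apply: (subM sgM Mz Mk).
have -> : y = x * (a * z * a^-1) by rewrite -hz mulVKg.
by rewrite !mulgA mulgVK.
Qed.

Lemma Msub1 a : Msub a 1.
Proof. by exists 1; rewrite ?mulg1 ?mulgV //; apply: sub1. Qed.

Lemma mem_lcos x a : lcos x (Msub a) x.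
Proof. by exists 1; rewrite ?mulg1 //; apply: Msub1. Qed.

Lemma Msub_mul a b : Pset b -> Msub (a * b) `<=` Msub a.
Proof.
move=> Pb _ [y My <-]; exists (b * y * b^-1); first exact: conj_in_M.
by rewrite invgM !mulgA.
Qed.

Definition quoM (a : G) := set_type (Mcosets a).

(* Given M_{ab} `<=` M_a, the congruence r_{ab} = r_a mod M_a says that the
   coset r_{ab} is contained in the coset r_a. *)
Definition Mbar := set_type
  [set r : prod_topology (fun a : PT => discrete_topology (quoM (val a))) |
    forall a b : PT, val (r (Pmul a b)) `<=` val (r a)].

Definition mbar (r : Mbar) (a : PT) : set G := val (val r a).

Lemma mbar_inj r s : (forall a, mbar r a = mbar s a) -> r = s.
Proof.
move=> h; apply: val_inj; apply: functional_extensionality_dep => a.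
exact/val_inj/h.
Qed.

Lemma mbarP r a x : mbar r a x ->
  M x /\ mbar r a = lcos x (Msub (val a)).
Proof.
rewrite /mbar; case: (set_valP (val r a)) => m Mm ->.
case=> [_ [k Mk <-] <-].
have Mc : M (val a * k * (val a)^-1) by apply: conj_in_M => //; apply: set_valP.
split; first by apply: subM.
apply: lcos_eq => //; [exact: subM|exact: set_valP|].
by rewrite mulKg; exists k.
Qed.

Lemma mbar_ex r a : exists x, mbar r a x.
Proof.
rewrite /mbar; case: (set_valP (val r a)) => m Mm ->.
by exists m; apply: mem_lcos.
Qed.

Lemma mbar_sub r (a b c : PT) : val c = val a * val b -> mbar r c `<=` mbar r a.
Proof.
move=> e; have -> : c = Pmul a b by apply: val_inj.
exact: (set_valP r).
Qed.

Lemma mkMbar (f : PT -> set G) (hf : forall a, Mcosets (val a) (f a))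
  (hc : forall a b : PT, f (Pmul a b) `<=` f a) :
  { r : Mbar | forall a, mbar r a = f a }.
Proof.
pose r a : quoM (val a) := exist _ (f a) (mem_set (hf a)).
by exists (exist _ r (mem_set hc)).
Qed.

Definition choose_right (a b : PT) : PT * PT :=
  xget (P1, P1) [set p | val a * val p.1 = val b * val p.2].

(* The b-th coordinate of a r a^-1: with a * alpha in bP, this is
   (a r_alpha a^-1) M_b.  [conj_cosE] shows independence of the choice of
   alpha. *)
Definition conj_cos (a : PT) (r : Mbar) (b : PT) : set G :=
  [set x * y | x in setconj (val a) (mbar r (choose_right a b).1)
             & y in Msub (val b)].

Lemma conj_cosE (a : PT) r (b al be : PT) x :
  val a * val al = val b * val be -> mbar r al x ->
  conj_cos a r b = lcos (val a * x * (val a)^-1) (Msub (val b)).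
Proof.
move=> e rx; rewrite /conj_cos.
have := xgetPex (P1, P1) (ore_right a b); rewrite -/(choose_right a b).
case: (choose_right a b) => al' be' /= e'.
have [[d d'] /= ed] := ore_right al al'.
have [z rz] := mbar_ex r (Pmul al d).
have Mconjb (g g' : PT) (u v : G) : val a * val g = val b * val g' ->
    mbar r g u -> mbar r g v ->
    Msub (val b) ((val a * u * (val a)^-1)^-1 * (val a * v * (val a)^-1)).
  move=> eg ru /[dup] rv; have [Mu ->] := mbarP ru => -[_ [k Mk <-] <-].
  exists (val g' * k * (val g')^-1); first exact/conj_in_M/Mk/set_valP.
  rewrite !invgM !invgK.
  transitivity ((val b * val g') * k * (val b * val g')^-1).
    by rewrite !invgM !mulgA.
  by rewrite -eg !invgM !mulgA !mulgVK.
have key (g g' : PT) (u : G) : val a * val g = val b * val g' ->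
    mbar r g u -> mbar r g z ->
    lcos (val a * u * (val a)^-1) (Msub (val b)) =
    lcos (val a * z * (val a)^-1) (Msub (val b)).
  move=> eg ru rz'; apply: lcos_eq; last exact: (Mconjb _ _ _ _ eg ru rz').
  - by apply: conj_in_M; [exact: set_valP|exact: (mbarP ru).1].
  - by apply: conj_in_M; [exact: set_valP|exact: (mbarP rz').1].
  - exact: set_valP.
have rz1 : mbar r al z by apply: mbar_sub rz.
have rz2 : mbar r al' z by apply: (@mbar_sub r al' d') rz; rewrite /= ed.
rewrite (key _ _ _ e rx rz1).
apply/seteqP; split=> [_ [_ [u ru <-] [y My <-]]|_ [y My <-]].
  by rewrite -(key _ _ _ e' ru rz2); exists y.
by exists (val a * z * (val a)^-1); [exists z|exists y].
Qed.

Lemma conj_cos_ex (a : PT) r (b : PT) : exists al be : PT, exists x,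
  [/\ val a * val al = val b * val be, mbar r al x &
    conj_cos a r b = lcos (val a * x * (val a)^-1) (Msub (val b))].
Proof.
have [[al be] /= e] := ore_right a b; have [x rx] := mbar_ex r al.
by exists al, be, x; split => //; apply: conj_cosE e rx.
Qed.

Lemma conj_cos_in (a : PT) r (b : PT) : Mcosets (val b) (conj_cos a r b).
Proof.
have [al [be [x [e rx ->]]]] := conj_cos_ex a r b.
exists (val a * x * (val a)^-1) => //.
by apply: conj_in_M; [exact: set_valP|exact: (mbarP rx).1].
Qed.

Lemma conj_cos_coherent (a : PT) r (b c : PT) :
  conj_cos a r (Pmul b c) `<=` conj_cos a r b.
Proof.
have [al [be [x [/= e rx ->]]]] := conj_cos_ex a r (Pmul b c).
have e' : val a * val al = val b * val (Pmul c be) by rewrite /= mulgA.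
rewrite (conj_cosE e' rx) => _ [k Mk <-]; exists k => //.
by apply: Msub_mul Mk; exact: set_valP.
Qed.

Definition conjMbar (a : PT) (r : Mbar) : Mbar :=
  sval (mkMbar (conj_cos_in a r) (@conj_cos_coherent a r)).

Lemma conjMbarE a r b : mbar (conjMbar a r) b = conj_cos a r b.
Proof. by rewrite /conjMbar; case: mkMbar. Qed.

Lemma conjMbarM (a b : PT) r : conjMbar a (conjMbar b r) = conjMbar (Pmul a b) r.
Proof.
apply: mbar_inj => c; rewrite !conjMbarE.
have [[al be] /= e] := ore_right a c.
have [[ga de] /= e'] := ore_right b al.
have [x rx] := mbar_ex r ga.
have ry : mbar (conjMbar b r) al (val b * x * (val b)^-1).
  by rewrite conjMbarE (conj_cosE e' rx); exact: mem_lcos.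
rewrite (conj_cosE e ry).
have e'' : val (Pmul a b) * val ga = val c * val (Pmul be de).
  by rewrite /= -mulgA e' !mulgA e.
by rewrite (conj_cosE e'' rx) /= invgM !mulgA.
Qed.

Lemma translate_in (m : MT) r b : Mcosets (val b) (lcos (val m) (mbar r b)).
Proof.
have [x rx] := mbar_ex r b; have [Mx ->] := mbarP rx.
exists (val m * x); first by apply: (subM sgM) => //; exact: set_valP.
apply/seteqP; split=> [_ [_ [k Mk <-] <-]|_ [k Mk <-]].
  by exists k; rewrite ?mulgA.
by exists (x * k); rewrite ?mulgA //; exists k.
Qed.

Lemma translate_coherent (m : MT) r b c :
  lcos (val m) (mbar r (Pmul b c)) `<=` lcos (val m) (mbar r b).
Proof. by move=> _ [k rk <-]; exists k => //; apply: mbar_sub rk. Qed.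

(* Left multiplication in Mbar by the image (m M_b)_b of m. *)
Definition translate (m : MT) (r : Mbar) : Mbar :=
  sval (mkMbar (translate_in m r) (@translate_coherent m r)).

Lemma translateE m r b : mbar (translate m r) b = lcos (val m) (mbar r b).
Proof. by rewrite /translate; case: mkMbar. Qed.

Lemma lcosM x y (A : set G) : lcos x (lcos y A) = lcos (x * y) A.
Proof.
apply/seteqP; split=> [_ [_ [k Ak <-] <-]|_ [k Ak <-]].
  by exists k; rewrite ?mulgA.
by exists (y * k); rewrite ?mulgA //; exists k.
Qed.

Lemma translateM (m n p : MT) r : val p = val m * val n ->
  translate m (translate n r) = translate p r.
Proof. by move=> e; apply: mbar_inj => b; rewrite !translateE lcosM e. Qed.

Lemma translate_conj a m r :
  conjMbar a (translate m r) = translate (Mconj a m) (conjMbar a r).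
Proof.
apply: mbar_inj => b; rewrite translateE !conjMbarE.
have [[al be] /= e] := ore_right a b; have [x rx] := mbar_ex r al.
have ry : mbar (translate m r) al (val m * x) by rewrite translateE; exists x.
by rewrite (conj_cosE e rx) (conj_cosE e ry) lcosM /= !mulgA mulgVK.
Qed.

Lemma conjMbar1 r : conjMbar P1 r = r.
Proof.
apply: mbar_inj => b; rewrite conjMbarE; have [x rx] := mbar_ex r b.
have e : val P1 * val b = val b * val P1 by rewrite /= mul1g mulg1.
by rewrite (conj_cosE e rx) /= invg1 mul1g mulg1 -(mbarP rx).2.
Qed.

Definition pairMP := (Mbar * discrete_topology PT)%type.
Definition pt_of (p : pairMP) : PT := p.2.

Definition sim (p q : pairMP) : Prop := exists al be : PT,
  val al * val (pt_of p) = val be * val (pt_of q) /\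
  conjMbar al p.1 = conjMbar be q.1.

Lemma sim_refl p : sim p p. Proof. by exists P1, P1. Qed.

Lemma sim_sym p q : sim p q -> sim q p.
Proof. by case=> [al [be [e1 e2]]]; exists be, al. Qed.

Lemma sim_trans q p r : sim p q -> sim q r -> sim p r.
Proof.
move=> [al [be [e1 e2]]] [ga [de [e3 e4]]].
have [[ze et] /= e] := ore_left be ga.
have e' : Pmul ze be = Pmul et ga by apply: val_inj.
exists (Pmul ze al), (Pmul et de); split => /=.
  by rewrite -mulgA e1 mulgA e -mulgA e3 mulgA.
by rewrite -!conjMbarM e2 conjMbarM e' -conjMbarM e4.
Qed.

Definition simb : rel pairMP := fun p q => `[< sim p q >].

Lemma simb_equiv : equiv_class_of simb.
Proof.
split=> [p|p q|q p r].
- exact/asboolP/sim_refl.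
- by apply/asboolP/asboolP; exact: sim_sym.
- by move=> /asboolP h1 /asboolP h2; apply/asboolP/(sim_trans h1).
Qed.

Canonical simb_rel := EquivRelPack simb_equiv.

Definition Nbar := quotient_topology {eq_quot simb}%qT.

HB.instance Definition _ := Topological.on Nbar.

Definition cls (x : Mbar) (a : PT) : Nbar := (\pi_Nbar (x, a))%qT.

Lemma cls_eq x a y b : cls x a = cls y b <-> sim (x, a) (y, b).
Proof. by split=> [/eqmodP/asboolP|h] //; apply/eqmodP/asboolP. Qed.

Lemma clsP (q : Nbar) : exists x a, q = cls x a.
Proof.
by exists (repr q).1, (repr q).2; rewrite /cls -surjective_pairing reprK.
Qed.

Definition choose_left (a b : PT) : PT * PT :=
  xget (P1, P1) [set p | val p.1 * val a = val p.2 * val b].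

(* phi, phi_inv, psi and act are defined on chosen representatives;
   independence of the choices is phiE, phi_invE, psiE and actE below. *)
Definition phi (a : PT) (q : Nbar) : Nbar :=
  let p := repr q in
  let ab := choose_left a (pt_of p) in
  cls (conjMbar ab.2 p.1) ab.1.

Definition phi_inv (a : PT) (q : Nbar) : Nbar :=
  let p := repr q in cls p.1 (Pmul (pt_of p) a).

Definition psi (m : MT) (q : Nbar) : Nbar :=
  let p := repr q in cls (translate (Mconj (pt_of p) m) p.1) (pt_of p).

Lemma repr_cls x a : sim (repr (cls x a)) (x, a).
Proof.
by apply/cls_eq; rewrite {1}/cls -!surjective_pairing reprK.
Qed.

Lemma phiE a x (b al be : PT) : val al * val a = val be * val b ->
  phi a (cls x b) = cls (conjMbar be x) al.
Proof.
move=> e; rewrite /phi; case: (repr _) (repr_cls x b) => y c /= [ga [de []]].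
rewrite /pt_of /= => e1 e2.
have := xgetPex (P1, P1) (ore_left a c); rewrite -/(choose_left a c).
case: (choose_left a c) => al' be' /= e'; apply/cls_eq.
have [[ze et] /= h] := ore_left al' al.
have [[ka la] /= h'] := ore_left (Pmul ze be') ga.
have h2 : Pmul la de = Pmul (Pmul ka et) be.
  apply: val_inj => /=; apply: (@mulIg _ (val b)).
  rewrite -mulgA -e1 mulgA -h' -!mulgA -e' -e.
  by congr (_ * _); rewrite !mulgA h.
have h3 : Pmul (Pmul ka ze) be' = Pmul la ga.
  by apply: val_inj; rewrite /= -h' !mulgA.
exists (Pmul ka ze), (Pmul ka et); split; rewrite /pt_of /=.
  by rewrite -!mulgA h.
by rewrite conjMbarM h3 -conjMbarM e2 !conjMbarM h2.
Qed.

Lemma phi_invE a x b : phi_inv a (cls x b) = cls x (Pmul b a).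
Proof.
rewrite /phi_inv; case: (repr _) (repr_cls x b) => y c /= [ga [de []]].
rewrite /pt_of /= => e1 e2; apply/cls_eq; exists ga, de; split => //.
by rewrite /pt_of /= !mulgA e1.
Qed.

Lemma psiE m x b : psi m (cls x b) = cls (translate (Mconj b m) x) b.
Proof.
rewrite /psi; case: (repr _) (repr_cls x b) => y c /= [ga [de []]].
rewrite /pt_of /= => e1 e2; apply/cls_eq; exists ga, de; split => //.
rewrite /= !translate_conj e2; congr translate; apply: val_inj => /=.
transitivity ((val ga * val c) * val m * (val ga * val c)^-1).
  by rewrite invgM !mulgA.
by rewrite e1 invgM !mulgA.
Qed.

Lemma phiK a : cancel (phi a) (phi_inv a).
Proof.
move=> q; have [x [b ->]] := clsP q; have [[al be] /= e] := ore_left a b.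
rewrite (phiE _ e) phi_invE; apply/cls_eq; exists P1, be; split => /=.
  by rewrite /pt_of /= mul1g.
by rewrite conjMbar1.
Qed.

Lemma phi_invK a : cancel (phi_inv a) (phi a).
Proof.
move=> q; have [x [b ->]] := clsP q; rewrite phi_invE.
have e : val b * val a = val P1 * val (Pmul b a) by rewrite /= mul1g.
by rewrite (phiE _ e) conjMbar1.
Qed.

Lemma phiM a b q : phi a (phi b q) = phi (Pmul a b) q.
Proof.
have [x [c ->]] := clsP q; have [[al be] /= e] := ore_left b c.
have [[ga de] /= e'] := ore_left a al.
rewrite (phiE _ e) (phiE _ e') conjMbarM; apply/esym/phiE => /=.
by rewrite mulgA e' -!mulgA e.
Qed.

Lemma psiM m n p q : val p = val m * val n -> psi m (psi n q) = psi p q.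
Proof.
move=> e; have [x [c ->]] := clsP q; rewrite !psiE; congr cls.
by apply: translateM; rewrite /= e !mulgA mulgVK.
Qed.

Lemma psi_phi a m q : phi a (psi m q) = psi (Mconj a m) (phi a q).
Proof.
have [x [b ->]] := clsP q; have [[al be] /= e] := ore_left a b.
rewrite psiE !(phiE _ e) psiE translate_conj; congr cls; congr translate.
apply: val_inj => /=.
transitivity ((val be * val b) * val m * (val be * val b)^-1).
  by rewrite invgM !mulgA.
by rewrite -e invgM !mulgA.
Qed.

Lemma phi_inj a : injective (phi a). Proof. exact: can_inj (phiK a). Qed.

Definition nform (g : G) (t : PT * MT * PT) : Prop :=
  g = (val t.1.1)^-1 * val t.1.2 * val t.2.

Lemma nform_ex g : exists t, nform g t.
Proof.
have [_ _ _ /(_ g) [n [h [Nn Hh ->]]] _] := st_semidirect st.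
move: Nn; rewrite (st_cup st) => -[c Pc /setconjE]; rewrite invgK => Mm.
have : H (c * h) by apply: (subM sgH) => //; exact: HPset.
rewrite {1}(st_left_ore st) => -[d Pd [e Pe ed]].
pose c' : PT := exist _ c (mem_set Pc); pose d' : PT := exist _ d (mem_set Pd).
pose m : MT := exist _ (c * n * c^-1) (mem_set Mm).
exists (Pmul d' c', Mconj d' m, exist _ e (mem_set Pe)); rewrite /nform /=.
have -> : e = d * (c * h) by rewrite -ed mulVKg.
by rewrite invgM !mulgA !mulgVK mulVg mul1g.
Qed.

(* some (a, m, b) with g = a^-1 m b *)
Definition choose_nform (g : G) : PT * MT * PT :=
  xget (P1, exist _ 1 (mem_set (sub1 sgM)), P1) (nform g).

Definition act (g : G) (q : Nbar) : Nbar :=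
  let t := choose_nform g in phi_inv t.1.1 (psi t.1.2 (phi t.2 q)).

Lemma actE g a m b q : g = (val a)^-1 * val m * val b ->
  act g q = phi_inv a (psi m (phi b q)).
Proof.
move=> e; have := xgetPex (P1, exist _ 1 (mem_set (sub1 sgM)), P1) (nform_ex g).
rewrite /act -/(choose_nform g).
case: (choose_nform g) => [[c n] d]; rewrite /nform /= => e'.
have [[al ga] /= h] := ore_left a c.
have hg : val (Mconj al m) * (val al * val b) =
          val (Mconj ga n) * (val ga * val d).
  transitivity (val al * val a * g).
    by rewrite e /= !mulgA !mulgVK mulgK.
  by rewrite h e' /= !mulgA !mulgVK mulgK.
have [sgN _ _ _ NH] := st_semidirect st; have [_ MN _] := st_normal st.
have Hx (x y : PT) : H (val x * val y).
  by apply: (subM sgH); apply: HPset; exact: set_valP.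
have hz : (val (Mconj ga n))^-1 * val (Mconj al m) = 1.
  suff : (N `&` H) ((val (Mconj ga n))^-1 * val (Mconj al m)) by rewrite NH.
  split; first by apply: (subM sgN); [apply: (subV sgN)|]; apply: MN; exact: set_valP.
  have -> : (val (Mconj ga n))^-1 * val (Mconj al m) =
            (val ga * val d) * (val al * val b)^-1.
    by apply: (@mulIg _ (val al * val b)); rewrite mulgVK -mulgA hg mulKg.
  by apply: (subF sgH); exact: Hx.
have emn : Mconj al m = Mconj ga n.
  by apply: val_inj; rewrite -[LHS](mulVKg (val (Mconj ga n))) hz mulg1.
have ebd : Pmul al b = Pmul ga d.
  by apply: val_inj; apply: (@mulgI _ (val (Mconj al m))); rewrite hg emn.
have eac : Pmul al a = Pmul ga c by apply: val_inj.
apply: (@phi_inj (Pmul al a)).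
rewrite -[RHS]phiM phi_invK psi_phi phiM eac -phiM phi_invK psi_phi phiM.
by rewrite emn ebd.
Qed.

Lemma act_form g : exists (a : PT) (m : MT) (b : PT), g = (val a)^-1 * val m * val b /\
  forall q, act g q = phi_inv a (psi m (phi b q)).
Proof.
have [[[a m] b] h] := nform_ex g.
by exists a, m, b; split=> // q; exact: actE.
Qed.

Definition M1 : MT := exist _ 1 (mem_set (sub1 sgM)).

Lemma psi1 q : psi M1 q = q.
Proof.
have [x [c ->]] := clsP q; rewrite psiE; congr cls.
apply: mbar_inj => b; rewrite translateE /= mulg1 mulgV.
apply/seteqP; split=> [_ [y hy <-]|y hy]; first by rewrite mul1g.
by exists y; rewrite ?mul1g.
Qed.

Lemma act1 q : act 1 q = q.
Proof.
rewrite (@actE 1 P1 M1 P1) ?psi1 ?phiK //=.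
by rewrite invg1 !mulg1.
Qed.

Lemma actM g h q : act (g * h) q = act g (act h q).
Proof.
have [a [m [b [eg ->]]]] := act_form g.
have [c [n [d [eh ->]]]] := act_form h.
have [[be ga] /= e] := ore_left b c.
have Mmn : M (val (Mconj be m) * val (Mconj ga n)).
  by apply: (subM sgM); exact: set_valP.
pose mn : MT := exist _ (val (Mconj be m) * val (Mconj ga n)) (mem_set Mmn).
rewrite (@actE _ (Pmul be a) mn (Pmul ga d)).
  apply: (@phi_inj (Pmul be a)); rewrite phi_invK.
  rewrite -[RHS]phiM phi_invK psi_phi phiM.
  have -> : Pmul be b = Pmul ga c by apply: val_inj.
  by rewrite -[phi (Pmul ga c) _]phiM phi_invK psi_phi phiM (psiM (p := mn)).
have bc : val b * (val c)^-1 = (val be)^-1 * val ga.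
  by apply: (@mulIg _ (val c)); rewrite mulgVK -mulgA -e mulKg.
rewrite eg eh /= invgM !mulgA !mulgVK -!mulgA.
by rewrite [val b * _]mulgA bc !mulgA.
Qed.

Definition MbarN : set Nbar := range (fun x => cls x P1).

Definition TGarr := (Nbar * discrete_topology G)%type.
Definition TGelt (p : TGarr) : G := p.2.
(* x.g = g^-1 x *)
Definition TGsrc (p : TGarr) : Nbar := act (TGelt p)^-1 p.1.

Definition RGset : set TGarr := [set p | MbarN p.1 /\ MbarN (TGsrc p)].

Local Notation RG := (set_type RGset).

Definition RGrng (p : RG) : Nbar := (val p).1.
Definition RGsrc (p : RG) : Nbar := TGsrc (val p).

(* The default value of [insubd] is never used on composable pairs, see
   [RGmulE]. *)
Definition RGmul (p q : RG) : RG :=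
  insubd p ((val p).1, TGelt (val p) * TGelt (val q)).

Lemma RGinv_in (p : RG) : RGset (TGsrc (val p), (TGelt (val p))^-1).
Proof.
have [h1 h2] := set_valP p; split => //.
by rewrite /TGsrc /TGelt /= invgK -actM mulgV act1.
Qed.

Definition RGinv (p : RG) : RG :=
  exist _ (TGsrc (val p), (TGelt (val p))^-1) (mem_set (RGinv_in p)).

Lemma RGmulE (p q : RG) : RGsrc p = RGrng q ->
  val (RGmul p q) = ((val p).1, TGelt (val p) * TGelt (val q)).
Proof.
move=> e; rewrite /RGmul val_insubd ifT //; apply/mem_set.
have [h1 _] := set_valP p; have [_ h2] := set_valP q; split => //.
rewrite /TGsrc /TGelt /= invgM actM.
by have := e; rewrite /RGsrc /TGsrc => ->.
Qed.

Lemma RGsrc_mul p q : RGsrc p = RGrng q -> RGsrc (RGmul p q) = RGsrc q.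
Proof.
move=> e; rewrite {1}/RGsrc (RGmulE e) /TGsrc /TGelt /= invgM actM.
by have := e; rewrite /RGsrc /TGsrc => ->.
Qed.

Lemma RGrng_mul p q : RGsrc p = RGrng q -> RGrng (RGmul p q) = RGrng p.
Proof. by move=> e; rewrite /RGrng RGmulE. Qed.

Lemma RGmulA p q r : RGsrc p = RGrng q -> RGsrc q = RGrng r ->
  RGmul p (RGmul q r) = RGmul (RGmul p q) r.
Proof.
move=> e1 e2; apply: val_inj.
rewrite !RGmulE ?RGrng_mul ?RGsrc_mul //=.
by rewrite /TGelt /= mulgA.
Qed.

Lemma RGrng_inv p : RGrng (RGinv p) = RGsrc p. Proof. by []. Qed.

Lemma RGsrc_inv p : RGsrc (RGinv p) = RGrng p.
Proof. by rewrite /RGsrc /TGsrc /TGelt /= invgK -actM mulgV act1. Qed.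

Lemma RGinvK : involutive RGinv.
Proof.
move=> p; apply: val_inj; rewrite /= [TGsrc _]RGsrc_inv /RGrng /TGelt /= invgK.
by rewrite -surjective_pairing.
Qed.

Lemma RGmulKl p q : RGsrc p = RGrng q -> RGmul (RGinv p) (RGmul p q) = q.
Proof.
move=> e; apply: val_inj; rewrite !RGmulE ?RGsrc_inv ?RGrng_mul //=.
rewrite /TGelt /= mulKg; have := e; rewrite /RGsrc /RGrng => ->.
by rewrite -surjective_pairing.
Qed.

Lemma RGmulKr p q : RGsrc p = RGrng q -> RGmul (RGmul p q) (RGinv q) = p.
Proof.
move=> e; apply: val_inj; rewrite !RGmulE ?RGsrc_mul //=.
by rewrite /TGelt /= mulgK -surjective_pairing.
Qed.

Definition restricted_groupoid : topGroupoid :=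
  TopGroupoid RGrng_mul RGsrc_mul RGmulA RGrng_inv RGinvK RGmulKl RGmulKr.

End GroupSide.

Local Open Scope ring_scope.

(* R[i] with the topology of its norm *)
Definition Complex (R : realType) : numClosedFieldType := R[i].

(* C*-algebras, not assumed to be unital. *)
HB.mixin Record isCstarAlgebra (R : realType) (A : Type)
    of CompleteNormedModule (Complex R) A := {
  cmul : A -> A -> A;
  cstar : A -> A;
  cmulA : associative cmul;
  cmulDl : left_distributive cmul +%R;
  cmulDr : right_distributive cmul +%R;
  cmulZl : forall (k : Complex R) x y, cmul (k *: x) y = k *: cmul x y;
  cmulZr : forall (k : Complex R) x y, cmul x (k *: y) = k *: cmul x y;
  cstarD : forall x y, cstar (x + y) = cstar x + cstar y;
  cstarZ : forall (k : Complex R) x, cstar (k *: x) = k^* *: cstar x;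
  cstarM : forall x y, cstar (cmul x y) = cmul (cstar y) (cstar x);
  cstarK : involutive cstar;
  cnormM : forall x y, `|cmul x y| <= `|x| * `|y|;
  cnorm_star : forall x, `|cmul (cstar x) x| = `|x| ^+ 2
}.

#[short(type="cstarAlgType")]
HB.structure Definition CstarAlgebra (R : realType) :=
  {A of isCstarAlgebra R A & CompleteNormedModule (Complex R) A}.

Notation "x ⋆ y" := (cmul x y) (at level 40, left associativity) : ring_scope.

Definition cstar_hom (R : realType) (A B : cstarAlgType R) (f : A -> B) : Prop :=
  [/\ forall (k : Complex R) x y, f (k *: x + y) = k *: f x + f y,
      forall x y, f (x ⋆ y) = f x ⋆ f y
    & forall x, f (cstar x) = cstar (f x)].

Definition cstar_isomorphic (R : realType) (A B : cstarAlgType R) : Prop :=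
  exists f : A -> B, cstar_hom f /\ bijective f.

Section FullGroupoid.
Variables (R : realType) (K : topGroupoid).

Definition Cc (f : K -> Complex R) : Prop :=
  continuous f /\ compact (closure [set x | f x != 0]).

(* (f * g)(z) = \sum_(xy = z) f(x) g(y); for f, g in C_c(K) and K etale only
   finitely many terms are nonzero. *)
Definition conv (f g : K -> Complex R) : K -> Complex R := fun z =>
  \sum_(p \in [set p : K * K | gsrc p.1 = grng p.2 /\ gmul p.1 p.2 = z])
    f p.1 * g p.2.

Definition invol (f : K -> Complex R) : K -> Complex R :=
  fun z => (f (ginv z))^*.

(* *-homomorphisms from the convolution *-algebra C_c(K) to a C*-algebra; the
   values of pi outside C_c(K) are irrelevant. *)
Definition Cc_rep (B : cstarAlgType R) (pi : (K -> Complex R) -> B) : Prop :=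
  [/\ forall k f g, Cc f -> Cc g ->
        pi (fun x => k * f x + g x) = k *: pi f + pi g,
      forall f g, Cc f -> Cc g -> pi (conv f g) = pi f ⋆ pi g
    & forall f, Cc f -> pi (invol f) = cstar (pi f)].

(* (B, iota) is the completion of C_c(K), for K etale, in the full norm
   sup {|pi f| : pi a *-homomorphism of C_c(K) to a C*-algebra}.  By
   Gelfand-Naimark this is also the supremum over the *-representations on
   Hilbert spaces, and for K etale these are automatically bounded by the
   I-norm. *)
Definition is_full_groupoid_cstar (B : cstarAlgType R)
    (iota : (K -> Complex R) -> B) : Prop :=
  [/\ Cc_rep iota,
      closure [set iota f | f in Cc] = setT
    & forall f, Cc f ->
        supremums [set r | exists (D : cstarAlgType R) (pi : _ -> D),
                     Cc_rep pi /\ r = `|pi f| ] `|iota f| ].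

End FullGroupoid.

Section UniversalAlgebra.
Variables (R : realType) (G : groupType) (H M : set G).

(* Unital algebras with unit e.  Only the values of s on P and of u on M
   matter.  In clf_sum, the k chosen in the coset C is irrelevant: replacing k
   by k a m a^-1 does not change the term, by clf_su and clf_unitary. *)
Record CL_family (A : cstarAlgType R) (e : A) (s u : G -> A) : Prop :=
  CLFamily {
  clf_unit : forall x, e ⋆ x = x /\ x ⋆ e = x;
  clf_isometry : forall a, Pset H M a -> cstar (s a) ⋆ s a = e;
  clf_unitary : forall m, M m ->
    cstar (u m) ⋆ u m = e /\ u m ⋆ cstar (u m) = e;
  clf_sM : forall a b, Pset H M a -> Pset H M b -> s a ⋆ s b = s (a * b)%g;
  clf_uM : forall m n, M m -> M n -> u m ⋆ u n = u (m * n)%g;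
  clf_su : forall a m, Pset H M a -> M m ->
    s a ⋆ u m = u (a * m * a^-1)%g ⋆ s a;
  clf_sum : forall a, Pset H M a ->
    \sum_(C \in Mcosets M a)
      (let k := xget 1%g C in
       u k ⋆ s a ⋆ cstar (s a) ⋆ cstar (u k)) = e
}.

Definition is_universal_CL (A : cstarAlgType R) (e : A) (s u : G -> A) : Prop :=
  CL_family e s u /\
  forall (B : cstarAlgType R) (e' : B) (s' u' : G -> B), CL_family e' s' u' ->
    exists! f : A -> B,
      [/\ cstar_hom f, f e = e',
          forall a, Pset H M a -> f (s a) = s' a
        & forall m, M m -> f (u m) = u' m].

End UniversalAlgebra.

(* Main.v *)
(* In the groupoid algebra, the indicator functions of the slices [Mbar x {a}]
   and [Mbar x {m}] satisfy the relations of the isometries s_a and unitaries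
   u(m); this gives f : A -> B.  Conversely the projections
   u(k) s_a s_a^* u(k)^* are indexed by M/M_a and sum to 1, hence are
   orthogonal; refining a, they give a *-homomorphism D : C(Mbar) -> A.  With
   V_g = s_a^* u(m) s_b for g = a^-1 m b, which depends on g only,
   F |-> sum_g D(F(., g)) V_g is a representation of C_c of the groupoid on A.
   It is bounded by the full norm, so it extends to g : B -> A.  Uniqueness in
   the universal property of A gives g f = id, and f g = id holds on the dense
   image of C_c.

   Positivity enters only in three places, each treated without spectral
   theory: projections summing to 1 are orthogonal (an extreme point argument),
   *-homomorphisms defined on C(Mbar) are contractive and *-homomorphisms
   between C*-algebras are bounded (small self-adjoint elements are means of
   two unitaries). *)

From HB Require Import structures.
From mathcomp Require Import all_boot all_order all_algebra.
From mathcomp Require Import all_classical all_reals all_analysis.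
From mathcomp Require Import complex ring.
Require Import Defs.
Import numFieldNormedType.Exports.
Import Order.TTheory GRing.Theory Num.Theory.

Set Implicit Arguments.
Unset Strict Implicit.
Unset Printing Implicit Defensive.

Local Open Scope classical_set_scope.
Local Open Scope ring_scope.

(** * Norm estimates in C*-algebras *)

(** Both algebras have the shape of a partial crossed product. Slice functions multiply by
    (f,g)(f',g') = (f f'(.g), gg'), where f'(.g) is zero at the points x with x.g outside Mbar; on
    the other side V_g D(h) = D(h(.g)) V_g and V_g V_g' = D(1_dom g) V_gg'. The domains of slices
    are clopen in Mbar, so slices are compact and every continuous function on Mbar gives an element
    of C_c.

    The obstacle is that P need not commute. Common right multiples, from H = PP^-1, make the finite
    levels M/M_a directed, so that one level serves finitely many functions; common left multiples,
    from H = P^-1 P, give common denominators for the forms a^-1 m b.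

    For h factoring through M/M_a, D(h) is characterised by the scalars by which it acts on the
    projections of level a. This characterisation makes sense for any family, so it also identifies
    f(D(h)) with the copy of h on the unit slice; that is how f g = id is checked on C_c. The
    passage to limits uses only that f and g are bounded, here by 2. *)

Lemma complex_archi (R : realType) (c : Complex R) :
  0 <= c -> exists n, c < n%:R.
Proof.
move=> c0; exists (Num.Def.archi_bound (complex.Re c)).
have -> : c = complex.real_complex R (complex.Re c).
  by apply/esym/complex.RRe_real; exact: (ger0_real c0).
rewrite -(rmorph_nat (real_complex R)) ltcR.
by apply: archi_boundP; move: c0; rewrite lecE => /andP[].
Qed.

Lemma norm_arch_eq0 (R : realType) (V : normedModType (Complex R)) (v : V)
    (c : Complex R) : 0 <= c -> (forall n : nat, n%:R * `|v| <= c) -> v = 0.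
Proof.
move=> c0 h; apply/eqP; rewrite -normr_eq0; apply/negPn/negP => v0.
have v_gt0 : 0 < `|v| by rewrite lt0r v0 normr_ge0.
have [n cn] := complex_archi (divr_ge0 c0 (normr_ge0 v)).
by move: cn; rewrite ltr_pdivrMr // => /(le_lt_trans (h n)); rewrite ltxx.
Qed.

Section CstarAlgebra.
Variables (R : realType) (A : cstarAlgType R).
Local Notation C := (Complex R).
Implicit Types (x y z q w : A) (k : C).

Lemma cmul0x x : 0 ⋆ x = 0.
Proof. by apply: (addIr (0 ⋆ x)); rewrite -cmulDl !add0r. Qed.

Lemma cmulx0 x : x ⋆ 0 = 0.
Proof. by apply: (addIr (x ⋆ 0)); rewrite -cmulDr !add0r. Qed.

Lemma cmulNx x y : (- x) ⋆ y = - (x ⋆ y).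
Proof. by apply: (addrI (x ⋆ y)); rewrite -cmulDl !subrr cmul0x. Qed.

Lemma cmulxN x y : x ⋆ (- y) = - (x ⋆ y).
Proof. by apply: (addrI (x ⋆ y)); rewrite -cmulDr !subrr cmulx0. Qed.

Lemma cmulBl x y z : (x - y) ⋆ z = x ⋆ z - y ⋆ z.
Proof. by rewrite cmulDl cmulNx. Qed.

Lemma cmulBr x y z : z ⋆ (x - y) = z ⋆ x - z ⋆ y.
Proof. by rewrite cmulDr cmulxN. Qed.

Lemma cstar0 : cstar (0 : A) = 0.
Proof. by apply: (addIr (cstar 0)); rewrite -cstarD !add0r. Qed.

Lemma cstarN x : cstar (- x) = - cstar x.
Proof. by apply: (addrI (cstar x)); rewrite -cstarD !subrr cstar0. Qed.

Lemma cstarB x y : cstar (x - y) = cstar x - cstar y.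
Proof. by rewrite cstarD cstarN. Qed.

Lemma cmul_suml I (r : seq I) (P : pred I) (F : I -> A) y :
  (\sum_(i <- r | P i) F i) ⋆ y = \sum_(i <- r | P i) F i ⋆ y.
Proof. by apply: (big_morph (cmul^~ y)) => [u v|]; rewrite ?cmulDl ?cmul0x. Qed.

Lemma cmul_sumr I (r : seq I) (P : pred I) (F : I -> A) y :
  y ⋆ (\sum_(i <- r | P i) F i) = \sum_(i <- r | P i) y ⋆ F i.
Proof. by apply: (big_morph (cmul y)) => [u v|]; rewrite ?cmulDr ?cmulx0. Qed.

Lemma normx_star x : `|x| ^+ 2 = `|cstar x ⋆ x|.
Proof. by rewrite cnorm_star. Qed.

Lemma norm_cstar x : `|cstar x| = `|x|.
Proof.
have le_star y : `|y| <= `|cstar y|.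
  have [->|y0] := eqVneq y 0; first by rewrite normr0.
  rewrite -(ler_pM2r (x := `|y|)) ?normr_gt0 //.
  by rewrite -expr2 normx_star cnormM.
by apply/le_anti; rewrite le_star andbT -{2}[x]cstarK le_star.
Qed.

Lemma cnorm_star_eq0 x : cstar x ⋆ x = 0 -> x = 0.
Proof.
move=> h; apply/eqP; rewrite -normr_eq0 -sqrf_eq0.
by rewrite normx_star h normr0.
Qed.

Lemma norm_proj x : cstar x ⋆ x = x -> `|x| <= 1.
Proof.
move=> h; have [->|x0] := eqVneq x 0; first by rewrite normr0.
by rewrite -(ler_pM2r (x := `|x|)) ?normr_gt0 // -expr2 normx_star h mul1r.
Qed.

(** [x] is a partial isometry with initial projection [p]; in some later uses [p] is the image of a
    unit and need not be a unit. *)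
Lemma norm_isometry x p : cstar p ⋆ p = p -> cstar x ⋆ x = p -> `|x| <= 1.
Proof.
move=> hp hx; rewrite -(@ler_pXn2r _ 2) // ?nnegrE // normx_star hx expr1n.
exact: norm_proj.
Qed.

(* [(q + w) / 2 + (q - w) / 2 = q] is the step of a symmetric random walk; the
   element below is the expectation of the square of its position after n steps
   starting from j, with the two halves as operator weights. *)
Lemma random_walk_bound q w (n : nat) (j : C) :
  q ⋆ q = q -> q ⋆ w = w -> w ⋆ q = w ->
  `|q| <= 1 -> `|q + w| <= 1 -> `|q - w| <= 1 -> j \is Num.real ->
  `|(j ^+ 2 + n%:R) *: q + (2 * n%:R * j) *: w + (n%:R * (n%:R - 1)) *: (w ⋆ w)|
    <= j ^+ 2 + n%:R.
Proof.
move=> qq qw wq q1 qDw qBw.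
(* Coefficients of a cubic in [w] with [q] as unit: multiplication by [q] fixes them and by [w]
   shifts them, so the recursion becomes an identity of coefficients. *)
pose T (a b c d : C) := a *: q + b *: w + c *: (w ⋆ w) + d *: (w ⋆ w ⋆ w).
have TD a b c d a' b' c' d' :
    T a b c d + T a' b' c' d' = T (a + a') (b + b') (c + c') (d + d').
  by rewrite /T !scalerDl addrACA; congr (_ + _); rewrite addrACA;
     congr (_ + _); rewrite addrACA.
have TZ k a b c d : k *: T a b c d = T (k * a) (k * b) (k * c) (k * d).
  by rewrite /T !scalerDr !scalerA.
have qT a b c : q ⋆ T a b c 0 = T a b c 0.
  by rewrite /T scale0r addr0 !cmulDr !cmulZr cmulA qq qw.
have wT a b c : w ⋆ T a b c 0 = T 0 a b c.
  by rewrite /T !scale0r addr0 add0r !cmulDr !cmulZr cmulA wq.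
elim: n j => [|n IHn] j jr.
  rewrite !(mul0r, mulr0, scale0r, addr0) normrZ ger0_norm ?real_exprn_even_ge0 //.
  by rewrite ler_piMr // real_exprn_even_ge0.
have IH1 := IHn _ (realD jr (real1 _)); have IH2 := IHn _ (realB jr (real1 _)).
pose S i := (i ^+ 2 + n%:R) *: q + (2 * n%:R * i) *: w
            + (n%:R * (n%:R - 1)) *: (w ⋆ w).
have TE a b c : a *: q + b *: w + c *: (w ⋆ w) = T a b c 0.
  by rewrite /T scale0r addr0.
rewrite TE.
have -> : T (j ^+ 2 + n.+1%:R) (2 * n.+1%:R * j) (n.+1%:R * (n.+1%:R - 1)) 0
   = 2^-1 *: ((q + w) ⋆ S (j + 1) + (q - w) ⋆ S (j - 1)).
  rewrite /S !TE cmulDl cmulBl !qT !wT -[- T _ _ _ _]scaleN1r !TZ !TD TZ.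
  by rewrite -natr1; congr T; field.
rewrite normrZ ger0_norm ?invr_ge0 //.
have hS i c : `|S i| <= c -> `|(q + w) ⋆ S i| <= c /\ `|(q - w) ⋆ S i| <= c.
  move=> Sc; split; apply: (le_trans (cnormM _ _)).
    by apply: (le_trans _ Sc); rewrite ler_piMl.
  by apply: (le_trans _ Sc); rewrite ler_piMl.
have [h1 _] := hS _ _ IH1; have [_ h2] := hS _ _ IH2.
rewrite -(ler_pM2l (x := 2)) // mulrA divff ?mul1r ?pnatr_eq0 //.
apply: (le_trans (ler_normD _ _)); apply: (le_trans (lerD h1 h2)).
rewrite [X in X <= _](_ : _ = 2 * (j ^+ 2 + n.+1%:R)) // -natr1; ring.
Qed.

(** The projection [q] is an extreme point of the unit ball of its corner: the walk started at 0
    bounds the norm of [q + n w^2] by 1 for every [n], so [n |w^2| <= 2] and [w^2 = 0]. *)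
Lemma proj_extreme q w :
  q ⋆ q = q -> q ⋆ w = w -> w ⋆ q = w -> cstar w = w ->
  `|q| <= 1 -> `|q + w| <= 1 -> `|q - w| <= 1 -> w = 0.
Proof.
move=> qq qw wq sw q1 h1 h2; apply: cnorm_star_eq0; rewrite sw.
apply: (@norm_arch_eq0 _ _ _ 2) => // n.
have := random_walk_bound n.+1 qq qw wq q1 h1 h2 (real0 _).
have e : n.+1%:R - 1 = n%:R :> C by rewrite -natr1 addrK.
rewrite e expr0n /= !add0r mulr0 scale0r addr0.
rewrite -scalerA -scalerDr normrZ normr_nat ger_pMr ?ltr0Sn // => h.
have -> : n%:R * `|w ⋆ w| = `|q + n%:R *: (w ⋆ w) - q|.
  by rewrite addrAC subrr add0r normrZ normr_nat.
apply: le_trans (ler_normB _ _) _; rewrite -[2]/(1 + 1); apply: lerD => //.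
Qed.

(* Compressing by the projection [q], [q - 2 q p q = q (1 - 2 p) q] with
   [1 - 2 p] unitary. *)
Lemma norm_compress e q p :
  (forall x, e ⋆ x = x /\ x ⋆ e = x) ->
  q ⋆ q = q -> cstar q = q -> p ⋆ p = p -> cstar p = p ->
  `|q - 2 *: (q ⋆ p ⋆ q)| <= 1.
Proof.
move=> he qq sq pp sp.
have e_sa : cstar e = e by rewrite -[LHS](he _).2 -{2}[e]cstarK -cstarM (he _).2 cstarK.
have -> : q - 2 *: (q ⋆ p ⋆ q) = q ⋆ (e - 2 *: p) ⋆ q.
  by rewrite cmulBr cmulBl (he q).2 qq cmulZr cmulZl.
have q1 : `|q| <= 1 by apply: norm_proj; rewrite sq.
have u1 : `|e - 2 *: p| <= 1.
  apply: (norm_isometry (p := e)); first by rewrite e_sa (he _).1.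
  rewrite cstarB e_sa cstarZ sp conjC_nat cmulBl (he _).1 cmulBr (he _).2.
  rewrite cmulZl cmulZr pp scalerA -scalerBl -addrA -opprD -scalerDl.
  by rewrite (_ : 2 + (2 - 2 * 2) = 0) ?scale0r ?subr0 //; ring.
apply: le_trans (cnormM _ _) _; rewrite mulr_ile1 //.
by apply: le_trans (cnormM _ _) _; rewrite mulr_ile1.
Qed.

(** For self-adjoint [c] in the corner of a projection [q], [|q - 2 c| <= 1] means [0 <= c <= q]; in
    this form the condition adds up by the triangle inequality. *)
Lemma norm_sum_compress (I : Type) (r : seq I) q (c : I -> A) :
  (forall i, `|q - 2 *: c i| <= 1) ->
  `|(size r)%:R *: q - 2 *: \sum_(i <- r) c i| <= (size r)%:R.
Proof.
move=> hc; elim: r => [|i r IH] /=.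
  by rewrite big_nil scale0r scaler0 subrr normr0.
have -> : (size r).+1%:R *: q - 2 *: (\sum_(j <- i :: r) c j) =
    (size r)%:R *: q - 2 *: (\sum_(j <- r) c j) + (q - 2 *: c i).
  rewrite big_cons -[(size r).+1%:R]natr1 scalerDl scale1r scalerDr opprD.
  by rewrite [- _ - _]addrC addrACA.
by rewrite -[(size r).+1%:R]natr1; apply: le_trans (ler_normD _ _) _; apply: lerD.
Qed.

(** With [n] the length of [r] and [w = 2/(n+1) c i], the norm conditions put [q + w] and [q - w] in
    the unit ball, where [q] is extreme. This is the norm form of the fact that positive elements
    with sum zero vanish. *)
Lemma sum_compress_eq0 (I : Type) (r : seq I) q (c : I -> A) i :
  q ⋆ q = q -> cstar q = q ->
  (forall i, [/\ q ⋆ c i = c i, c i ⋆ q = c i, cstar (c i) = c i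
             & `|q - 2 *: c i| <= 1]) ->
  c i + \sum_(j <- r) c j = 0 -> c i = 0.
Proof.
move=> qq sq hc sum0; have [qc cq sc ci1] := hc i.
have q1 : `|q| <= 1 by apply: norm_proj; rewrite sq.
have hS : \sum_(j <- r) c j = - c i.
  by apply/eqP; rewrite -addr_eq0 addrC sum0.
have := @norm_sum_compress _ r q c (fun i => let: And4 _ _ _ h := hc i in h).
rewrite hS scalerN opprK; set n := (size r)%:R : C => cn.
have n0 : 0 <= n by rewrite ler0n.
have n1 : 0 < n + 1 by rewrite ltr_wpDl.
have w0 : (2 / (n + 1)) *: c i = 0.
  apply: (@proj_extreme q) => //.
  - by rewrite cmulZr qc.
  - by rewrite cmulZl cq.
  - rewrite cstarZ sc; congr (_ *: _).
    by apply/CrealP; rewrite realE divr_ge0 // ltW.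
  - rewrite -(ler_pM2l n1) mulr1 -{1}[n + 1]ger0_norm ?(ltW n1) // -normrZ.
    rewrite scalerDr scalerA mulrCA divff ?gt_eqF // mulr1 scalerDl scale1r.
    by rewrite addrAC; apply: le_trans (ler_normD _ _) _; apply: lerD.
  - rewrite -(ler_pM2l n1) mulr1 -{1}[n + 1]ger0_norm ?(ltW n1) // -normrZ.
    rewrite scalerBr scalerA mulrCA divff ?gt_eqF // mulr1 scalerDl scale1r.
    rewrite -addrA; apply: le_trans (ler_normD _ _) _; apply: lerD => //.
    by rewrite normrZ ger0_norm // ler_piMr.
move/eqP: w0; rewrite scaler_eq0 mulf_eq0 invr_eq0 pnatr_eq0 /= gt_eqF //=.
by move/eqP.
Qed.

(** Compress the sum by [p i] and cancel the term of [i], itself [p i]: the other compressions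
    [p i p k p i] have sum zero, hence vanish, and [p i p j p i = 0] forces [p j p i = 0] by the
    C*-identity. *)
Lemma proj_sum_orth (I : choiceType) (S : set I) (p : I -> A) e i j :
  (forall x, e ⋆ x = x /\ x ⋆ e = x) -> finite_set S ->
  (forall i, S i -> p i ⋆ p i = p i /\ cstar (p i) = p i) ->
  \sum_(i \in S) p i = e -> S i -> S j -> i != j -> p i ⋆ p j = 0.
Proof.
move=> he fS hpS sum1 Si Sj ij.
(* Extension by zero outside [S] makes every [p i] a projection, so the conditions on the
   compressions hold for all indices. *)
wlog hp : p hpS sum1 / forall i, p i ⋆ p i = p i /\ cstar (p i) = p i => [h|].
  have pE (m : I) : S m -> patch (fun=> 0) S p m = p m by move=> Sm; rewrite patchT ?inE.
  rewrite -(pE i) // -(pE j) //; apply: h => [k Sk||k].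
  - by rewrite pE //; exact: hpS.
  - by rewrite -[RHS]sum1; apply: eq_fsbigr => k /set_mem; exact: pE.
  - rewrite /patch; case: ifPn => [/set_mem|_]; first exact: hpS.
    by rewrite cmul0x cstar0.
have [qq sq] := hp i.
pose c (m : I) := p i ⋆ p m ⋆ p i.
have hc (k : I) : [/\ p i ⋆ c k = c k, c k ⋆ p i = c k, cstar (c k) = c k
                & `|p i - 2 *: c k| <= 1].
  have [pk sk] := hp k; split; rewrite /c.
  - by rewrite !cmulA qq.
  - by rewrite -!cmulA qq.
  - by rewrite !cstarM sq sk cmulA.
  - exact: norm_compress.
have cj0 : c j = 0.
  have : c i + \sum_(k \in S `\ i) c k = c i.
    rewrite -(fsbigD1 i) //= fsbig_finite //= -cmul_suml -cmul_sumr.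
    by rewrite -fsbig_finite // sum1 (he _).2 /c qq.
  move/(canRL (addKr _)); rewrite addNr (fsbigD1 j); last 2 first.
  - exact: finite_setD.
  - by split => //; apply/eqP; rewrite eq_sym.
  rewrite fsbig_finite ?finite_setD //=; last by do 2 apply: finite_setD.
  exact: (sum_compress_eq0 qq sq hc).
have h : cstar (p j ⋆ p i) ⋆ (p j ⋆ p i) = 0.
  have [pj sj] := hp j.
  by rewrite cstarM sq sj cmulA -(cmulA (p i)) pj; exact: cj0.
have := cnorm_star_eq0 h; move/(congr1 cstar).
by rewrite cstarM cstar0 sq (hp j).2.
Qed.

End CstarAlgebra.

(** * Continuity of complex-valued functions *)

Lemma continuous_normP (R : realType) (f : Complex R -> Complex R) :
  (forall z e, 0 < e -> exists2 d, 0 < d &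
     forall w, `|z - w| < d -> `|f z - f w| <= e) -> continuous f.
Proof.
move=> h z; apply: (@cvgrPdist_le _ (Complex R) _ (nbhs z) (nbhs_filter z) f (f z)).2.
move=> e e0; have [d d0 hd] := h z e e0.
by apply/nbhs_ballP; exists d => //= w; exact: hd.
Qed.

Section ComplexContinuity.
Variables (R : realType) (T : topologicalType).
Implicit Types f g : T -> Complex R.

Lemma ccontinuousD f g :
  continuous f -> continuous g -> continuous (fun x => f x + g x).
Proof. by move=> cf cg x; apply: (cvgD (cf x) (cg x)). Qed.

Lemma ccontinuousM f g :
  continuous f -> continuous g -> continuous (fun x => f x * g x).
Proof. by move=> cf cg x; apply: (cvgM (cf x) (cg x)). Qed.

Lemma ccontinuous_comp (F : Complex R -> Complex R) f :
  continuous F -> continuous f -> continuous (F \o f).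
Proof. by move=> cF cf x; apply: continuous_comp; [exact: cf|exact: cF]. Qed.

End ComplexContinuity.

Lemma sqrtC_dist (C : numClosedFieldType) (a b : C) :
  0 <= a -> 0 <= b -> `|sqrtC a - sqrtC b| ^+ 2 <= `|a - b|.
Proof.
move=> a0 b0; rewrite -{2}[a]sqrtCK -{2}[b]sqrtCK subr_sqr normrM expr2.
rewrite ler_wpM2l // [leRHS]ger0_norm ?addr_ge0 ?sqrtC_ge0 //.
by apply: le_trans (ler_normB _ _) _; rewrite !ger0_norm ?sqrtC_ge0.
Qed.

Lemma continuous_sqrtC_norm (R : realType) :
  continuous (fun z : Complex R => sqrtC `|z|).
Proof.
apply: continuous_normP => z e e0; exists (e ^+ 2); first by rewrite exprn_gt0.
move=> w zw; rewrite -(@ler_pXn2r _ 2) ?nnegrE ?(ltW e0) //.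
apply: le_trans (sqrtC_dist _ _) _ => //.
by apply: le_trans (ltW zw); exact: ler_dist_dist.
Qed.

Lemma continuous_conjC (R : realType) :
  continuous (fun z : Complex R => z^* ).
Proof.
apply: continuous_normP => z e e0; exists e => // w zw.
by rewrite -rmorphB norm_conjC ltW.
Qed.

(** * Contractivity of *-homomorphisms on algebras of functions *)

Section FunctionAlgebra.
Variables (R : realType) (X : Type) (D : cstarAlgType R).
Local Notation C := (Complex R).
Variables (L : set (X -> C)) (rho : (X -> C) -> D).
Hypothesis L_comp : forall (F : C -> C) f, continuous F -> L f -> L (F \o f).
Hypothesis rho_lin : forall k f g, L f -> L g ->
  rho (fun x => k * f x + g x) = k *: rho f + rho g.
Hypothesis rho_mul : forall f g, L f -> L g ->
  rho (fun x => f x * g x) = rho f ⋆ rho g.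
Hypothesis rho_star : forall f, L f -> rho (fun x => (f x)^* ) = cstar (rho f).

Lemma rho_scale k f : L f -> rho (fun x => k * f x) = k *: rho f.
Proof.
(* Linearity is available in the form [k f + g]; splitting off one copy of [f] avoids the zero
   function. *)
move=> Lf; transitivity (rho (fun x => (k - 1) * f x + f x)).
  by congr rho; apply/funext => x; ring.
by rewrite rho_lin // scalerBl scale1r subrK.
Qed.

Lemma norm_rho_unitary f : L f -> (forall x, (f x)^* * f x = 1) -> `|rho f| <= 1.
Proof.
move=> Lf f1; pose one := (fun=> 1) : X -> C.
have L1 : L one by apply: (L_comp (F := fun=> 1)) Lf; exact: cst_continuous.
apply: (@norm_isometry _ _ _ (rho one)).
  rewrite -rho_star // -rho_mul //; last first.
    exact: (L_comp (F := fun z => z^* ) (@continuous_conjC R)).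
  by congr rho; apply/funext => x; rewrite /one /= rmorph1 mulr1.
rewrite -rho_star // -rho_mul //; last first.
  exact: (L_comp (F := fun z => z^* ) (@continuous_conjC R)).
by congr rho; apply/funext => x; rewrite f1.
Qed.

(* [t = |f|^2 / c^2] is the mean of the unitaries [t +- i (1 - t^2)^{1/2}]. *)
Lemma norm_rho_le f c : L f -> 0 <= c -> (forall x, `|f x| <= c) -> `|rho f| <= c.
Proof.
move=> Lf; rewrite le0r => /orP[/eqP-> f0|c0 fc].
  have -> : f = (fun x => 0 * f x).
    by apply/funext => x; rewrite mul0r; apply/eqP; rewrite -normr_le0.
  by rewrite rho_scale // scale0r normr0.
pose t (z : C) := (`|z| / c) ^+ 2.
(* The modulus under the root makes [psi s] continuous on the whole plane; where [|z| <= c], so that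
   [t z <= 1], it changes nothing. *)
pose psi (s : C) (z : C) := t z + s * sqrtC `|1 - t z ^+ 2|.
have ct : continuous t.
  have cn : continuous (fun z : C => `|z| / c).
    apply: continuous_normP => z e e0; exists (e * c); first exact: mulr_gt0.
    move=> w zw; rewrite -mulrBl normrM [X in _ * X]gtr0_norm ?invr_gt0 //.
    by rewrite ler_pdivrMr //; apply: le_trans (ltW zw); exact: ler_dist_dist.
  exact: ccontinuousM.
have cpsi s : continuous (psi s).
  apply: (ccontinuousD ct (g := fun z => s * sqrtC `|1 - t z ^+ 2|)).
  apply: (ccontinuousM (f := fun=> s) (g := fun z => sqrtC `|1 - t z ^+ 2|)).
    exact: cst_continuous.
  apply: (ccontinuous_comp (f := fun z => 1 - t z ^+ 2) (@continuous_sqrtC_norm R)).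
  apply: (ccontinuousD (f := fun=> 1) (g := fun z => - t z ^+ 2)).
    exact: cst_continuous.
  rewrite (_ : (fun z => - _) = fun z => -1 * (t z * t z)).
    apply: (ccontinuousM (f := fun=> -1) (g := fun z => t z * t z)).
      exact: cst_continuous.
    exact: ccontinuousM.
  by apply/funext => z; rewrite mulN1r expr2.
(* For [s = i] or [-i] and real [t], [r], the conjugate of [t + s r] is [t - s r], and their product
   is [t^2 + r^2], here equal to 1. *)
have upsi s : s^* = - s -> s ^+ 2 = -1 -> `|rho (psi s \o f)| <= 1.
  move=> s1 s2; apply: norm_rho_unitary => [|x].
    exact: (L_comp (cpsi s) Lf).
  rewrite compE.
  have t0 : 0 <= t (f x) by rewrite exprn_ge0 // divr_ge0 // ltW.
  have t1 : t (f x) <= 1.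
    by rewrite exprn_ile1 // ?divr_ge0 ?(ltW c0) // ler_pdivrMr // mul1r.
  have conjDM (a b : C) : 0 <= a -> 0 <= b -> (a + s * b)^* = a - s * b.
    move=> /geC0_conj a_sa /geC0_conj b_sa.
    rewrite rmorphD rmorphM -mulNr; congr (_ + _ * _); [exact: a_sa|exact: s1|exact: b_sa].
  rewrite /psi conjDM ?sqrtC_ge0 // -subr_sqr [(s * _) ^+ 2]exprMn sqrtCK s2 mulN1r opprK.
  have tt : 0 <= 1 - t (f x) ^+ 2 by rewrite subr_ge0; exact: exprn_ile1.
  rewrite (ger0_norm tt) addrC; exact: subrK.
have hf : rho (fun x => (f x)^* * f x) =
    (c ^+ 2 / 2) *: (rho (psi 'i \o f) + rho (psi (- 'i) \o f)).
  rewrite scalerDr -(rho_scale _ (L_comp (cpsi (- 'i)) Lf)).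
  rewrite -rho_lin; [|exact: (L_comp (cpsi _) Lf)|].
    congr rho; apply/funext => x; rewrite !compE /psi /t.
    by rewrite mulrC -normCK; field; rewrite gt_eqF.
  apply: (L_comp (F := fun z => c ^+ 2 / 2 * psi (- 'i) z)) Lf.
  apply: (ccontinuousM (f := fun=> c ^+ 2 / 2)); last exact: cpsi.
  exact: cst_continuous.
rewrite -(@ler_pXn2r _ 2) ?nnegrE ?(ltW c0) //.
rewrite normx_star -rho_star // -rho_mul //; last first.
  exact: (L_comp (F := fun z => z^* ) (@continuous_conjC R)).
have c20 : 0 <= c ^+ 2 / 2 by rewrite divr_ge0 // exprn_ge0 // ltW.
rewrite hf normrZ (ger0_norm c20).
rewrite [leRHS](_ : _ = c ^+ 2 / 2 * 2); last by rewrite mulfVK.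
rewrite ler_wpM2l //; apply: le_trans (ler_normD _ _) _.
rewrite -[2]/(1 + 1); apply: lerD; apply: upsi.
- exact: conjCi.
- exact: sqrCi.
- by rewrite rmorphN; congr (- _); exact: conjCi.
- by rewrite sqrrN sqrCi.
Qed.

End FunctionAlgebra.

(** * Limits of sequences with geometric steps *)

Section GeometricLimit.
Variable R : realType.
Local Notation C := (Complex R).

Lemma half_pow_small (e : C) : 0 < e -> exists n, (2^-1 : C) ^+ n < e.
Proof.
move=> e0; have ie0 : 0 <= e^-1 by rewrite invr_ge0 ltW.
have [n en] := complex_archi ie0; exists n.
rewrite exprVn invf_plt ?posrE ?exprn_gt0 //.
by apply: lt_trans en _; rewrite -natrX ltr_nat ltn_expl.
Qed.

Lemma geometric_limit (V : completeNormedModType C) (u : nat -> V) :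
  (forall n, `|u n.+1 - u n| <= 2^-1 ^+ n) ->
  exists l, forall n, `|u n - l| <= 2 * 2^-1 ^+ n.
Proof.
move=> hu; pose h n : C := 2^-1 ^+ n.
have hS n : h n = h n.+1 + h n.+1 by rewrite /h exprS -mulrDl -mulr2n; field.
have h0 n : 0 <= h n by rewrite exprn_ge0 // invr_ge0.
have step n k : `|u (n + k)%N - u n| <= 2 * h n - 2 * h (n + k)%N.
  elim: k => [|k IH]; first by rewrite addn0 !subrr normr0.
  rewrite addnS -(subrK (u (n + k)%N) (u (n + k).+1)) -addrA.
  apply: le_trans (ler_normD _ _) _; apply: le_trans (lerD (hu _) IH) _.
  by rewrite -/(h (n + k)%N) (hS (n + k)%N); rewrite le_eqVlt; apply/orP; left;
     apply/eqP; ring.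
have dist n m : (n <= m)%N -> `|u m - u n| <= 2 * h n.
  move=> nm; rewrite -(subnKC nm); apply: le_trans (step _ _) _.
  by rewrite gerBl mulr_ge0.
have cu : cvg (u @ \oo).
  apply: cauchy_cvg; apply: cauchy_exP => e e0.
  have [n hn] := half_pow_small (divr_gt0 e0 (ltr0Sn _ 1)).
  exists (u n); exists n => // m /= nm; rewrite -ball_normE /= distrC.
  by apply: le_lt_trans (dist _ _ nm) _; rewrite -ltr_pdivlMl // mulrC.
exists (lim (u @ \oo)) => n; apply/ler_addgt0Pr => e e0.
have [N _ hN] := cvgr_distC_le _ _ cu _ e0.
have := hN (N + n)%N (leq_addr _ _) => /= {}hN.
rewrite -(subrK (u (N + n)%N) (u n)) -addrA.
apply: le_trans (ler_normD _ _) _; apply: lerD => //.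
by rewrite distrC; apply: dist; exact: leq_addl.
Qed.

End GeometricLimit.

(** * Boundedness of *-homomorphisms between C*-algebras *)

Section AutomaticContinuity.
Variables (R : realType) (A : cstarAlgType R).
Local Notation C := (Complex R).

(* The fixed point of [w |-> (x^2 + w^2) / 2] makes [e - w] a square root of
   [e - x^2]. *)
Lemma sqrt_fixpoint (x : A) : cstar x = x -> `|x| <= 2^-1 ->
  exists w, [/\ cstar w = w, x ⋆ w = w ⋆ x & 2 *: w = x ⋆ x + w ⋆ w].
Proof.
move=> sx x1; pose F (w : A) := (2^-1 : C) *: (x ⋆ x + w ⋆ w).
pose u n := iter n F 0.
have halfP : 0 <= (2^-1 : C) by rewrite invr_ge0.
have q4 : `|x ⋆ x| <= (4^-1 : C).
  apply: le_trans (cnormM _ _) _; rewrite (_ : 4^-1 = 2^-1 * 2^-1 :> C); last by field.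
  exact: ler_pM.
have le14 : (4^-1 : C) <= 1 by rewrite invf_le1 ?ler1n.
(* The ball of radius 1/4 is invariant under [F] since [|x^2| <= 1/4]; on it [F] has Lipschitz
   constant at most 1/4, estimated by 1/2 to match [geometric_limit]. *)
have u4 n : `|u n| <= (4^-1 : C).
  elim: n => [|n IH]; first by rewrite /u /= normr0 invr_ge0.
  rewrite /u iterS -/(u n) /F normrZ ger0_norm //.
  rewrite (_ : 4^-1 = 2^-1 * (4^-1 + 4^-1) :> C); last by field.
  rewrite ler_wpM2l //; apply: le_trans (ler_normD _ _) _; apply: lerD => //.
  apply: le_trans (cnormM _ _) _; rewrite -[leRHS]mulr1.
  by apply: ler_pM => //; exact: le_trans le14.
have FB v w : `|v| <= 4^-1 -> `|w| <= 4^-1 -> `|F v - F w| <= 2^-1 * `|v - w|.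
  move=> v4 w4; rewrite /F -scalerBr normrZ ger0_norm // ler_wpM2l //.
  have -> : x ⋆ x + v ⋆ v - (x ⋆ x + w ⋆ w) = v ⋆ (v - w) + (v - w) ⋆ w.
    by rewrite cmulBl cmulBr opprD addrACA subrr add0r addrA subrK.
  apply: le_trans (ler_normD _ _) _.
  have h : `|v| * `|v - w| + `|v - w| * `|w| <= `|v - w|.
    rewrite [X in X + _]mulrC -mulrDr ler_piMr //.
    apply: le_trans (lerD v4 w4) _; rewrite (_ : 4^-1 + 4^-1 = 2^-1 :> C); last by field.
    by rewrite invf_le1 ?ler1n.
  by apply: le_trans h; apply: lerD; exact: cnormM.
have step n : `|u n.+1 - u n| <= 2^-1 ^+ n.
  elim: n => [|n IH]; first by rewrite subr0 expr0; apply: le_trans (u4 1%N) _.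
  rewrite exprS {1}/u iterS -/(u n.+1) [X in _ - X]/u iterS -/(u n).
  by apply: le_trans (FB _ _ (u4 _) (u4 _)) _; rewrite ler_wpM2l.
have [w hw] := geometric_limit step.
(* Identities satisfied by the iterates pass to [w]: a difference dominated by [K |u n - w|] for all
   [n] is zero. *)
have closeP (v v' : A) (K : C) : 0 <= K ->
    (forall n, `|v - v'| <= K * `|u n - w|) -> v = v'.
  move=> K0 h; apply/eqP; rewrite -subr_eq0 -normr_le0; apply/ler_addgt0Pr => e e0.
  rewrite add0r; have K1 : 0 < K + 1 by rewrite ltr_wpDl.
  have [n hn] := half_pow_small (divr_gt0 e0 (mulr_gt0 K1 (ltr0Sn _ 1))).
  apply: le_trans (h n) _.
  apply: (@le_trans _ _ ((K + 1) * `|u n - w|)); first by rewrite ler_wpM2r // lerDl.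
  rewrite -ler_pdivlMl //; apply: le_trans (hw n) _; rewrite mulrC -ler_pdivlMr //.
  by apply: ltW; apply: lt_le_trans hn _; rewrite invfM mulrA [_^-1 * e]mulrC.
have u_sa n : cstar (u n) = u n.
  elim: n => [|n IH]; first exact: cstar0.
  rewrite {1}/u iterS -/(u n) /F cstarZ cstarD !cstarM sx IH /u iterS.
  by congr (_ *: _); apply/geC0_conj.
have u_comm n : x ⋆ u n = u n ⋆ x.
  elim: n => [|n IH]; first by rewrite cmul0x cmulx0.
  rewrite /u iterS -/(u n) /F cmulZl cmulZr cmulDl cmulDr !cmulA IH -!cmulA IH.
  by rewrite cmulA.
have w4 : `|w| <= (4^-1 : C).
  apply/ler_addgt0Pr => e e0.
  have [n hn] := half_pow_small (divr_gt0 e0 (ltr0Sn _ 1)).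
  rewrite -(subrK (u n) w) addrC; apply: le_trans (ler_normD _ _) _.
  apply: lerD => //; rewrite distrC; apply: le_trans (hw n) _.
  by rewrite mulrC -ler_pdivlMr // ltW.
exists w; split.
- apply: (closeP _ _ 2) => // n.
  rewrite -(subrK (u n) (cstar w)) -addrA mulr2n mulrDl mul1r.
  apply: le_trans (ler_normD _ _) _; apply: lerD => //.
  by rewrite -{1}[u n]u_sa -cstarB norm_cstar distrC.
- apply: (closeP _ _ (2 * `|x|)) => [|n]; first by rewrite mulr_ge0.
  rewrite -(subrK (x ⋆ u n) (x ⋆ w)) -addrA {2}u_comm -cmulBr -cmulBl.
  apply: le_trans (ler_normD _ _) _.
  rewrite -mulrA mulr2n mulrDl mul1r; apply: lerD.
    by apply: le_trans (cnormM _ _) _; rewrite distrC.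
  by apply: le_trans (cnormM _ _) _; rewrite mulrC.
- have -> : x ⋆ x + w ⋆ w = 2 *: F w by rewrite /F scalerA divff ?scale1r ?pnatr_eq0.
  congr (_ *: _).
  have lim0 n : `|w - F w| <= 2 * (2 * 2^-1 ^+ n).
    rewrite -{1}(subrK (u n.+1) w) -addrA; apply: le_trans (ler_normD _ _) _.
    rewrite [leRHS]mulr_natl mulr2n; apply: lerD.
      rewrite distrC; apply: le_trans (hw _) _; rewrite exprS mulrA.
      apply: ler_wpM2r; first exact: exprn_ge0.
      by rewrite divff ?pnatr_eq0 // ler1n.
    rewrite {1}/u iterS -/(u n); apply: le_trans (FB _ _ (u4 _) w4) _.
    apply: le_trans (hw n); rewrite ler_piMl // invf_le1 ?ler1n //.
  apply/eqP; rewrite -subr_eq0 -normr_le0; apply/ler_addgt0Pr => e e0; rewrite add0r.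
  have [n hn] := half_pow_small (divr_gt0 e0 (ltr0Sn _ 3)).
  apply: le_trans (lim0 n) _; rewrite mulrA -natrM mulrC -ler_pdivlMr //.
  exact: ltW.
Qed.

(** For [x] self-adjoint with [|x| <= 1/2] and [w] from [sqrt_fixpoint], [y = e - w] commutes with
    [x] and [x^2 + y^2 = e]. So [x] is the mean of the unitaries [x + i y] and [x - i y], whose
    images have norm at most 1. The factor 2 comes from rescaling to norm 1/2; the C*-identity
    handles general elements. *)
Lemma cstar_hom_bounded (B : cstarAlgType R) (e : A) (f : A -> B) :
  (forall x, e ⋆ x = x /\ x ⋆ e = x) -> cstar_hom f ->
  forall x, `|f x| <= 2 * `|x|.
Proof.
move=> he [flin fM fS].
have e_sa : cstar e = e.
  by rewrite -[LHS](he _).2 -{2}[e]cstarK -cstarM (he _).2 cstarK.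
have f0 : f 0 = 0.
  have := flin (-1) 0 0; rewrite scaler0 addr0 => ->.
  by rewrite scaleN1r addNr.
have fZ k x : f (k *: x) = k *: f x by rewrite -[k *: x]addr0 flin f0 addr0.
have fD x y : f (x + y) = f x + f y by rewrite -[x]scale1r flin !scale1r.
have sa_half x : cstar x = x -> `|x| <= 2^-1 -> `|f x| <= 1.
  move=> sx x1; have [w [sw xw ww]] := sqrt_fixpoint sx x1.
  pose y := e - w.
  have xy : x ⋆ y = y ⋆ x by rewrite cmulBr cmulBl xw (he x).1 (he x).2.
  have sy : cstar y = y by rewrite cstarB e_sa sw.
  have yy : x ⋆ x + y ⋆ y = e.
    rewrite cmulBl !cmulBr !(he _).1 (he w).2 opprB addrCA.
    have -> : x ⋆ x + (w ⋆ w - w) = w.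
      by rewrite addrA -ww scaler_nat mulr2n addrK.
    by rewrite subrK.
  have unitary (s : C) : s^* = - s -> s ^+ 2 = -1 -> `|f (x + s *: y)| <= 1.
    move=> s1 s2; apply: (@norm_isometry _ _ _ (f e)).
      by rewrite -fS -fM e_sa (he e).1.
    rewrite -fS -fM cstarD cstarZ sx sy s1; congr f.
    rewrite cmulDl !cmulDr !cmulZl !cmulZr scalerA xy scaleNr mulNr -expr2 s2 opprK.
    by rewrite scale1r addrA addrK.
  have -> : x = 2^-1 *: ((x + 'i *: y) + (x + (- 'i) *: y)).
    rewrite addrACA -scalerDl subrr scale0r addr0.
    rewrite -[x + x]mulr2n -[x *+ 2]scaler_nat scalerA.
    by rewrite mulVf ?scale1r ?pnatr_eq0.
  rewrite fZ normrZ ger0_norm ?invr_ge0 // fD ler_pdivrMl // mulr1.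
  apply: le_trans (ler_normD _ _) _; rewrite -[2]/(1 + 1); apply: lerD.
    by apply: unitary; [exact: conjCi|exact: sqrCi].
  by apply: unitary; [rewrite rmorphN; congr (- _); exact: conjCi|rewrite sqrrN; exact: sqrCi].
have sa_bound x : cstar x = x -> `|f x| <= 2 * `|x|.
  move=> sx; have [->|x0] := eqVneq x 0; first by rewrite f0 !normr0 mulr0.
  have n0 : 0 < 2 * `|x| by rewrite mulr_gt0 ?normr_gt0.
  pose k := (2 * `|x|)^-1; have k0 : 0 <= k by rewrite invr_ge0 ltW.
  have sk : cstar (k *: x) = k *: x.
    by rewrite cstarZ sx; congr (_ *: _); exact: geC0_conj.
  have nk : `|k *: x| <= 2^-1.
    by rewrite normrZ (ger0_norm k0) /k invfM -mulrA mulVf ?normr_eq0 // mulr1.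
  have := sa_half _ sk nk.
  by rewrite fZ normrZ (ger0_norm k0) /k ler_pdivrMl // mulr1.
move=> x; rewrite -(@ler_pXn2r _ 2) ?nnegrE ?mulr_ge0 //.
rewrite normx_star -fS -fM; apply: le_trans (sa_bound _ _) _.
  by rewrite cstarM cstarK.
rewrite cnorm_star exprMn ler_wpM2r ?exprn_ge0 // expr2.
by rewrite ler_peMl // ler1n.
Qed.

End AutomaticContinuity.

(* Replaces the minimum, [C] being only partially ordered. *)
Lemma pos_lower_bound (C : numFieldType) (d1 d2 : C) : 0 < d1 -> 0 < d2 ->
  exists d, [/\ 0 < d, d <= d1 & d <= d2].
Proof.
move=> d1_0 d2_0; have s0 : 0 < d1 + d2 by rewrite addr_gt0.
exists (d1 * d2 / (d1 + d2)); split; first by rewrite divr_gt0 // mulr_gt0.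
- by rewrite ler_pdivrMr // ler_pM2l // lerDr ltW.
- by rewrite ler_pdivrMr // mulrC ler_pM2l // lerDl ltW.
Qed.

(* Extension by uniform continuity of a contractive map [D0] from [L] to its
   closure. Closeness in the source is an abstract relation, so that the source
   may be a C*-algebra or the functions on a space with the uniform norm. *)
Section Extension.
Variables (R : realType) (A : cstarAlgType R) (V : Type).
Local Notation C := (Complex R).
Variables (close : V -> V -> C -> Prop) (L : set V) (D0 : V -> A).

Definition approximable (v : V) : Prop :=
  forall e, 0 < e -> exists l, L l /\ close v l e.

Hypothesis close_mono : forall v l c d, close v l c -> c <= d -> close v l d.
Hypothesis D0_contr : forall v l m c d, L l -> L m ->
  close v l c -> close v m d -> `|D0 l - D0 m| <= c + d.

Lemma extension_ex : exists D : V -> A, forall v, approximable v ->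
  forall l c, L l -> close v l c -> `|D v - D0 l| <= c.
Proof.
suff /choice [D hD] : forall v, exists T : A, approximable v ->
    forall l c, L l -> close v l c -> `|T - D0 l| <= c by exists D.
move=> v; have [av|nav] := pselect (approximable v); last by exists 0.
have half_gt0 n : 0 < (2^-1 : C) ^+ n by rewrite exprn_gt0 // invr_gt0.
(* The shift to [n.+1] makes consecutive values differ by at most [2^-(n+2) + 2^-(n+1) <= 2^-n]. *)
have /choice [l hl] n : exists l, L l /\ close v l (2^-1 ^+ n.+1) by exact: av.
have step n : `|D0 (l n.+1) - D0 (l n)| <= 2^-1 ^+ n.
  have [L1 c1] := hl n.+1; have [L2 c2] := hl n.
  apply: le_trans (D0_contr L1 L2 c1 c2) _.
  have -> : 2^-1 ^+ n = 2^-1 ^+ n.+1 + 2^-1 ^+ n.+1 :> C.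
    by rewrite exprS -mulrDl -mulr2n; field.
  by rewrite lerD2r [leLHS]exprS ler_piMl ?(ltW (half_gt0 _)) // invf_le1 ?ler1n.
have [T hT] := geometric_limit step.
exists T => _ m c Lm vm; apply/ler_addgt0Pr => e e0.
(* The error beyond [c] is [2 * 2^-n] from the limit plus [2^-(n+1)] from [l n], at most [3 * 2^-n];
   hence [e / 3]. *)
have [n hn] := half_pow_small (divr_gt0 e0 (ltr0Sn _ 2)).
rewrite -(subrK (D0 (l n)) T) -addrA; apply: le_trans (ler_normD _ _) _.
have [L2 c2] := hl n.
have hT' : `|T - D0 (l n)| <= 2 * 2^-1 ^+ n by rewrite distrC.
apply: le_trans (lerD hT' (D0_contr L2 Lm c2 vm)) _.
rewrite addrA addrC lerD2l.
apply: (@le_trans _ _ (3 * 2^-1 ^+ n)).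
  rewrite (_ : 3 = 2 + 1 :> C); last by ring.
  rewrite [leRHS]mulrDl mul1r.
  by rewrite lerD2l exprS ler_piMl ?(ltW (half_gt0 _)) // invf_le1 ?ler1n.
by rewrite mulrC -ler_pdivlMr // ltW.
Qed.

Variable D : V -> A.
Hypothesis hD : forall v, approximable v ->
  forall l c, L l -> close v l c -> `|D v - D0 l| <= c.

(** One form for linear combinations, products and adjoints: the law holds on [L], and both
    operations are continuous at the points concerned. Adjoints ignore the second argument; scalars
    are built into the operation. *)
Lemma extension_op (opV : V -> V -> V) (opA : A -> A -> A) v w :
  (forall l m, L l -> L m -> L (opV l m) /\ D0 (opV l m) = opA (D0 l) (D0 m)) ->
  (forall e, 0 < e -> exists2 d, 0 < d & forall l m, L l -> L m ->
     close v l d -> close w m d -> close (opV v w) (opV l m) e) ->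
  (forall x y e, 0 < e -> exists2 d, 0 < d & forall x' y',
     `|x - x'| <= d -> `|y - y'| <= d -> `|opA x y - opA x' y'| <= e) ->
  approximable v -> approximable w ->
  approximable (opV v w) /\ D (opV v w) = opA (D v) (D w).
Proof.
move=> hL hV hA av aw.
have aop : approximable (opV v w).
  move=> e e0; have [d d0 hd] := hV e e0.
  have [l [Ll vl]] := av _ d0; have [m [Lm wm]] := aw _ d0.
  by exists (opV l m); split; [exact: (hL _ _ Ll Lm).1|exact: hd].
split => //; apply/eqP; rewrite -subr_eq0 -normr_le0; apply/ler_addgt0Pr => e e0.
rewrite add0r; have e2 : 0 < e / 2 by rewrite divr_gt0.
have [d1 d10 hd1] := hV _ e2; have [d2 d20 hd2] := hA (D v) (D w) _ e2.
have [d [d0 dd1 dd2]] := pos_lower_bound d10 d20.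
have [l [Ll vl]] := av _ d0; have [m [Lm wm]] := aw _ d0.
have [Lop Dop] := hL _ _ Ll Lm.
rewrite -(subrK (D0 (opV l m)) (D _)) -addrA (splitr e).
apply: le_trans (ler_normD _ _) _; apply: lerD.
  by apply: hD => //; apply: hd1 => //; apply: close_mono; eauto.
rewrite Dop distrC; apply: hd2.
  by apply: le_trans (hD av Ll vl) _.
by apply: le_trans (hD aw Lm wm) _.
Qed.

End Extension.

(** * Joint continuity of the operations of a C*-algebra *)

Section CstarContinuity.
Variables (R : realType) (A : cstarAlgType R).
Local Notation C := (Complex R).

Lemma clin_near (k : C) (x y : A) e : 0 < e -> exists2 d, 0 < d & forall x' y',
  `|x - x'| <= d -> `|y - y'| <= d -> `|(k *: x + y) - (k *: x' + y')| <= e.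
Proof.
move=> e0; have K0 : 0 < `|k| + 1 by rewrite ltr_wpDl.
exists (e / (`|k| + 1)) => [|x' y' hx hy]; first by rewrite divr_gt0.
rewrite opprD addrACA -scalerBr; apply: le_trans (ler_normD _ _) _.
rewrite normrZ; apply: (@le_trans _ _ (`|k| * (e / (`|k| + 1)) + e / (`|k| + 1))).
  by apply: lerD => //; exact: ler_wpM2l.
by rewrite -{2}[e / _]mul1r -mulrDl mulrCA divff ?gt_eqF // mulr1.
Qed.

Lemma cmul_near (x y : A) e : 0 < e -> exists2 d, 0 < d & forall x' y',
  `|x - x'| <= d -> `|y - y'| <= d -> `|x ⋆ y - x' ⋆ y'| <= e.
Proof.
move=> e0; pose K := `|x| + (`|y| + 1).
have K0 : 0 < K by rewrite ltr_wpDl // ltr_wpDl.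
have [d [d0 d1 dK]] := pos_lower_bound (@ltr01 C) (divr_gt0 e0 K0).
exists d => // x' y' hx hy.
have -> : x ⋆ y - x' ⋆ y' = x ⋆ (y - y') + (x - x') ⋆ y'.
  by rewrite cmulBr cmulBl addrA subrK.
have y'1 : `|y'| <= `|y| + 1.
  rewrite -(subrK y y') addrC; apply: le_trans (ler_normD _ _) _.
  by rewrite lerD2l distrC; exact: le_trans hy d1.
apply: le_trans (ler_normD _ _) _; apply: (@le_trans _ _ (d * K)); last first.
  by rewrite -ler_pdivlMr.
rewrite /K mulrDr; apply: lerD; apply: le_trans (cnormM _ _) _.
  by rewrite mulrC; exact: ler_wpM2r.
by apply: ler_pM.
Qed.

Lemma cstar_near (x : A) e : 0 < e -> exists2 d, 0 < d & forall x' : A,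
  `|x - x'| <= d -> `|cstar x - cstar x'| <= e.
Proof. by move=> e0; exists e => // x' h; rewrite -cstarB norm_cstar. Qed.

End CstarContinuity.

(** * The space Mbar *)

Section Mbar.
Variables (G : groupType) (N H M : set G) (st : CL_hypotheses N H M).
Local Open Scope group_scope.
Local Notation PT := (set_type (Pset H M)).
Local Notation MT := (set_type M).
Local Notation MB := (Mbar st).
Local Notation "a ** b" := (Pmul st a b) (at level 40, left associativity).
Local Notation one := (P1 st).
Implicit Types (a b c d : PT) (x y : MB) (m k : MT).

Let sgM : is_subgroup M. Proof. by case: (st_normal st). Qed.

Lemma PmulA a b c : a ** (b ** c) = a ** b ** c.
Proof. by apply: val_inj; rewrite /= mulgA. Qed.

Lemma Pmul1 a : a ** one = a.
Proof. by apply: val_inj; rewrite /= mulg1. Qed.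

Lemma Pmul_right a b : exists a' b', a ** a' = b ** b'.
Proof.
by have [[a' b'] /= e] := ore_right st a b; exists a', b'; exact: val_inj.
Qed.

Lemma Pmul_left a b : exists a' b', a' ** a = b' ** b.
Proof.
by have [[a' b'] /= e] := ore_left st a b; exists a', b'; exact: val_inj.
Qed.

Lemma mbar_mem_eq x y a z : mbar x a z -> mbar y a z -> mbar x a = mbar y a.
Proof. by move=> /mbarP[_ ->] /mbarP[_ ->]. Qed.

Lemma mbar_memM x a z : mbar x a z -> M z.
Proof. by case/mbarP. Qed.

Lemma mbar_same_mul x y a b : mbar x (a ** b) = mbar y (a ** b) -> mbar x a = mbar y a.
Proof.
move=> e; have [z xz] := mbar_ex x (a ** b).
apply: (mbar_mem_eq (z := z)); apply: (@mbar_sub _ _ _ _ _ _ a b (a ** b)) => //.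
by rewrite -e.
Qed.

Lemma mbar_of_ex m : {x : MB | forall a, mbar x a = lcos (val m) (Msub M (val a))}.
Proof.
apply: mkMbar => [a|a b]; first by exists (val m) => //; exact: set_valP.
by move=> _ [k Mk <-]; exists k => //; apply: Msub_mul Mk; exact: set_valP.
Qed.

Definition mbar_of m : MB := sval (mbar_of_ex m).

Lemma mbar_ofE m a : mbar (mbar_of m) a = lcos (val m) (Msub M (val a)).
Proof. by rewrite /mbar_of; case: mbar_of_ex. Qed.

Lemma mem_mbar_of m a : mbar (mbar_of m) a (val m).
Proof. rewrite mbar_ofE; exact: (mem_lcos st). Qed.

Lemma mbar_conj b x a z : mbar x a z ->
  mbar (conjMbar b x) (b ** a) (val b * z * (val b)^-1).
Proof.
move=> xz; have e : val b * val a = val (b ** a) * val one by rewrite /= mulg1.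
by rewrite conjMbarE (conj_cosE e xz); exact: (mem_lcos st).
Qed.

Lemma mbar_translate m x a z : mbar x a z -> mbar (translate m x) a (val m * z).
Proof. by move=> xz; rewrite translateE; exists z. Qed.

(** Conjugation by [b] embeds [M/M_a] into the quotient at level [b ** a]. The two directions give
    continuity of [conjMbar b] and of its inverse on the range. *)
Lemma conjMbar_same b x y a :
  mbar x a = mbar y a <-> mbar (conjMbar b x) (b ** a) = mbar (conjMbar b y) (b ** a).
Proof.
have [z xz] := mbar_ex x a; have [w yw] := mbar_ex y a.
have hx := mbar_conj b xz; have hy := mbar_conj b yw; split=> e.
  apply: mbar_mem_eq hx _; move: xz; rewrite e => /mbar_conj; exact.
apply: mbar_mem_eq xz _; move: hx; rewrite e => hx.
have [_ ->] := mbarP yw; have [_ E] := mbarP hy; move: hx; rewrite E.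
case=> _ [k Mk <-] /= e2; exists (val a * k * (val a)^-1); first by exists k.
apply: (@mulgI _ (val b)); apply: (@mulIg _ (val b)^-1); rewrite -e2.
by rewrite /= invgM !mulgA mulgVK.
Qed.

Lemma conjMbar_inj b : injective (conjMbar b : MB -> MB).
Proof. by move=> x y e; apply: mbar_inj => a; apply/(conjMbar_same b); rewrite e. Qed.

(** The range is thus a cylinder, open and closed, which is what makes domains of slices clopen. For
    the converse, the coordinate of the preimage at [a] is that of [y] at [b ** a], conjugated back
    by [b]; it lies in [M] because [y] is trivial at [b]. *)
Lemma conjMbar_range b y : (exists x, y = conjMbar b x) <-> mbar y b 1.
Proof.
split=> [[x ->]|y1].
  have [z xz] := mbar_ex x one; have := mbar_conj b xz; rewrite Pmul1 => h.
  have [_ ->] := mbarP h; exists (val b * z^-1 * (val b)^-1).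
    by exists z^-1 => //; apply: (subV sgM); exact: mbar_memM xz.
  by rewrite !mulgA mulgVK mulgK mulgV.
pose f a : set G := [set (val b)^-1 * z * val b | z in mbar y (b ** a)].
have hf a : Mcosets M (val a) (f a).
  have [z yz] := mbar_ex y (b ** a); have [Mz E] := mbarP yz.
  have zb : mbar y b z by apply: mbar_sub yz.
  move: zb; have [_ ->] := mbarP y1 => -[_ [k Mk <-]]; rewrite mul1g => zE.
  exists k => //; rewrite /f E -zE; apply/seteqP; split.
    move=> _ [_ [_ [j Mj <-] <-] <-]; exists (val a * j * (val a)^-1); first by exists j.
    by rewrite /= invgM !mulgA mulgVK mulVg mul1g mulgVK.
  move=> _ [_ [j Mj <-] <-].
  exists (val b * k * (val b)^-1 * (val (b ** a) * j * (val (b ** a))^-1)).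
    by exists (val (b ** a) * j * (val (b ** a))^-1) => //; exists j.
  by rewrite /= invgM !mulgA mulgVK mulVg mul1g mulgVK.
have hc a c : f (a ** c) `<=` f a.
  move=> _ [z yz <-]; exists z => //.
  by apply: (@mbar_sub _ _ _ _ _ _ (b ** a) c) yz; rewrite /= mulgA.
have [x xE] := mkMbar hf hc; exists x; apply: mbar_inj => a.
(* Coordinates of [conjMbar b x] are known at the levels [b ** c] only; some [a ** a'] has this
   form, and the coordinate there determines the one at [a]. *)
have [a' [c e]] := Pmul_right a b; have [z yz] := mbar_ex y (b ** c).
have xz : mbar x c ((val b)^-1 * z * val b) by rewrite xE; exists z.
have := mbar_conj b xz; rewrite !mulgA mulgV mul1g mulgK => h.
by apply: (@mbar_same_mul _ _ _ a'); rewrite e; exact: mbar_mem_eq yz h.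
Qed.

Lemma translate1 m x : val m = 1 -> translate m x = x.
Proof.
move=> m1; apply: mbar_inj => a; have [z xz] := mbar_ex x a.
by have := mbar_translate m xz; rewrite m1 mul1g => h; exact: mbar_mem_eq h xz.
Qed.

Lemma translate_same m x y a :
  mbar x a = mbar y a -> mbar (translate m x) a = mbar (translate m y) a.
Proof. by move=> e; rewrite !translateE e. Qed.

Lemma translate_inj m : injective (translate m : MB -> MB).
Proof.
pose m' : MT := exist _ (val m)^-1 (mem_set (subV sgM (set_valP m))).
pose o : MT := exist _ 1 (mem_set (sub1 sgM)).
apply: (can_inj (g := translate m')) => x.
by rewrite (translateM (p := o)) ?translate1 //= mulVg.
Qed.

End Mbar.

(** * Cylinders, topology and compactness of Mbar *)

Section MbarTopology.
Variables (G : groupType) (N H M : set G) (st : CL_hypotheses N H M).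
Local Notation PT := (set_type (Pset H M)).
Local Notation MT := (set_type M).
Local Notation MB := (Mbar st).
Local Notation "a ** b" := (Pmul st a b) (at level 40, left associativity).
Local Notation one := (P1 st).
Implicit Types (a b c d : PT) (x y : MB) (m k : MT).

(** Neighbourhoods in a product are controlled by finitely many coordinates; here one suffices,
    because two levels have a common right multiple. *)
Definition cylinder x : set_system MB :=
  [set U | exists a, forall y, mbar y a = mbar x a -> U y].

Lemma cylinder_filter x : Filter (cylinder x).
Proof.
split; first by exists one.
- move=> U V [a Ua] [b Vb]; have [a' [b' e]] := Pmul_right st a b.
  exists (a ** a') => y h; split; first exact/Ua/mbar_same_mul/h.
  by apply/Vb/(@mbar_same_mul _ _ _ _ _ _ _ b b'); rewrite -e.
- by move=> U V UV [a Ua]; exists a => y /Ua /UV.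
Qed.

Lemma cylinder_cvg x (F : set_system MB) : Filter F ->
  (forall a, F [set y | mbar y a = mbar x a]) -> F --> x.
Proof.
move=> FF hF U [_ /= [[W oW <-] Wx] WU].
suff FW : F (set_val @^-1` W) by exact: filterS FW.
pose F' : set_system (prod_topology (fun a : PT => discrete_topology (quoM M (val a)))) :=
  [set V | F (set_val @^-1` V)].
have FF' : Filter F'.
  split; first exact: filterT.
  - by move=> V V' h h'; apply: filterS (filterI h h').
  - by move=> V V' VV' h; apply: filterS h => y; exact: VV'.
have : F' --> (val x : prod_topology (fun a : PT => discrete_topology (quoM M (val a)))).
  apply/cvg_sup => a U' [_ /= [[W' oW' <-] W'x] WU'].
  rewrite /nbhs /= /F' /=; apply: filterS (hF a) => y h; apply: WU'.
  have e : val y a = val x a by exact: val_inj.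
  by change (W' (val y a)); rewrite e.
by apply; exact: open_nbhs_nbhs.
Qed.

Lemma open_cylinder x a : open [set y : MB | mbar y a = mbar x a].
Proof.
exists (proj a @^-1` [set val x a]).
  apply: open_comp; last exact: discrete_open.
  by move=> z _; exact: proj_continuous.
by apply/seteqP; split => y h; [exact: (congr1 val h)|exact: val_inj].
Qed.

Lemma nbhs_mbarE x : nbhs x = cylinder x.
Proof.
apply/seteqP; split=> U.
  apply: (cylinder_cvg (cylinder_filter x)) => a.
  by exists a.
move=> [a Ua]; have := @open_nbhs_nbhs _ x _ (conj (open_cylinder x a) erefl).
by apply: filterS.
Qed.

(** Each [M/M_a] is finite, so an ultrafilter selects a coset at every level. The selections at
    [a ** b] and at [a] are realised by a common point, hence are coherent and form the limit. *)
Lemma compact_mbar : compact [set: MB].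
Proof.
rewrite compact_ultra => F FU _.
have pick a : exists C, F [set y : MB | mbar y a = C].
  have /finite_seqP[r hr] := st_finite st (set_valP a).
  have : F [set y : MB | mbar y a \in r].
    apply: filterE => y; have := set_valP (val y a).
    by rewrite -/(mbar y a); have := hr; rewrite predeqE => /(_ (mbar y a))[h _] /h.
  elim: r {hr} => [|C r IH] Fr; first by have [] := filter_ex Fr.
  have [FC|FnC] := in_ultra_setVsetC [set y : MB | mbar y a = C] FU; first by exists C.
  apply: IH; apply: filterS (filterI Fr FnC) => y /= [].
  by rewrite inE => /orP[/eqP|].
have /choice [C hC] := pick.
have Cin a : Mcosets M (val a) (C a).
  by have [y <-] := filter_ex (hC a); exact: set_valP.
have Csub a b : C (a ** b) `<=` C a.
  by have [y [<- <-]] := filter_ex (filterI (hC (a ** b)) (hC a)); exact: mbar_sub.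
have [x xC] := mkMbar Cin Csub; exists x; split => //.
by apply: cylinder_cvg => a; rewrite xC.
Qed.

Lemma continuous_from_mbarP (T : topologicalType) (f : MB -> T) :
  continuous f <-> forall x U, open U -> U (f x) ->
    exists a, forall y, mbar y a = mbar x a -> U (f y).
Proof.
split=> [cf x U oU Ux|h x U].
  have : nbhs x (f @^-1` U) by apply: cf; exact: open_nbhs_nbhs.
  by rewrite nbhs_mbarE.
rewrite nbhsE => -[V [oV Vx] VU]; have [a ha] := h x V oV Vx.
change (nbhs x (f @^-1` U)); rewrite nbhs_mbarE.
by exists a => y /ha; exact: VU.
Qed.

Lemma continuous_to_mbar (f : MB -> MB) :
  (forall x a, exists b, forall y, mbar y b = mbar x b -> mbar (f y) a = mbar (f x) a) ->
  continuous f.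
Proof.
move=> h; apply/continuous_from_mbarP => x U oU Ux.
have : nbhs (f x) U by exact: open_nbhs_nbhs.
rewrite nbhs_mbarE => -[a ha]; have [b hb] := h x a.
by exists b => y /hb; exact: ha.
Qed.

Lemma continuous_conjMbar b : continuous (conjMbar b : MB -> MB).
Proof.
apply: continuous_to_mbar => x a; have [a' [b' e]] := Pmul_right st a b.
exists b' => y h; apply: (@mbar_same_mul _ _ _ _ _ _ _ a a'); rewrite e.
exact: ((@conjMbar_same _ _ _ _ st b y x b').1 h).
Qed.

Lemma continuous_translate m : continuous (translate m : MB -> MB).
Proof. by apply: continuous_to_mbar => x a; exists a => y; exact: translate_same. Qed.

End MbarTopology.

(** * Locally constant functions and uniform approximation *)

Section MbarFunctions.
Variables (G : groupType) (N H M : set G) (st : CL_hypotheses N H M).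
Local Notation PT := (set_type (Pset H M)).
Local Notation MT := (set_type M).
Local Notation MB := (Mbar st).
Local Notation "a ** b" := (Pmul st a b) (at level 40, left associativity).
Local Notation one := (P1 st).
Implicit Types (a b c d : PT) (x y : MB) (m k : MT).
Variable R : realType.
Local Notation C := (Complex R).
Implicit Types h : MB -> C.

Definition level_fun h a := forall x y, mbar x a = mbar y a -> h x = h y.

Definition locally_const h := exists a, level_fun h a.

Lemma level_fun_mul h a b : level_fun h a -> level_fun h (a ** b).
Proof. by move=> ha x y /mbar_same_mul; exact: ha. Qed.

Lemma level_fun_common h h' : locally_const h -> locally_const h' ->
  exists a, level_fun h a /\ level_fun h' a.
Proof.
move=> [a ha] [b hb]; have [a' [b' e]] := Pmul_right st a b.
by exists (a ** a'); split; [|rewrite e]; exact: level_fun_mul.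
Qed.

Definition unif_close h h' (c : C) := forall x, (`|h x - h' x| <= c)%R.

(** Compactness gives one level on whose cylinders [h] oscillates by at most [e]; freezing [h] at a
    chosen point of each cylinder gives the approximation. *)
Lemma unif_approx h : continuous h -> approximable unif_close locally_const h.
Proof.
move=> ch e e0.
(* The filter of sets containing all right multiples of some level: it expresses a limit over the
   levels in the covering form of compactness. *)
pose F : set_system PT := [set S | exists a0, forall b, S (a0 ** b)].
have FF : Filter F.
  split; first by exists one.
  - move=> U V [a Ua] [b Vb]; have [a' [b' E]] := Pmul_right st a b.
    by exists (a ** a') => c; split; [rewrite -PmulA|rewrite E -PmulA].
  - by move=> U V UV [a Ua]; exists a => b; exact/UV/Ua.
have cov := (compact_near_coveringP _).1 (@compact_mbar _ _ _ _ st).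
have := cov _ F (fun a x => forall y, mbar y a = mbar x a -> (`|h x - h y| <= e)%R) FF.
have osc : forall x, [set: MB] x -> \forall x' \near x & i \near F,
    forall y, mbar y i = mbar x' i -> (`|h x' - h y| <= e)%R.
  move=> x _; have e2 : (0 < e / 2)%R by rewrite divr_gt0.
  have := (@cvgrPdist_le _ C _ (nbhs x) (nbhs_filter x) h (h x)).1 (ch x) _ e2.
  rewrite {1}nbhs_mbarE => -[a ha].
  exists ([set y | mbar y a = mbar x a], [set a ** b | b in setT]) => /=.
    split; first exact: (open_nbhs_nbhs (conj (open_cylinder x a) erefl)).
    by exists a => b; exists b.
  move=> [x' i] /= [x'a [b _ <-]] y /mbar_same_mul yx'.
  rewrite -(subrK (h x) (h x')) -addrA (splitr e).
  apply: le_trans (ler_normD _ _) _; apply: lerD; first by rewrite distrC ha.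
  by apply: ha; rewrite yx'.
move=> /(_ osc)[a ha]; have {}ha x := ha one x I.
(* Points of one cylinder define the same set, so the choice depends on the coordinate only; the
   default is never taken. *)
pose rep x := xget (mbar_of st (M1 st)) [set y | mbar y (a ** one) = mbar x (a ** one)].
have repE x : mbar (rep x) (a ** one) = mbar x (a ** one).
  by apply: (@xgetPex _ _ [set y | mbar y (a ** one) = mbar x (a ** one)]); exists x.
exists (h \o rep); split=> [|x].
  by exists (a ** one) => x y xy; rewrite /comp /rep xy.
by apply: ha; exact: repE.
Qed.

End MbarFunctions.

(** * Arrows between points of Mbar and translation of functions along them *)

Section Arrow.
Variables (G : groupType) (N H M : set G) (st : CL_hypotheses N H M).
Local Open Scope group_scope.
Local Notation PT := (set_type (Pset H M)).
Local Notation MT := (set_type M).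
Local Notation MB := (Mbar st).
Local Notation "a ** b" := (Pmul st a b) (at level 40, left associativity).
Local Notation one := (P1 st).
Implicit Types (a b c d : PT) (x y z : MB) (m k : MT) (g h : G).

Lemma cls_conj b x : cls (conjMbar b x) b = cls x one.
Proof.
apply/cls_eq; exists one, b; split; first by rewrite /pt_of /= mul1g mulg1.
by rewrite /= conjMbar1.
Qed.

Lemma cls_eq_one y b x : cls y b = cls x one -> y = conjMbar b x.
Proof.
move=> /cls_eq [al [be [/= + e2]]]; rewrite /pt_of /= mulg1 => e1.
have e : be = al ** b by exact: val_inj.
by move: e2; rewrite /= e -conjMbarM => /conjMbar_inj.
Qed.

Lemma cls_one_inj x y : cls x one = cls y one -> x = y.
Proof. by move=> /cls_eq_one; rewrite conjMbar1. Qed.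

(* [arrow g x y] says that (x, g) is an arrow of the restricted groupoid with
   source y, for x, y in Mbar. *)
Definition arrow g x y : Prop := act g (cls y one) = cls x one.

(** Multiplying [x = g y] by [a] clears the denominator: [a x a^-1 = m (b y b^-1)] involves only
    operations defined on all of Mbar. *)
Lemma arrowE g a m b x y : g = (val a)^-1 * val m * val b ->
  arrow g x y <-> conjMbar a x = translate m (conjMbar b y).
Proof.
move=> e; rewrite /arrow (actE _ e).
have phi1 c u : phi c (cls u one) = cls (conjMbar c u) one.
  by apply: phiE; rewrite /= mul1g mulg1.
have M1m : Mconj one m = m by apply: val_inj; rewrite /= mul1g invg1 mulg1.
rewrite phi1 psiE M1m; split=> [e'|<-].
  by apply: cls_one_inj; rewrite -phi1 -e' phi_invK.
by rewrite -phi1 phiK.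
Qed.

Lemma arrow_P b x y : arrow (val b) y x <-> y = conjMbar b x.
Proof.
rewrite (@arrowE _ one (M1 st) b); last by rewrite /= invg1 !mul1g.
by rewrite conjMbar1 translate1.
Qed.

Lemma arrow_M m x y : arrow (val m) x y <-> x = translate m y.
Proof.
rewrite (@arrowE _ one m one); last by rewrite /= invg1 mul1g mulg1.
by rewrite !conjMbar1.
Qed.

Lemma arrow1 x : arrow 1 x x.
Proof. exact: act1. Qed.

Lemma arrowM g h x y z : arrow g x y -> arrow h y z -> arrow (g * h) x z.
Proof. by rewrite /arrow actM => gxy ->. Qed.

Lemma arrowV g x y : arrow g x y -> arrow g^-1 y x.
Proof. by rewrite /arrow => <-; rewrite -actM mulVg act1. Qed.

Lemma arrow_injl g x x' y : arrow g x y -> arrow g x' y -> x = x'.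
Proof. by rewrite /arrow => -> /cls_one_inj. Qed.

Lemma arrow_injr g x y y' : arrow g x y -> arrow g x y' -> y = y'.
Proof. by move=> /arrowV gx /arrowV; exact: arrow_injl. Qed.

Lemma arrowMl g h x y z : arrow g x y -> arrow (g * h) x z -> arrow h y z.
Proof. by move=> /arrowV gx ghz; have := arrowM gx ghz; rewrite mulKg. Qed.

Section Pull.
Variable R : realType.
Local Notation C := (Complex R).
Implicit Types f : MB -> C.

(* [x |-> f (x.g)], extended by zero to the points of Mbar with [x.g] outside
   Mbar. *)
Definition pull g f x : C :=
  if pselect (exists y, arrow g x y) then f (xget x [set y | arrow g x y]) else 0%R.

Lemma pullE g f x y : arrow g x y -> pull g f x = f y.
Proof.
move=> gxy; rewrite /pull; case: pselect => [ex|[]]; last by exists y.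
by congr f; apply: (arrow_injr _ gxy); apply: (@xgetPex _ x [set y | arrow g x y]); exists y.
Qed.

Lemma pullN g f x : (forall y, ~ arrow g x y) -> pull g f x = 0%R.
Proof. by move=> n; rewrite /pull; case: pselect => [[y gxy]|//]; case: (n y). Qed.

Lemma pull_cases g x : (exists y, arrow g x y) \/ (forall y, ~ arrow g x y).
Proof.
by have [|n] := pselect (exists y, arrow g x y); [left|right => y h; apply: n; exists y].
Qed.

Lemma pull_P_conj b f x : pull (val b) f (conjMbar b x) = f x.
Proof. by apply: pullE; apply/arrow_P. Qed.

(** For [y = m^-1 (a x a^-1)] the points [x.g] and [y.b] agree or both fall outside Mbar, so
    translation along [g] reduces to translation along an element of [P]. *)
Lemma pull_comp g a m b f : g = (val a)^-1 * val m * val b ->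
  forall x y, conjMbar a x = translate m y -> pull g f x = pull (val b) f y.
Proof.
move=> e x y xy; have [[z gxz]|n] := pull_cases g x.
  rewrite (pullE _ gxz); apply/esym/pullE/arrow_P.
  by apply: (@translate_inj _ _ _ _ st m); rewrite -xy; exact: (arrowE x z e).1.
rewrite pullN // pullN // => z /arrow_P yz; apply: (n z).
by apply: (arrowE x z e).2; rewrite xy yz.
Qed.

(** On the range of conjugation by [b] the function is [f] after conjugating back, elsewhere it is
    zero, and the range is clopen. *)
Lemma continuous_pull_P b f : continuous f -> continuous (pull (val b) f).
Proof.
move=> /continuous_from_mbarP cf; apply/continuous_from_mbarP => y U oU Uy.
have [ex|n] := pselect (exists x, y = conjMbar b x).
  have [x yE] := ex; subst y; rewrite pull_P_conj in Uy.
  have [a ha] := cf x U oU Uy; exists (b ** a) => y' yy'.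
  have : mbar y' b 1.
    by rewrite (mbar_same_mul yy'); apply/conjMbar_range; exists x.
  move=> /conjMbar_range[x' x'E]; rewrite x'E pull_P_conj; apply: ha.
  have := yy'; rewrite x'E.
  exact: ((@conjMbar_same _ _ _ _ st b x' x a).2).
exists b => y' yy'; rewrite pullN; last first.
  move=> x /arrow_P y'x; apply: n; apply/conjMbar_range; rewrite -yy'.
  by apply/conjMbar_range; exists x.
move: Uy; rewrite pullN // => x /arrow_P yx; apply: n; by exists x.
Qed.

Lemma translateVK m : exists k, forall x, translate m (translate k x) = x.
Proof.
have [sgM _ _] := st_normal st.
exists (exist _ (val m)^-1 (mem_set (subV sgM (set_valP m)))) => x.
by rewrite (translateM (p := M1 st)) ?translate1 //= mulgV.
Qed.

Lemma continuous_pull g f : continuous f -> continuous (pull g f).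
Proof.
move=> cf; have [[[a m] b] e] := nform_ex st g; rewrite /nform /= in e.
have [k hk] := translateVK m.
have -> : pull g f = (pull (val b) f \o translate k) \o conjMbar a.
  by apply/funext => x; apply: (pull_comp _ e); rewrite hk.
move=> x; apply: continuous_comp; first exact: continuous_conjMbar.
apply: continuous_comp; first exact: continuous_translate.
exact: continuous_pull_P.
Qed.

End Pull.
End Arrow.

(** * The restricted groupoid *)

Section GroupoidCoordinates.
Variables (G : groupType) (N H M : set G) (st : CL_hypotheses N H M).
Local Open Scope group_scope.
Local Notation PT := (set_type (Pset H M)).
Local Notation MT := (set_type M).
Local Notation MB := (Mbar st).
Local Notation "a ** b" := (Pmul st a b) (at level 40, left associativity).
Local Notation one := (P1 st).
Local Notation K := (restricted_groupoid st).
Implicit Types (a b c d : PT) (x y : MB) (m k : MT) (g h : G) (z w : K).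

Lemma mkK_in x g y : arrow g x y -> RGset (st := st) (cls x one, g).
Proof.
move=> gxy; split; first by exists x.
by exists y => //; apply/esym; exact: (arrowV gxy).
Qed.

Definition mkK x g y (gxy : arrow g x y) : K :=
  (exist _ (cls x one, g) (mem_set (mkK_in gxy)) : set_type (RGset (st := st))).

Definition gelt z : G := (val z).2.

Lemma K_ex z : exists x y, arrow (gelt z) x y /\ (val z).1 = cls x one.
Proof.
have [[x _ xE] [y _ yE]] := set_valP z; exists x, y; split => //.
by rewrite /arrow yE /TGsrc /TGelt -actM mulgV act1 xE.
Qed.

(** A point of [Nbar] is a class; its representative in Mbar is unique, so [gpt] and [gelt] are
    coordinates on the groupoid. *)
Definition gpt z : MB := xget (mbar_of st (M1 st)) [set x | (val z).1 = cls x one].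

Lemma gptE z : (val z).1 = cls (gpt z) one.
Proof.
have [x [y [_ e]]] := K_ex z.
by apply: (@xgetPex _ _ [set x | (val z).1 = cls x one]); exists x.
Qed.

Lemma gsp_ex z : exists y, arrow (gelt z) (gpt z) y.
Proof.
have [x [y [gxy e]]] := K_ex z; exists y.
by rewrite (_ : gpt z = x) //; apply: (@cls_one_inj _ _ _ _ st); rewrite -e gptE.
Qed.

Lemma gpt_mk x g y (gxy : arrow g x y) : gpt (mkK gxy) = x.
Proof. by apply: (@cls_one_inj _ _ _ _ st); rewrite -gptE. Qed.

Lemma K_inj z w : gpt z = gpt w -> gelt z = gelt w -> z = w.
Proof.
move=> e1 e2; apply: val_inj.
by rewrite (surjective_pairing (val z)) (surjective_pairing (val w)) !gptE e1;
   congr pair.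
Qed.

Lemma gsrc_arrow z y : arrow (gelt z) (gpt z) y -> gsrc z = cls y one.
Proof.
by move=> /arrowV h; rewrite /gsrc /= /RGsrc /TGsrc gptE; exact: h.
Qed.

Lemma grngE z : grng z = cls (gpt z) one.
Proof. exact: gptE. Qed.

Lemma composableE z w : gsrc z = grng w <-> arrow (gelt z) (gpt z) (gpt w).
Proof.
split=> [e|/gsrc_arrow ->]; last by rewrite grngE.
have [y hy] := gsp_ex z; rewrite (_ : gpt w = y) //.
by apply: (@cls_one_inj _ _ _ _ st); rewrite -grngE -e (gsrc_arrow hy).
Qed.

Lemma gmul_coord z w : gsrc z = grng w ->
  gpt (gmul z w) = gpt z /\ gelt (gmul z w) = gelt z * gelt w.
Proof.
move=> /RGmulE e; split; last by rewrite /gelt [gmul z w]/(RGmul z w) e.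
by apply: (@cls_one_inj _ _ _ _ st); rewrite -gptE [gmul z w]/(RGmul z w) e -gptE.
Qed.

Lemma ginv_coord z y : arrow (gelt z) (gpt z) y ->
  gpt (ginv z) = y /\ gelt (ginv z) = (gelt z)^-1.
Proof.
move=> h; split => //; apply: (@cls_one_inj _ _ _ _ st).
by rewrite -gptE -(gsrc_arrow h).
Qed.

(** Over each [b], the preimage under the quotient map consists of the conjugates by [b] of points
    of [U], an open set because conjugation by [b] is a homeomorphism onto its open range. *)
Lemma open_cls (U : set MB) : open U -> open [set q : Nbar st | exists2 x, U x & q = cls x one].
Proof.
move=> oU; rewrite /open /= /quotient_open openE => -[y b] /= [x Ux /cls_eq_one yE].
have : nbhs x U by exact: open_nbhs_nbhs.
rewrite nbhs_mbarE => -[a ha].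
exists ([set y' | mbar y' (b ** a) = mbar y (b ** a)], [set b : discrete_topology PT]) => /=.
  split; last exact: discrete_set1.
  exact: (open_nbhs_nbhs (conj (open_cylinder y (b ** a)) erefl)).
move=> [y' b'] /= [yy' ->].
have : mbar y' b 1 by rewrite (mbar_same_mul yy'); apply/conjMbar_range; exists x.
move=> /conjMbar_range[x' x'E]; exists x'; last by rewrite x'E; exact: cls_conj.
apply: ha; have := yy'; rewrite x'E yE.
exact: ((@conjMbar_same _ _ _ _ st b x' x a).2).
Qed.

Lemma continuous_gpt : continuous gpt.
Proof.
apply/continuousP => U oU.
exists (fst @^-1` [set q : Nbar st | exists2 x, U x & q = cls x one]).
  by apply: open_comp; [move=> p _; exact: cvg_fst|exact: open_cls].
apply/seteqP; split=> z /=.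
  by move=> [x Ux]; rewrite gptE => /cls_one_inj ->.
by move=> Uz; exists (gpt z) => //; exact: gptE.
Qed.

Lemma continuous_gelt : continuous (gelt : K -> discrete_topology G).
Proof.
move=> z; apply: (@continuous_comp _ _ _ (set_val : K -> TGarr st) snd).
  exact: initial_continuous.
by apply: cvg_snd.
Qed.

End GroupoidCoordinates.

(** * Slices of the groupoid *)

Section GroupoidFunctions.
Variables (G : groupType) (N H M : set G) (st : CL_hypotheses N H M) (R : realType).
Local Notation PT := (set_type (Pset H M)).
Local Notation MB := (Mbar st).
Local Notation one := (P1 st).
Local Notation K := (restricted_groupoid st).
Local Notation C := (Complex R).
Implicit Types (x y : MB) (g : G) (z w : K) (h : MB -> C) (F : K -> C).

Lemma continuous_discrete (D : discreteTopologicalType) (T : topologicalType) (f : D -> T) :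
  continuous f.
Proof.
by move=> x U /nbhs_singleton Ux; apply: filterS (discrete_set1 x) => y ->.
Qed.

(** The domain of [g] is clopen: [x] belongs to it when [m^-1 (a x a^-1)] has trivial coordinate at
    [b], which near [x] depends on one coordinate by continuity. *)
Lemma locally_const_arrow g x : exists a, forall x', mbar x' a = mbar x a ->
  (exists y, arrow g x' y) <-> (exists y, arrow g x y).
Proof.
have [[[a m] b] e] := nform_ex st g; rewrite /nform /= in e.
have [sgM _ _] := st_normal st.
have [k hk] := translateVK st m.
have domE u : (exists y, arrow g u y) <-> mbar (translate k (conjMbar a u)) b 1%g.
  rewrite -conjMbar_range; split=> -[y uy]; exists y.
    apply: (@translate_inj _ _ _ _ st m); rewrite hk.
    exact: (arrowE u y e).1.
  by apply: (arrowE u y e).2; rewrite -uy hk.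
have cf : continuous (translate k \o conjMbar a : MB -> MB).
  move=> u; apply: continuous_comp; first exact: continuous_conjMbar.
  exact: continuous_translate.
have [c hc] := (continuous_from_mbarP _).1 cf x _
  (open_cylinder (translate k (conjMbar a x)) b) erefl.
by exists c => x' /hc /= E; rewrite !domE E.
Qed.

Lemma continuous_pair_cst (T U V : topologicalType) (f : T -> U) (v : V) :
  continuous f -> continuous (fun t => (f t, v)).
Proof. by move=> cf t; apply: cvg_pair; [exact: cf|exact: cvg_cst]. Qed.

(* [h] transported to the open subset [Mbar x {g}] of the groupoid. *)
Definition on_slice h g : K -> C := fun z => if gelt z == g then h (gpt z) else 0.

Lemma continuous_on_slice h g : continuous h -> continuous (on_slice h g).
Proof.
move=> ch; pose ind (g' : discrete_topology G) : C := (g' == g)%:R.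
have -> : on_slice h g = fun z =>
    (ind \o (@gelt _ _ _ _ st : K -> discrete_topology G)) z * (h \o @gpt _ _ _ _ st) z.
  by apply/funext => z; rewrite /on_slice /ind !compE; case: eqP; rewrite ?mul1r ?mul0r.
have ci : continuous (ind \o (@gelt _ _ _ _ st : K -> discrete_topology G)).
  move=> z; apply: continuous_comp; first exact: continuous_gelt.
  exact: continuous_discrete.
have cg : continuous (h \o @gpt _ _ _ _ st).
  by move=> z; apply: continuous_comp; [exact: continuous_gpt|exact: ch].
exact: (ccontinuousM ci cg).
Qed.

(** [j] is a continuous section of the slice, made total by replacing points off the clopen domain
    of [g] by the point of a fixed arrow [z0]. This takes a nonempty slice, hence the
    alternative. *)
Lemma slice_ex g : (forall z : K, gelt z <> g) \/
  exists j : MB -> K, continuous j /\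
    forall x, (exists y, arrow g x y) -> gpt (j x) = x /\ gelt (j x) = g.
Proof.
have [ne|] := pselect (forall z : K, gelt z <> g); first by left.
move=> /existsNP[z0 /contrapT z0g]; right.
pose r x := if `[< exists y, arrow g x y >] then x else gpt z0.
have rg x : exists y, arrow g (r x) y.
  rewrite /r; case: asboolP => // _.
  by have [y hy] := gsp_ex z0; exists y; rewrite -z0g.
have /choice [y hy] := rg.
exists (fun x => mkK (hy x)); split; last first.
  move=> x ex; split; last by [].
  by rewrite gpt_mk /r; case: asboolP.
have cr : continuous r.
  apply: continuous_to_mbar => x a; have [b hb] := locally_const_arrow g x.
  have [a' [b' e]] := Pmul_right st a b; exists (Pmul st a a') => u hu.
  have ub : mbar u b = mbar x b.
    by apply: (@mbar_same_mul _ _ _ _ _ _ _ b b'); rewrite -e.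
  rewrite /r (asbool_equiv_eq (hb _ ub)); case: asboolP => // _.
  exact: mbar_same_mul hu.
apply: continuous_comp_initial.
apply: (@continuous_pair_cst MB (Nbar st) (discrete_topology G) (fun x => cls (r x) one) g).
move=> x; apply: (@continuous_comp _ _ _
  (fun x => (r x, one) : pairMP st) (fun p => (\pi_(Nbar st) p)%qT)).
  exact: (@continuous_pair_cst MB MB (discrete_topology PT) r one cr).
exact: pi_continuous.
Qed.

Lemma compact_slice g : compact [set z : K | gelt z = g].
Proof.
have [ne|[j [cj hj]]] := slice_ex g.
  rewrite (_ : [set z | _] = set0); first exact: compact0.
  by apply/seteqP; split => z //= /ne.
have -> : [set z : K | gelt z = g] = j @` [set x | exists y, arrow g x y].
  apply/seteqP; split=> z.
    move=> zg; exists (gpt z); first by have := gsp_ex z; rewrite zg.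
    have [|e1 e2] := hj (gpt z); first by have := gsp_ex z; rewrite zg.
    by apply: K_inj; rewrite ?e1 ?e2.
  by move=> [x ex <-]; have [] := hj x ex.
apply: continuous_compact; first exact: continuous_subspaceT.
apply: (subclosed_compact _ (@compact_mbar _ _ _ _ st)) => //.
rewrite -[X in closed X]setCK closedC openE => x nx.
have [a ha] := locally_const_arrow g x.
by rewrite /interior nbhs_mbarE; exists a => x' /ha E /E.
Qed.

Lemma closed_slice g : closed [set z : K | gelt z = g].
Proof.
have -> : [set z : K | gelt z = g] =
    (@gelt _ _ _ _ st : K -> discrete_topology G) @^-1` [set g : discrete_topology G] by [].
by apply: closed_comp; [move=> z _; exact: continuous_gelt|exact: discrete_closed].
Qed.

Lemma Cc_on_slice h g : continuous h -> Cc (on_slice h g).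
Proof.
move=> ch; split; first exact: continuous_on_slice.
apply: (subclosed_compact _ (@compact_slice g)); first exact: closed_closure.
rewrite [X in _ `<=` X]((closure_id _).1 (@closed_slice g)).
apply: closureS => z /eqP hz; apply: contrapT => /eqP ng; apply: hz.
by rewrite /on_slice (negbTE ng).
Qed.

End GroupoidFunctions.

(** * Decomposition of C_c into slice functions *)

Section GroupoidDecomposition.
Variables (G : groupType) (N H M : set G) (st : CL_hypotheses N H M) (R : realType).
Local Notation MB := (Mbar st).
Local Notation K := (restricted_groupoid st).
Local Notation C := (Complex R).
Implicit Types (x y : MB) (g : G) (z w : K) (h : MB -> C) (F : K -> C).

Lemma Cc_lin k F F' : Cc F -> Cc F' -> Cc (fun z => k * F z + F' z).
Proof.
move=> [cF kF] [cF' kF']; split.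
  have ck : continuous (fun z => k * F z).
    apply: (ccontinuousM (f := fun=> k) (g := F)); last exact: cF.
    exact: cst_continuous.
  exact: (ccontinuousD ck cF').
apply: (subclosed_compact _ (@compactU _ _ _ kF kF')); first exact: closed_closure.
rewrite -closureU; apply: closureS => z /= h.
apply/orP; rewrite -negb_and; apply: contra h => /andP[/eqP-> /eqP->].
by rewrite mulr0 addr0.
Qed.

(** The slices are open and cover the support. Compactness is applied to the filter of finite lists
    ordered by inclusion, which yields one list containing all group parts. *)
Lemma Cc_support F : Cc F -> exists s : seq G, uniq s /\ forall z, F z != 0 -> gelt z \in s.
Proof.
move=> [_ kF].
pose S : set_system (seq G) :=
  [set U | exists s0 : seq G, forall s : seq G, {subset s0 <= s} -> U s].
have FS : Filter S.
  split; first by exists [::].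
  - move=> U V [s Us] [t Vt]; exists (s ++ t) => r h.
    by split; [apply: Us|apply: Vt] => g gs; apply: h; rewrite mem_cat gs ?orbT.
  - by move=> U V UV [s Us]; exists s => t /Us /UV.
have := (compact_near_coveringP _).1 kF _ S (fun s z => gelt z \in s) FS.
have near_slice z : closure [set x : K | F x != 0] z ->
    \forall z' \near z & s \near S, gelt z' \in s.
  move=> _; exists ([set z' : K | gelt z' = gelt z], [set s : seq G | gelt z \in s]).
    split; last by exists [:: gelt z] => s; apply; rewrite inE.
    apply: open_nbhs_nbhs; split => //.
    have -> : [set z' : K | gelt z' = gelt z] =
      (@gelt _ _ _ _ st : K -> discrete_topology G) @^-1` [set gelt z] by [].
    by apply: open_comp; [move=> w _; exact: continuous_gelt|exact: discrete_open].
  by move=> [z' s] [/= -> ].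
move=> /(_ near_slice)[s hs]; exists (undup s); split; first exact: undup_uniq.
by move=> z Fz; rewrite mem_undup; apply: (hs s) => //; exact: subset_closure.
Qed.

Definition restr_slice F g x : C :=
  match pselect (exists y, arrow g x y) with
  | left ex => F (mkK (projT2 (cid ex)))
  | right _ => 0
  end.

Lemma restr_sliceE F z : restr_slice F (gelt z) (gpt z) = F z.
Proof.
rewrite /restr_slice; case: pselect => [ex|[]]; last exact: gsp_ex.
by congr F; apply: K_inj; rewrite ?gpt_mk.
Qed.

Lemma continuous_restr_slice F g : continuous F -> continuous (restr_slice F g).
Proof.
move=> cF; have [ne|[j [cj hj]]] := slice_ex st g.
  have -> : restr_slice F g = fun=> 0; last exact: cst_continuous.
  apply/funext => x; rewrite /restr_slice; case: pselect => // -[y gxy].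
  by case: (ne (mkK gxy)).
(* [F \o j] has the right values on the domain of [g] only; the indicator of the domain removes the
   arbitrary ones elsewhere. *)
have -> : restr_slice F g = fun x => pull g (fun=> 1) x * (F \o j) x.
  apply/funext => x; have [[y gxy]|n] := pull_cases g x.
    rewrite (pullE _ gxy) mul1r; have [|e1 e2] := hj x; first by exists y.
    by rewrite /comp -[in RHS]restr_sliceE e1 e2.
  rewrite pullN // mul0r /restr_slice; case: pselect => // -[y /n //].
apply: (ccontinuousM (f := pull g (fun=> 1)) (g := F \o j)).
  by apply: continuous_pull; exact: cst_continuous.
by move=> x; apply: continuous_comp; [exact: cj|exact: cF].
Qed.

Lemma Cc_decomp F : Cc F -> exists s : seq G, uniq s /\
  F = fun z => \sum_(g <- s) on_slice (restr_slice F g) g z.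
Proof.
move=> FC; have [s [us hs]] := Cc_support FC; exists s; split => //.
apply/funext => z; have [zs|zs] := boolP (gelt z \in s).
  rewrite (bigD1_seq (gelt z)) //= big1 ?addr0 => [|g gz]; rewrite /on_slice.
    by rewrite eqxx restr_sliceE.
  by rewrite eq_sym (negbTE gz).
rewrite big_seq big1 => [|g gs]; last first.
  by rewrite /on_slice; case: eqP => // zg; rewrite zg gs in zs.
by apply/eqP/negPn/negP => /hs; rewrite (negbTE zs).
Qed.

End GroupoidDecomposition.

(** * Convolution and involution of slice functions *)

Section Convolution.
Variables (G : groupType) (N H M : set G) (st : CL_hypotheses N H M) (R : realType).
Local Notation MB := (Mbar st).
Local Notation K := (restricted_groupoid st).
Local Notation C := (Complex R).
Implicit Types (x y : MB) (g : G) (z w : K) (h : MB -> C) (F : K -> C).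

Definition factorizations z : set (K * K) :=
  [set p | gsrc p.1 = grng p.2 /\ gmul p.1 p.2 = z].

Lemma factorizationP z p : factorizations z p <->
  [/\ arrow (gelt p.1) (gpt z) (gpt p.2), gpt p.1 = gpt z
    & gelt z = (gelt p.1 * gelt p.2)%g].
Proof.
split=> [[e <-]|[a e1 e2]].
  have [-> ->] := gmul_coord e; split; [|reflexivity|reflexivity].
  exact: (composableE _ _).1 e.
have e : gsrc p.1 = grng p.2 by apply: (composableE _ _).2; rewrite e1.
split; first exact: e.
have [h1 h2] := gmul_coord e; apply: K_inj; first by rewrite h1.
by rewrite h2.
Qed.

Lemma factorization_inj z p q : factorizations z p -> factorizations z q ->
  gelt p.1 = gelt q.1 -> p = q.
Proof.
move=> /factorizationP[ap p1 p2] /factorizationP[aq q1 q2] e.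
rewrite (surjective_pairing p) (surjective_pairing q); congr pair.
  by apply: K_inj; rewrite ?p1 ?q1.
apply: K_inj; first by apply: (arrow_injr ap); rewrite e.
by apply: (@mulgI _ (gelt p.1)); rewrite -p2 e -q2.
Qed.

(** Only the factorization of [z] with group parts [g] and [g'] can contribute. It exists when
    [gelt z] is their product and [gpt z] lies in the domain of [g]; [pull g h'] then evaluates [h']
    at the middle point. *)
Lemma conv_on_slice h g h' g' :
  conv (on_slice h g) (on_slice h' g') = on_slice (fun x => h x * pull g h' x) (g * g')%g :> (K -> C).
Proof.
apply/funext => z; rewrite /conv -/(factorizations z) [RHS]/on_slice.
have zero p : (gelt p.1 == g) && (gelt p.2 == g') = false ->
    on_slice h g p.1 * on_slice h' g' p.2 = 0.
  rewrite /on_slice; case: (gelt p.1 == g); case: (gelt p.2 == g') => // _;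
    by rewrite ?mul0r ?mulr0.
have [zg|/eqP zg] := eqVneq (gelt z) (g * g')%g; last first.
  rewrite fsbig1 // => p zp; apply: zero; apply/negP => /andP[/eqP e1 /eqP e2].
  by apply: zg; move/factorizationP: zp => [_ _ ->]; rewrite e1 e2.
have [[y gxy]|n] := pull_cases g (gpt z); last first.
  rewrite pullN // mulr0 fsbig1 // => p zp; apply: zero.
  apply/negP => /andP[/eqP e1 /eqP e2].
  by move/factorizationP: zp => [+ _ _]; rewrite e1 => /n.
have [w zw] := gsp_ex z; have g'yw : arrow g' y w.
  by apply: (arrowMl gxy); rewrite -zg.
pose p0 : K * K := (mkK gxy, mkK g'yw).
have zp0 : factorizations z p0.
  by apply/factorizationP; rewrite /p0 !gpt_mk; split.
rewrite -(fsbig_widen [set p0]) /=; last 2 first.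
- by move=> _ ->.
- move=> p [zp pp0]; apply: zero; apply/negP => /andP[/eqP e1 /eqP e2].
  by apply: pp0; exact: (factorization_inj zp zp0).
by rewrite fsbig_set1 /on_slice !gpt_mk /p0 !eqxx (pullE _ gxy).
Qed.

Lemma invol_on_slice h g :
  invol (on_slice h g) = on_slice (pull g^-1%g (fun x => (h x)^* )) g^-1%g :> (K -> C).
Proof.
apply/funext => z; rewrite /invol /on_slice; have [y zy] := gsp_ex z.
have [-> ->] := ginv_coord zy.
have -> : ((gelt z)^-1 == g)%g = (gelt z == g^-1)%g.
  by rewrite -(inj_eq (@invg_inj _)) invgK.
case: eqP => [zg|_]; last exact: rmorph0.
by rewrite (@pullE _ _ _ _ _ _ _ _ _ y) // -zg.
Qed.

(** [z] may have infinitely many factorizations, so the sums cannot be exchanged at once. The group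
    part of the first factor determines the factorization; hence the set [T] of those with this part
    in [s] is finite, and it carries all nonzero terms. *)
Lemma conv_sum (s t : seq G) (f f' : G -> MB -> C) :
  conv (fun z => \sum_(g <- s) on_slice (f g) g z) (fun z => \sum_(g <- t) on_slice (f' g) g z) =
  (fun z => \sum_(g <- s) \sum_(g' <- t) conv (on_slice (f g) g) (on_slice (f' g') g') z) :> (K -> C).
Proof.
apply/funext => z; pose T := [set p | factorizations z p /\ gelt p.1 \in s].
have finT : finite_set T.
  have inj : set_inj T (fun p : K * K => gelt p.1).
    by move=> p q /set_mem[zp _] /set_mem[zq _]; exact: factorization_inj zp zq.
  rewrite -(eq_finite_set (inj_card_eq inj)).
  by apply: (sub_finite_set (B := [set` s])) => // _ [p [_ ps] <-].
have convT F F' : (forall p, F p != 0 -> gelt p \in s) ->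
    conv F F' z = \sum_(p \in T) F p.1 * F' p.2.
  move=> Fs; apply/esym/fsbig_widen; first by move=> p [].
  move=> p [zp nT]; have [F0|/Fs ps] := eqVneq (F p.1) 0.
    by rewrite /preimage /mkset F0 mul0r.
  by case: nT.
rewrite convT => [|p]; last first.
  apply: contraNT => ps; rewrite big_seq big1 // => g gs; rewrite /on_slice.
  by case: eqP => // e; rewrite e gs in ps.
rewrite fsbig_finite //.
under eq_bigr => p _ do rewrite big_distrlr /=.
rewrite exchange_big /=; rewrite big_seq [RHS]big_seq; apply: eq_bigr => g gs.
rewrite exchange_big /=; apply: eq_bigr => g' _.
rewrite convT => [|p]; last first.
  by rewrite /on_slice; have [->//|_] := eqVneq (gelt p) g; rewrite eqxx.
by rewrite fsbig_finite.
Qed.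

Lemma Cc0 : Cc ((fun=> 0) : K -> C).
Proof.
have -> : ((fun=> 0) : K -> C) = on_slice (fun=> 0) 1%g.
  by apply/funext => z; rewrite /on_slice; case: ifP.
by apply: Cc_on_slice; exact: cst_continuous.
Qed.

Lemma Cc_sum (I : Type) (r : seq I) (F : I -> K -> C) : (forall i, Cc (F i)) ->
  Cc (fun z => \sum_(i <- r) F i z).
Proof.
move=> FC; elim: r => [|i r IH].
  by rewrite (_ : (fun z => _) = fun=> 0); [exact: Cc0|apply/funext => z; rewrite big_nil].
rewrite (_ : (fun z => _) = fun z => 1 * F i z + \sum_(j <- r) F j z).
  exact: Cc_lin.
by apply/funext => z; rewrite big_cons mul1r.
Qed.

End Convolution.

Section Representations.
Variables (R : realType) (G : groupType) (N H M : set G) (st : CL_hypotheses N H M).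
Local Notation K := (restricted_groupoid st).
Local Notation C := (Complex R).
Variables (D : cstarAlgType R) (pi : (K -> C) -> D).
Hypothesis pi_lin : forall k F F', Cc F -> Cc F' ->
  pi (fun z => k * F z + F' z) = k *: pi F + pi F'.

Lemma rep0 : pi (fun=> 0) = 0.
Proof.
have := pi_lin 1 (Cc0 st R) (Cc0 st R).
rewrite (_ : (fun z => _) = fun=> 0); last by apply/funext => z; rewrite mulr0 addr0.
by rewrite scale1r => e; apply: (addrI (pi (fun=> 0))); rewrite addr0 -e.
Qed.

Lemma rep_sum (I : Type) (r : seq I) (F : I -> K -> C) : (forall i, Cc (F i)) ->
  Cc (fun z => \sum_(i <- r) F i z) /\
  pi (fun z => \sum_(i <- r) F i z) = \sum_(i <- r) pi (F i).
Proof.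
move=> FC; split; first exact: Cc_sum.
elim: r => [|i r IH].
  rewrite big_nil -rep0; congr pi; apply/funext => z; exact: big_nil.
rewrite big_cons -IH -[pi (F i)]scale1r -pi_lin //; last exact: Cc_sum.
by congr pi; apply/funext => z; rewrite big_cons mul1r.
Qed.

End Representations.

(** * The representation of the groupoid algebra defined by a family *)

Section CLFamily.
Variables (R : realType) (G : groupType) (N H M : set G) (st : CL_hypotheses N H M).
Local Notation PT := (set_type (Pset H M)).
Local Notation MT := (set_type M).
Local Notation MB := (Mbar st).
Local Notation C := (Complex R).
Local Notation "a ** b" := (Pmul st a b) (at level 40, left associativity).
Local Notation one := (P1 st).
Variables (A : cstarAlgType R) (e : A) (s u : G -> A).
Hypothesis fam : CL_family H M e s u.
Implicit Types (a b c : PT) (m k : MT) (x y : MB) (h : MB -> C) (T : A).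

Local Notation S a := (s (val a)).
Local Notation U m := (u (val m)).

Definition Mmul m k : MT :=
  exist _ (val m * val k)%g (mem_set (subM (let: And3 h _ _ := st_normal st in h)
    (set_valP m) (set_valP k))).

Definition Minv m : MT :=
  exist _ (val m)^-1%g (mem_set (subV (let: And3 h _ _ := st_normal st in h) (set_valP m))).

Lemma CL_unitl (T : A) : e ⋆ T = T. Proof. exact: (clf_unit fam T).1. Qed.
Lemma CL_unitr (T : A) : T ⋆ e = T. Proof. exact: (clf_unit fam T).2. Qed.

Lemma CL_isometry a : cstar (S a) ⋆ S a = e.
Proof. exact: (clf_isometry fam (set_valP a)). Qed.

Lemma CL_u_unitl m : cstar (U m) ⋆ U m = e.
Proof. exact: (clf_unitary fam (set_valP m)).1. Qed.

Lemma CL_u_unitr m : U m ⋆ cstar (U m) = e.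
Proof. exact: (clf_unitary fam (set_valP m)).2. Qed.

Lemma CL_sM a b : S a ⋆ S b = S (a ** b).
Proof. exact: (clf_sM fam (set_valP a) (set_valP b)). Qed.

Lemma CL_uM m k : U m ⋆ U k = U (Mmul m k).
Proof. exact: (clf_uM fam (set_valP m) (set_valP k)). Qed.

Lemma CL_su a m : S a ⋆ U m = U (Mconj a m) ⋆ S a.
Proof. exact: (clf_su fam (set_valP a) (set_valP m)). Qed.

Lemma CL_e_sa : cstar e = e.
Proof. by rewrite -[LHS]CL_unitr -{2}[e]cstarK -cstarM CL_unitr cstarK. Qed.

Lemma CL_s1 : S one = e.
Proof. by rewrite -[LHS]CL_unitl -(CL_isometry one) -cmulA CL_sM Pmul1 CL_isometry. Qed.

Lemma CL_u1 : u 1%g = e.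
Proof.
have := CL_uM (M1 st) (M1 st); rewrite (_ : Mmul _ _ = M1 st) => [uu|]; last first.
  by apply: val_inj; rewrite /= mulg1.
by rewrite -[LHS]CL_unitl -(CL_u_unitl (M1 st)) -cmulA uu.
Qed.

Lemma CL_uV m : cstar (U m) = U (Minv m).
Proof.
have h : U m ⋆ U (Minv m) = e by rewrite CL_uM /= mulgV CL_u1.
by rewrite -[LHS]CL_unitr -h cmulA CL_u_unitl CL_unitl.
Qed.

(** Plays the part of the indicator function of the cylinder of the coset [m M_a]. *)
Definition coset_proj m a : A := U m ⋆ S a ⋆ cstar (S a) ⋆ cstar (U m).

Lemma coset_projS m b c : S b ⋆ coset_proj m c = coset_proj (Mconj b m) (b ** c) ⋆ S b.
Proof.
rewrite /coset_proj !cmulA CL_su -(cmulA _ (S b)) CL_sM -!cmulA; congr (_ ⋆ (_ ⋆ _)).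
rewrite -CL_sM cstarM -cmulA; congr (_ ⋆ _).
rewrite !CL_uV (_ : Minv (Mconj b m) = Mconj b (Minv m)); last first.
  by apply: val_inj; rewrite /= !invgM invgK !mulgA.
by rewrite -CL_su cmulA CL_isometry CL_unitl.
Qed.

Lemma coset_projU m k a : U m ⋆ coset_proj k a = coset_proj (Mmul m k) a ⋆ U m.
Proof.
rewrite /coset_proj -CL_uM cstarM !cmulA -!cmulA; congr (_ ⋆ (_ ⋆ (_ ⋆ (_ ⋆ _)))).
by rewrite CL_u_unitl CL_unitr.
Qed.

Lemma coset_proj_sa m a : cstar (coset_proj m a) = coset_proj m a.
Proof. by rewrite /coset_proj !cstarM !cstarK !cmulA. Qed.

Lemma coset_proj_sub m a b : coset_proj m a ⋆ coset_proj m (a ** b) = coset_proj m (a ** b).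
Proof.
rewrite /coset_proj -(CL_sM a b) !cmulA -(cmulA _ (cstar (U m))) CL_u_unitl CL_unitr.
by rewrite -(cmulA _ (cstar (S a)) (S a)) CL_isometry CL_unitr.
Qed.

Lemma coset_proj_idem m a : coset_proj m a ⋆ coset_proj m a = coset_proj m a.
Proof. by have := coset_proj_sub m a one; rewrite Pmul1. Qed.

(** Write [k = m (a n a^-1)]: [u] of the second factor passes through [S a] as [u n], which cancels
    against its adjoint. *)
Lemma coset_proj_same m k a : mbar (mbar_of st m) a (val k) -> coset_proj m a = coset_proj k a.
Proof.
rewrite mbar_ofE => -[_ [n Mn <-] kE].
pose n' : MT := exist _ n (mem_set Mn).
have -> : k = Mmul m (Mconj a n') by exact: val_inj.
rewrite /coset_proj -CL_uM cstarM !cmulA -(cmulA _ _ (S a)) -CL_su.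
rewrite -(cmulA _ (cstar (S a)) (cstar (U (Mconj a n')))) -cstarM -CL_su cstarM.
by rewrite !cmulA -(cmulA _ (U n')) CL_u_unitr CL_unitr.
Qed.

Lemma coset_rep a (D : set G) : Mcosets M (val a) D ->
  exists m, val m = xget 1%g D /\ mbar (mbar_of st m) a = D.
Proof.
move=> hD; have [n Mn DE] := hD; have Dn : D n by rewrite DE; exact: mem_lcos st _ _.
have Dk : D (xget 1%g D) by apply: xgetPex; exists n.
pose n' : MT := exist _ n (mem_set Mn).
have DE' : mbar (mbar_of st n') a = D by rewrite mbar_ofE DE.
have Mk : M (xget 1%g D) by apply: (@mbar_memM _ _ _ _ st (mbar_of st n') a); rewrite DE'.
pose k : MT := exist _ (xget 1%g D) (mem_set Mk).
exists k; split => //; rewrite -DE'.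
by apply: mbar_mem_eq (mem_mbar_of st k a) _; rewrite DE'.
Qed.

Lemma coset_proj_separate a T T' : (forall m, T ⋆ coset_proj m a = T' ⋆ coset_proj m a) -> T = T'.
Proof.
move=> h; rewrite -[T]CL_unitr -[T']CL_unitr -(clf_sum fam (set_valP a)).
rewrite fsbig_finite; last exact: st_finite st _ (set_valP a).
rewrite /= !cmul_sumr !big_seq; apply: eq_bigr => D.
rewrite in_fset_set; last exact: st_finite st _ (set_valP a).
by move=> /set_mem /coset_rep[m [<- _]]; exact: h.
Qed.

(** By [clf_sum] these projections sum to [e], so [proj_sum_orth] applies once the representatives
    chosen by [xget] are traded for [m] and [k]. *)
Lemma coset_proj_orth m k a : mbar (mbar_of st m) a <> mbar (mbar_of st k) a ->
  coset_proj m a ⋆ coset_proj k a = 0.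
Proof.
move=> mk; pose p D := u (xget 1%g D) ⋆ S a ⋆ cstar (S a) ⋆ cstar (u (xget 1%g D)).
have pE n : coset_proj n a = p (mbar (mbar_of st n) a).
  have [n' [n'E n'a]] := @coset_rep a (mbar (mbar_of st n) a) (set_valP (val (mbar_of st n) a)).
  by rewrite /p -n'E; apply: coset_proj_same; rewrite -n'a; exact: mem_mbar_of.
rewrite !pE; apply: (@proj_sum_orth _ _ _ (Mcosets M (val a)) p e).
- by move=> T; split; [exact: CL_unitl|exact: CL_unitr].
- exact: st_finite st _ (set_valP a).
- move=> D /coset_rep[n [nE nD]]; rewrite /p -nE -/(coset_proj n a).
  by split; [exact: coset_proj_idem|exact: coset_proj_sa].
- exact: (clf_sum fam (set_valP a)).
- exact: set_valP.
- exact: set_valP.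
- exact/eqP.
Qed.

(* [T] acts on the projections of level [a] as multiplication by the values of
   the level [a] function [h]; as these projections sum to [e], this determines
   [T]. *)
Definition acts_as h a T := level_fun h a /\
  forall m x, mbar x a (val m) -> T ⋆ coset_proj m a = h x *: coset_proj m a.

Lemma acts_as_raise h a b T : acts_as h a T -> acts_as h (a ** b) T.
Proof.
move=> [ha hT]; split=> [|m x xm]; first exact: level_fun_mul.
by rewrite -coset_proj_sub cmulA (hT m x) ?cmulZl //; apply: mbar_sub xm.
Qed.

Lemma acts_as_common h h' a b T T' : acts_as h a T -> acts_as h' b T' ->
  exists c, acts_as h c T /\ acts_as h' c T'.
Proof.
move=> hT hT'; have [a' [b' E]] := Pmul_right st a b; exists (a ** a').
by split; [|rewrite E]; exact: acts_as_raise.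
Qed.

Lemma acts_as_unique h a b T T' : acts_as h a T -> acts_as h b T' -> T = T'.
Proof.
move=> hT hT'; have [c [[_ h1] [_ h2]]] := acts_as_common hT hT'.
apply: (@coset_proj_separate c) => m.
by rewrite (h1 m (mbar_of st m)) ?(h2 m (mbar_of st m)) //; exact: mem_mbar_of.
Qed.

Lemma acts_as_ex h a : level_fun h a -> exists T, acts_as h a T.
Proof.
move=> ha; pose f D := coset_proj (xget (M1 st) [set m | mbar (mbar_of st m) a = D]) a.
pose v D := h (mbar_of st (xget (M1 st) [set m | mbar (mbar_of st m) a = D])).
have rE m : mbar (mbar_of st (xget (M1 st) [set k | mbar (mbar_of st k) a = mbar (mbar_of st m) a])) a =
    mbar (mbar_of st m) a.
  by apply: (@xgetPex _ _ [set k | mbar (mbar_of st k) a = mbar (mbar_of st m) a]); exists m.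
exists (\sum_(D <- finmap.enum_fset (fset_set (Mcosets M (val a)))) v D *: f D); split => // m x xm.
have xE : mbar x a = mbar (mbar_of st m) a by exact: mbar_mem_eq xm (mem_mbar_of _ _ _).
rewrite cmul_suml (bigD1_seq (mbar (mbar_of st m) a)) ?finmap.fset_uniq //=; last first.
  rewrite in_fset_set; last exact: st_finite st _ (set_valP a).
  by apply/mem_set; exact: set_valP.
rewrite big_seq_cond big1 => [|D /andP[]]; last first.
  rewrite in_fset_set; last exact: st_finite st _ (set_valP a).
  move=> /set_mem /coset_rep[k [_ kD]] /eqP Dm; rewrite cmulZl /f coset_proj_orth ?scaler0 //.
  by rewrite -kD rE kD.
rewrite addr0 cmulZl /v /f; congr (_ *: _); first by apply: ha; rewrite rE xE.
set k := xget _ _; rewrite -(@coset_proj_same m k) ?coset_proj_idem //.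
by have := mem_mbar_of st k a; rewrite rE.
Qed.

Lemma acts_as_lin l h h' a T T' : acts_as h a T -> acts_as h' a T' ->
  acts_as (fun x => l * h x + h' x) a (l *: T + T').
Proof.
move=> [ha hT] [ha' hT']; split=> [x y xy|m x xm].
  by rewrite (ha x y xy) (ha' x y xy).
by rewrite cmulDl cmulZl (hT m x xm) (hT' m x xm) scalerDl scalerA.
Qed.

Lemma acts_as_mul h h' a T T' : acts_as h a T -> acts_as h' a T' ->
  acts_as (fun x => h x * h' x) a (T ⋆ T').
Proof.
move=> [ha hT] [ha' hT']; split=> [x y xy|m x xm].
  by rewrite (ha x y xy) (ha' x y xy).
by rewrite -cmulA (hT' m x xm) cmulZr (hT m x xm) scalerA mulrC.
Qed.

(** [acts_as] multiplies by projections on the right, the adjoint needs them on the left; by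
    orthogonality [T] acts with the same scalars from both sides. *)
Lemma acts_as_star h a T : acts_as h a T -> acts_as (fun x => (h x)^* ) a (cstar T).
Proof.
move=> [ha hT]; split=> [x y xy|m x xm]; first by rewrite (ha x y xy).
rewrite -coset_proj_sa -cstarM -cstarZ; congr cstar.
apply: (@coset_proj_separate a) => k; rewrite -cmulA (hT k (mbar_of st k)) ?cmulZr ?cmulZl; last first.
  exact: mem_mbar_of.
have [mk|mk] := pselect (mbar (mbar_of st m) a = mbar (mbar_of st k) a).
  congr (_ *: _); apply: ha; rewrite -mk.
  exact: mbar_mem_eq (mem_mbar_of _ _ _) xm.
by rewrite coset_proj_orth // !scaler0.
Qed.

(** Tested against the projections of level [c], which [S b] moves to level [b ** c]; hence the
    levels required of the two functions. *)
Lemma acts_as_S h b c T T' : acts_as h (b ** c) T -> acts_as (h \o conjMbar b) c T' ->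
  T ⋆ S b = S b ⋆ T'.
Proof.
move=> [_ hT] [_ hT']; apply: (@coset_proj_separate c) => m.
rewrite -!cmulA (hT' m (mbar_of st m)); last exact: mem_mbar_of.
rewrite coset_projS cmulA (hT _ (conjMbar b (mbar_of st m))).
  by rewrite cmulZl cmulZr coset_projS.
exact: (mbar_conj b (mem_mbar_of st m c)).
Qed.

Lemma acts_as_U h a m T T' : acts_as h a T -> acts_as (h \o translate m) a T' ->
  T ⋆ U m = U m ⋆ T'.
Proof.
move=> [_ hT] [_ hT']; apply: (@coset_proj_separate a) => k.
rewrite -!cmulA (hT' k (mbar_of st k)); last exact: mem_mbar_of.
rewrite coset_projU cmulA (hT _ (translate m (mbar_of st k))).
  by rewrite cmulZl cmulZr coset_projU.
exact: (mbar_translate m (mem_mbar_of st k a)).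
Qed.

(** [S b ⋆ cstar (S b)] is the projection of the trivial coset at level [b], whose cylinder is the
    range of conjugation by [b]. *)
Lemma acts_as_range b : acts_as (pull (val b) (fun=> 1)) b (S b ⋆ cstar (S b)).
Proof.
have pullb x : pull (val b) (fun=> 1 : C) x = (`[< mbar x b 1%g >])%:R.
  case: asboolP => [/conjMbar_range[y ->]|nx]; first exact: pull_P_conj.
  by apply: pullN => y /arrow_P xy; apply: nx; apply/conjMbar_range; exists y.
split=> [x y xy|m x xm]; first by rewrite !pullb xy.
have -> : S b ⋆ cstar (S b) = coset_proj (M1 st) b.
  by rewrite /coset_proj /= CL_u1 CL_e_sa CL_unitl CL_unitr.
have xE : mbar x b = mbar (mbar_of st m) b by exact: mbar_mem_eq xm (mem_mbar_of _ _ _).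
rewrite pullb; case: asboolP => [x1|nx].
  rewrite scale1r -(@coset_proj_same m) ?coset_proj_idem //=.
  by rewrite -xE.
rewrite scale0r coset_proj_orth // => E; apply: nx; rewrite xE -E.
exact: (mem_mbar_of st (M1 st) b).
Qed.

End CLFamily.

(** * The calculus of continuous functions on Mbar *)

Section FunctionCalculus.
Variables (R : realType) (G : groupType) (N H M : set G) (st : CL_hypotheses N H M).
Local Notation PT := (set_type (Pset H M)).
Local Notation MT := (set_type M).
Local Notation MB := (Mbar st).
Local Notation C := (Complex R).
Local Notation "a ** b" := (Pmul st a b) (at level 40, left associativity).
Local Notation one := (P1 st).
Variables (A : cstarAlgType R) (e : A) (s u : G -> A).
Hypothesis fam : CL_family H M e s u.
Implicit Types (a b c : PT) (m k : MT) (x y : MB) (f h : MB -> C) (T : A).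

Local Notation S a := (s (val a)).
Local Notation U m := (u (val m)).
Local Notation acts_as := (@acts_as R G N H M st A s u).
Local Notation lc := (@locally_const G N H M st R).
Local Notation close := (@unif_close G N H M st R).

(** The level is left open: by [acts_as_unique] the element does not depend on it. *)
Definition lc_calculus h : A := xget 0 [set T | exists a, acts_as h a T].

Local Notation D0 := lc_calculus.

Lemma lc_calculusP h : lc h -> exists a, acts_as h a (D0 h).
Proof.
move=> [a ha]; have [T hT] := acts_as_ex fam ha.
by apply: (@xgetPex _ _ [set T | exists a, acts_as h a T]); exists T, a.
Qed.

Lemma lc_calculusE h a T : acts_as h a T -> D0 h = T.
Proof.
move=> hT; have lh : lc h by exists a; case: hT.
by have [b hb] := lc_calculusP lh; exact: (acts_as_unique fam hb hT).
Qed.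

Lemma lc_lin l f h : lc f -> lc h -> lc (fun x => l * f x + h x).
Proof.
move=> lf lh; have [a [fa ha]] := level_fun_common lf lh.
by exists a => x y xy; rewrite (fa x y xy) (ha x y xy).
Qed.

Lemma lc_mul f h : lc f -> lc h -> lc (fun x => f x * h x).
Proof.
move=> lf lh; have [a [fa ha]] := level_fun_common lf lh.
by exists a => x y xy; rewrite (fa x y xy) (ha x y xy).
Qed.

Lemma lc_comp (F : C -> C) f : lc f -> lc (F \o f).
Proof. by move=> [a fa]; exists a => x y xy; rewrite /comp (fa x y xy). Qed.

Lemma lc_calculus_lin l f h : lc f -> lc h -> D0 (fun x => l * f x + h x) = l *: D0 f + D0 h.
Proof.
move=> /lc_calculusP[a fa] /lc_calculusP[b hb]; have [c [fc hc]] := acts_as_common fam fa hb.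
exact: lc_calculusE (acts_as_lin l fc hc).
Qed.

Lemma lc_calculus_mul f h : lc f -> lc h -> D0 (fun x => f x * h x) = D0 f ⋆ D0 h.
Proof.
move=> /lc_calculusP[a fa] /lc_calculusP[b hb]; have [c [fc hc]] := acts_as_common fam fa hb.
exact: lc_calculusE (acts_as_mul fc hc).
Qed.

Lemma lc_calculus_star f : lc f -> D0 (fun x => (f x)^* ) = cstar (D0 f).
Proof. by move=> /lc_calculusP[a fa]; exact: lc_calculusE (acts_as_star fam fa). Qed.

Lemma lc_calculus_le f (c : C) : lc f -> 0 <= c -> (forall x, `|f x| <= c) -> `|D0 f| <= c.
Proof.
apply: (@norm_rho_le R MB A lc D0).
- by move=> F h _; exact: lc_comp.
- exact: lc_calculus_lin.
- exact: lc_calculus_mul.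
- exact: lc_calculus_star.
Qed.

Lemma lc_calculus_dist_le h f f' (c d : C) : lc f -> lc f' -> close h f c -> close h f' d ->
  `|D0 f - D0 f'| <= c + d.
Proof.
move=> lf lf' hf hf'; have -> : D0 f - D0 f' = D0 (fun x => -1 * f' x + f x).
  by rewrite lc_calculus_lin // scaleN1r addrC.
have b x : `|-1 * f' x + f x| <= c + d.
  rewrite mulN1r addrC -(subrK (h x) (f x)) -addrA; apply: le_trans (ler_normD _ _) _.
  by apply: lerD; [rewrite distrC|]; [exact: hf|exact: hf'].
apply: lc_calculus_le => //; first exact: lc_lin.
(* Mbar has a point, so [c + d] dominates a norm and is nonnegative. *)
exact: le_trans (normr_ge0 _) (b (mbar_of st (M1 st))).
Qed.

Lemma close_mono h f (c d : C) : close h f c -> c <= d -> close h f d.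
Proof. by move=> hf cd x; exact: le_trans (hf x) cd. Qed.

Definition calculus : (MB -> C) -> A := projT1 (cid (extension_ex lc_calculus_dist_le)).

Local Notation D := calculus.

Lemma calculus_close h : continuous h -> forall f (c : C), lc f -> close h f c ->
  `|D h - D0 f| <= c.
Proof.
move=> ch; exact: (projT2 (cid (extension_ex lc_calculus_dist_le))) (unif_approx ch).
Qed.

Lemma calculus_lc h : continuous h -> lc h -> D h = D0 h.
Proof.
move=> ch lh; apply/eqP; rewrite -subr_eq0 -normr_le0.
by apply: calculus_close => // x; rewrite subrr normr0.
Qed.

Lemma calculus_lin l f h : continuous f -> continuous h ->
  D (fun x => l * f x + h x) = l *: D f + D h.
Proof.
move=> cf ch.
have := @extension_op R A (MB -> C) close lc D0 close_mono D
  (projT2 (cid (extension_ex lc_calculus_dist_le))) (fun f h x => l * f x + h x)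
  (fun T T' => l *: T + T') f h.
case=> [v w lv lw|r r0|x y r r0|||_ //].
- by split; [exact: lc_lin|exact: lc_calculus_lin].
- have K0 : 0 < `|l| + 1 by rewrite ltr_wpDl.
  exists (r / (`|l| + 1)) => [|v w lv lw fv hw x]; first by rewrite divr_gt0.
  rewrite opprD addrACA -mulrBr; apply: le_trans (ler_normD _ _) _.
  rewrite normrM; apply: (@le_trans _ _ (`|l| * (r / (`|l| + 1)) + r / (`|l| + 1))).
    by apply: lerD; [apply: ler_wpM2l => //; exact: fv|exact: hw].
  by rewrite -{2}[r / _]mul1r -mulrDl mulrCA divff ?gt_eqF // mulr1.
- exact: clin_near.
- exact: unif_approx.
- exact: unif_approx.
Qed.

Lemma continuous_bounded f : continuous f -> exists2 B : C, 0 < B & forall x, `|f x| <= B.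
Proof.
move=> cf.
have := (compact_near_coveringP _).1 (@compact_mbar _ _ _ _ st) nat \oo
  (fun n x => `|f x| <= n%:R) _.
have near_bound x : [set: MB] x -> \forall x' \near x & n \near \oo, `|f x'| <= n%:R.
  move=> _; have x0 : 0 <= `|f x| + 1 by rewrite addr_ge0.
  have [n hn] := complex_archi x0.
  have := (@cvgrPdist_le _ C _ (nbhs x) (nbhs_filter x) f (f x)).1 (cf x) 1 ltr01.
  move=> near1; exists ([set x' | `|f x - f x'| <= 1], [set p | (n <= p)%N]).
    by split; [exact: near1|exists n].
  move=> [x' p] [/= fx np]; rewrite -(subrK (f x) (f x')) addrC.
  apply: le_trans (ler_normD _ _) _; apply: (@le_trans _ _ (`|f x| + 1)).
    by rewrite lerD2l distrC.
  by apply: le_trans (ltW hn) _; rewrite ler_nat.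
move=> /(_ eventually_filter near_bound)[n _ hn]; exists (n%:R + 1); first by rewrite ltr_wpDl.
by move=> x; apply: le_trans (hn n (leqnn n) x I) _; rewrite lerDl.
Qed.

Lemma calculus_mul f h : continuous f -> continuous h -> D (fun x => f x * h x) = D f ⋆ D h.
Proof.
move=> cf ch; have [B B0 fB] := continuous_bounded cf.
have [B' B'0 hB'] := continuous_bounded ch.
have := @extension_op R A (MB -> C) close lc D0 close_mono D
  (projT2 (cid (extension_ex lc_calculus_dist_le))) (fun f h x => f x * h x)
  (@cmul R A) f h.
case=> [v w lv lw|r r0|x y r r0|||_ //].
- by split; [exact: lc_mul|exact: lc_calculus_mul].
(* [f (h - w)] costs at most [B d] and [(f - v) w] at most [d (B' + 1)], as [d <= 1] gives
   [|w| <= B' + 1]. *)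
- have K0 : 0 < B + (B' + 1) by rewrite !addr_gt0.
  have [d [d0 d1 dK]] := pos_lower_bound (@ltr01 C) (divr_gt0 r0 K0).
  exists d => // v w lv lw fv hw x.
  have -> : f x * h x - v x * w x = f x * (h x - w x) + (f x - v x) * w x by ring.
  have w1 : `|w x| <= B' + 1.
    rewrite -(subrK (h x) (w x)) addrC; apply: le_trans (ler_normD _ _) _.
    by apply: lerD; [exact: hB'|rewrite distrC; exact: le_trans (hw x) d1].
  apply: le_trans (ler_normD _ _) _; apply: (@le_trans _ _ (d * (B + (B' + 1)))).
    rewrite [leRHS]mulrDr !normrM; apply: lerD; last by apply: ler_pM => //; exact: fv.
    by rewrite mulrC; apply: ler_pM => //; exact: hw.
  by rewrite -ler_pdivlMr.
- exact: cmul_near.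
- exact: unif_approx.
- exact: unif_approx.
Qed.

Lemma calculus_star f : continuous f -> D (fun x => (f x)^* ) = cstar (D f).
Proof.
move=> cf.
have := @extension_op R A (MB -> C) close lc D0 close_mono D
  (projT2 (cid (extension_ex lc_calculus_dist_le))) (fun f _ x => (f x)^* )
  (fun T _ => cstar T) f f.
case=> [v w lv lw|r r0|x y r r0|||_ //].
- by split; [exact: (lc_comp (fun z => z^* ))|exact: lc_calculus_star].
- by exists r => // v w lv lw fv _ x; rewrite -rmorphB norm_conjC; exact: fv.
- by have [d d0 hd] := cstar_near x r0; exists d => // x' _ hx _; exact: hd.
- exact: unif_approx.
- exact: unif_approx.
Qed.

Lemma calculus_intertwine (phi : MB -> MB) T h : `|T| <= 1 -> continuous phi ->
  (forall f, lc f -> lc (f \o phi) /\ D0 f ⋆ T = T ⋆ D0 (f \o phi)) ->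
  continuous h -> D h ⋆ T = T ⋆ D (h \o phi).
Proof.
move=> T1 cphi hphi ch.
have chp : continuous (h \o phi).
  by move=> x; apply: continuous_comp; [exact: cphi|exact: ch].
apply/eqP; rewrite -subr_eq0 -normr_le0; apply/ler_addgt0Pr => r r0; rewrite add0r.
have [f [lf hf]] := unif_approx ch (divr_gt0 r0 (ltr0Sn _ 1)).
have [lfp E] := hphi f lf.
have -> : D h ⋆ T - T ⋆ D (h \o phi) =
    (D h - D0 f) ⋆ T + T ⋆ (D0 (f \o phi) - D (h \o phi)).
  by rewrite cmulBl cmulBr E addrA subrK.
rewrite (splitr r); apply: le_trans (ler_normD _ _) _; apply: lerD.
  apply: le_trans (cnormM _ _) _; rewrite -[leRHS]mulr1.
  by apply: ler_pM => //; exact: calculus_close.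
apply: le_trans (cnormM _ _) _; rewrite -[leRHS]mul1r.
apply: ler_pM => //; rewrite distrC; apply: calculus_close => // x.
exact: hf.
Qed.

Lemma norm_S a : `|S a| <= 1.
Proof.
apply: (norm_isometry (p := e)); last exact: (CL_isometry fam).
by rewrite (CL_e_sa fam) (CL_unitl fam).
Qed.

Lemma norm_U m : `|U m| <= 1.
Proof.
apply: (norm_isometry (p := e)); last exact: (CL_u_unitl fam).
by rewrite (CL_e_sa fam) (CL_unitl fam).
Qed.

Lemma calculus_S b h : continuous h -> D h ⋆ S b = S b ⋆ D (h \o conjMbar b).
Proof.
apply: calculus_intertwine; [exact: norm_S|exact: continuous_conjMbar|].
(* [acts_as_S] asks for a level of the form [b ** c], reached through a common right multiple of [a]
   and [b]. *)
move=> f lf; have [a fa] := lc_calculusP lf; have [a' [c E]] := Pmul_right st a b.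
have fbc : acts_as f (b ** c) (D0 f) by rewrite -E; exact: (acts_as_raise fam).
have fc : level_fun (f \o conjMbar b) c.
  move=> x y xy; apply: fbc.1.
  exact: ((@conjMbar_same _ _ _ _ st b x y c).1 xy).
have [T hT] := acts_as_ex fam fc; split; first by exists c.
by rewrite (lc_calculusE hT); exact: (acts_as_S fam fbc hT).
Qed.

Lemma calculus_U m h : continuous h -> D h ⋆ U m = U m ⋆ D (h \o translate m).
Proof.
apply: calculus_intertwine; [exact: norm_U|exact: continuous_translate|].
move=> f lf; have [a fa] := lc_calculusP lf.
have fc : level_fun (f \o translate m) a.
  by move=> x y xy; apply: fa.1; exact: translate_same.
have [T hT] := acts_as_ex fam fc; split; first by exists a.
by rewrite (lc_calculusE hT); exact: (acts_as_U fam fa hT).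
Qed.

Lemma calculus_1 : D (fun=> 1) = e.
Proof.
have sp : acts_as (fun=> 1) one e.
  by split => // m x _; rewrite (CL_unitl fam) scale1r.
rewrite calculus_lc; [exact: lc_calculusE sp|exact: cst_continuous|by exists one].
Qed.

Lemma calculus_range b : D (pull (val b) (fun=> 1)) = S b ⋆ cstar (S b).
Proof.
have sp := acts_as_range st fam b.
rewrite calculus_lc; [exact: lc_calculusE sp| |by exists b; case: sp].
by apply: continuous_pull; exact: cst_continuous.
Qed.

End FunctionCalculus.

(** * The partial isometries V_g and their relations *)

Section PartialRepresentation.
Variables (R : realType) (G : groupType) (N H M : set G) (st : CL_hypotheses N H M).
Local Notation PT := (set_type (Pset H M)).
Local Notation MT := (set_type M).
Local Notation MB := (Mbar st).
Local Notation C := (Complex R).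
Local Notation "a ** b" := (Pmul st a b) (at level 40, left associativity).
Local Notation one := (P1 st).
Local Notation K := (restricted_groupoid st).
Variables (A : cstarAlgType R) (e : A) (s u : G -> A).
Hypothesis fam : CL_family H M e s u.
Implicit Types (a b c : PT) (m k : MT) (g : G) (f h : MB -> C) (T : A) (F : K -> C).

Local Notation S a := (s (val a)).
Local Notation U m := (u (val m)).
Local Notation D := (@calculus R G N H M st A e s u fam).

(** A common left multiple of [a] and [c] equalises the denominators; then the parts in [N] and in
    [H] agree separately, because [N] and [H] meet in 1. *)
Lemma nform_common (a b c d : PT) (m k : MT) :
  ((val a)^-1 * val m * val b = (val c)^-1 * val k * val d)%g ->
  exists al ga, [/\ al ** a = ga ** c, Mconj al m = Mconj ga k & al ** b = ga ** d].
Proof.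
move=> E; have [al [ga ac]] := Pmul_left st a c; exists al, ga.
have [[sgN sgH _ _ NH] [sgM MN _]] := (st_semidirect st, st_normal st).
have E' : (val (Mconj al m) * val (al ** b) = val (Mconj ga k) * val (ga ** d))%g.
  transitivity (val (al ** a) * ((val a)^-1 * val m * val b))%g.
    by rewrite /= !mulgA !mulgVK mulgK.
  by rewrite ac E /= !mulgA !mulgVK mulgK.
have mk : ((val (Mconj ga k))^-1 * val (Mconj al m) = 1)%g.
  suff : (N `&` H) ((val (Mconj ga k))^-1 * val (Mconj al m))%g by rewrite NH.
  split; first by apply: (subM sgN); [apply: (subV sgN)|]; apply: MN; exact: set_valP.
  have -> : ((val (Mconj ga k))^-1 * val (Mconj al m) =
             val (ga ** d) * (val (al ** b))^-1)%g.
    by apply: (@mulIg _ (val (al ** b))); rewrite mulgVK -mulgA E' mulKg.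
  by apply: (subF sgH); exact: (HPset (set_valP _)).
have e1 : Mconj al m = Mconj ga k.
  by apply: val_inj; rewrite -[LHS](mulVKg (val (Mconj ga k))) mk mulg1.
split => //; apply: val_inj.
by apply: (@mulgI _ (val (Mconj al m))); rewrite E' e1.
Qed.

Definition partial_iso g : A :=
  let t := sval (cid (nform_ex st g)) in cstar (S t.1.1) ⋆ U t.1.2 ⋆ S t.2.

Local Notation V := partial_iso.

(** [S al] passes through [U], meets its adjoint and cancels. With [nform_common] this is why [V g]
    depends on [g] only. *)
Lemma partial_iso_raise al a m b :
  cstar (S (al ** a)) ⋆ U (Mconj al m) ⋆ S (al ** b) = cstar (S a) ⋆ U m ⋆ S b.
Proof.
rewrite -!(CL_sM st fam) cstarM -!cmulA; congr (_ ⋆ _).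
rewrite !cmulA -(cmulA _ (U (Mconj al m))) -(CL_su fam) cmulA (CL_isometry fam) (CL_unitl fam).
by [].
Qed.

Lemma partial_isoE g a m b : g = ((val a)^-1 * val m * val b)%g -> V g = cstar (S a) ⋆ U m ⋆ S b.
Proof.
rewrite /partial_iso; case: cid => -[[c k] d] /= gE1 gE2.
have : ((val c)^-1 * val k * val d = (val a)^-1 * val m * val b)%g.
  by rewrite -gE2 -gE1.
case/nform_common => al [ga [e1 e2 e3]].
by rewrite -(partial_iso_raise al c k d) e1 e2 e3 partial_iso_raise.
Qed.

Lemma partial_iso_ex g : exists a m b, g = ((val a)^-1 * val m * val b)%g /\
  V g = cstar (S a) ⋆ U m ⋆ S b.
Proof.
have [[[a m] b] gE] := nform_ex st g; exists a, m, b; split; first exact: gE.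
exact: partial_isoE.
Qed.

Lemma partial_iso_star g : cstar (V g) = V g^-1%g.
Proof.
have [a [m [b [gE ->]]]] := partial_iso_ex g.
rewrite (@partial_isoE _ b (Minv st m) a); last by rewrite gE /= !invgM invgK !mulgA.
by rewrite !cstarM cstarK (CL_uV st fam) cmulA.
Qed.

Lemma partial_iso_P a : V (val a) = S a.
Proof.
rewrite (@partial_isoE _ one (M1 st) a); last by rewrite /= invg1 !mul1g.
by rewrite (CL_s1 st fam) /= (CL_u1 st fam) (CL_e_sa fam) !(CL_unitl fam).
Qed.

Lemma partial_iso_M m : V (val m) = U m.
Proof.
rewrite (@partial_isoE _ one m one); last by rewrite /= invg1 mul1g mulg1.
by rewrite (CL_s1 st fam) (CL_e_sa fam) (CL_unitl fam) (CL_unitr fam).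
Qed.

Lemma continuous_comp_conj a f : continuous f -> continuous (f \o conjMbar a).
Proof.
by move=> cf x; apply: continuous_comp; [exact: continuous_conjMbar|exact: cf].
Qed.

Lemma continuous_comp_translate m f : continuous f -> continuous (f \o translate m).
Proof.
by move=> cf x; apply: continuous_comp; [exact: continuous_translate|exact: cf].
Qed.

Lemma calculus_Sstar a f : continuous f -> cstar (S a) ⋆ D f = D (f \o conjMbar a) ⋆ cstar (S a).
Proof.
move=> cf; apply: (can_inj (@cstarK _ A)).
have cfc : continuous (fun x => (f x)^* ).
  exact: (ccontinuous_comp (F := fun z => z^* ) (@continuous_conjC R) cf).
rewrite !cstarM cstarK -(calculus_star fam cf) -(calculus_star fam (continuous_comp_conj (a := a) cf)).
exact: (calculus_S fam a cfc).
Qed.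

(** [f'] is [f] evaluated at [m^-1 (a x a^-1)]; it is specified by a relation between [x] and [y] to
    match [pull_comp]. *)
Lemma calculus_left a m f : continuous f -> exists2 f', continuous f' &
  cstar (S a) ⋆ U m ⋆ D f = D f' ⋆ (cstar (S a) ⋆ U m) /\
  forall x y, conjMbar a x = translate m y -> f' x = f y.
Proof.
move=> cf; have [k hk] := translateVK st m.
exists ((f \o translate k) \o conjMbar a).
  by apply: continuous_comp_conj; exact: continuous_comp_translate.
split.
  have fE : f = (f \o translate k) \o translate m.
    apply/funext => x; congr f; apply: (@translate_inj _ _ _ _ st m).
    by rewrite hk.
  have ck := continuous_comp_translate (m := k) cf.
  rewrite {1}fE -cmulA -(calculus_U fam m ck) !cmulA.
  by rewrite (calculus_Sstar a ck).
move=> x y xy; rewrite /comp xy; congr f; apply: (@translate_inj _ _ _ _ st m).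
by rewrite hk.
Qed.

Lemma partial_iso_D g h : continuous h -> V g ⋆ D h = D (pull g h) ⋆ V g.
Proof.
move=> ch; have [a [m [b [gE ->]]]] := partial_iso_ex g.
have cb : continuous (pull (val b) h) by exact: continuous_pull.
have [f' cf' [DE f'E]] := calculus_left a m cb.
have -> : pull g h = f'.
  apply/funext => x; have [k hk] := translateVK st m.
  have xE : conjMbar a x = translate m (translate k (conjMbar a x)) by rewrite hk.
  by rewrite (f'E _ _ xE) (pull_comp _ gE xE).
(* Conjugation by [b] is defined on all of Mbar, so [h] is recovered from [pull (val b) h], to which
   [calculus_S] applies. *)
have hE : h = pull (val b) h \o conjMbar b.
  by apply/funext => x; rewrite /comp pull_P_conj.
by rewrite {1}hE -cmulA -(calculus_S fam b cb) !cmulA DE !cmulA.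
Qed.

Lemma partial_iso_dom g : D (pull g (fun=> 1)) ⋆ V g = V g.
Proof.
by rewrite -partial_iso_D ?calculus_1 ?(CL_unitr fam) //; exact: cst_continuous.
Qed.

(** Over a common left multiple of [b] and [c] the two forms meet in the range projection of one
    isometry. Moved to the left by [calculus_left] it becomes the indicator of the domain of [g],
    and what remains is a normal form of the product. *)
Lemma partial_iso_mul g g' : V g ⋆ V g' = D (pull g (fun=> 1)) ⋆ V (g * g')%g.
Proof.
have [a [m [b [gE ->]]]] := partial_iso_ex g; have [c [k [d [g'E ->]]]] := partial_iso_ex g'.
have [be [ga bc]] := Pmul_left st b c.
have bcv : (val be * val b = val ga * val c)%g := congr1 val bc.
rewrite -(partial_iso_raise be a m b) -(partial_iso_raise ga c k d) -bc.
have gE' : g = ((val (be ** a))^-1 * val (Mconj be m) * val (be ** b))%g.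
  by rewrite gE /= !invgM !mulgA !mulgVK.
have ggE : (g * g')%g =
    ((val (be ** a))^-1 * val (Mmul st (Mconj be m) (Mconj ga k)) * val (ga ** d))%g.
  have bcE : (val b * (val c)^-1 = (val be)^-1 * val ga)%g.
    by apply: (@mulIg _ (val c)); rewrite mulgVK -mulgA -bcv mulKg.
  rewrite gE g'E /= !invgM !mulgA !mulgVK -!mulgA.
  by rewrite [(val b * ((val c)^-1 * _))%g]mulgA bcE !mulgA.
rewrite (partial_isoE ggE) -(CL_uM st fam).
have c1 : continuous (pull (val (be ** b)) (fun=> 1) : MB -> C).
  by apply: continuous_pull; exact: cst_continuous.
have [f' cf' [DE f'E]] := calculus_left (be ** a) (Mconj be m) c1.
have -> : pull g (fun=> 1) = f'.
  apply/funext => x; have [n hn] := translateVK st (Mconj be m).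
  have xE : conjMbar (be ** a) x =
    translate (Mconj be m) (translate n (conjMbar (be ** a) x)) by rewrite hn.
  by rewrite (f'E _ _ xE) (pull_comp _ gE' xE).
rewrite !cmulA -(cmulA _ (S (be ** b))) -(calculus_range st fam) -!cmulA.
by rewrite cmulA (cmulA (cstar _ ⋆ _)) DE !cmulA.
Qed.

End PartialRepresentation.

(** * The representation of C_c defined by the family *)

Section InducedRepresentation.
Variables (R : realType) (G : groupType) (N H M : set G) (st : CL_hypotheses N H M).
Local Notation MB := (Mbar st).
Local Notation C := (Complex R).
Local Notation K := (restricted_groupoid st).
Variables (A : cstarAlgType R) (e : A) (s u : G -> A).
Hypothesis fam : CL_family H M e s u.
Implicit Types (g : G) (f h : MB -> C) (F : K -> C).

Local Notation D := (@calculus R G N H M st A e s u fam).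
Local Notation V := (@partial_iso R G N H M st A s u).

Definition induced F : A := \sum_(g \in setT) D (restr_slice F g) ⋆ V g.

Lemma calculus_0 : D (fun=> 0) = 0.
Proof.
have c0 : continuous ((fun=> 0) : MB -> C) by exact: cst_continuous.
have := calculus_lin fam 1 c0 c0.
rewrite (_ : (fun x => _) = fun=> 0); last by apply/funext => x; rewrite mulr0 addr0.
by rewrite scale1r => E; apply: (addrI (D (fun=> 0))); rewrite addr0 -E.
Qed.

Lemma restr_slice0 F g : (forall z, gelt z = g -> F z = 0) -> restr_slice F g = fun=> 0.
Proof.
move=> F0; apply/funext => x; rewrite /restr_slice; case: pselect => // ex.
exact: F0.
Qed.

Lemma inducedE F (r : seq G) : uniq r -> (forall z, F z != 0 -> gelt z \in r) ->
  induced F = \sum_(g <- r) D (restr_slice F g) ⋆ V g.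
Proof.
move=> ur Fr; rewrite (fsbig_seq _ _ ur); apply/esym/fsbig_widen => // g [_ gr].
rewrite /preimage /mkset restr_slice0 ?calculus_0 ?cmul0x // => z zg.
by apply/eqP/negPn/negP => /Fr; rewrite zg => /gr.
Qed.

Lemma restr_on_slice h g : restr_slice (on_slice h g : K -> C) g = fun x => h x * pull g (fun=> 1) x.
Proof.
apply/funext => x; rewrite /restr_slice; case: pselect => [ex|n].
  by rewrite /on_slice gpt_mk eqxx (pullE _ (projT2 (cid ex))) mulr1.
by rewrite pullN ?mulr0 // => y xy; apply: n; exists y.
Qed.

(** The slice sees [h] on the domain of [g] only; the indicator introduced by the restriction is
    absorbed by [V g]. *)
Lemma induced_on_slice h g : continuous h -> induced (on_slice h g) = D h ⋆ V g.
Proof.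
move=> ch; rewrite (@inducedE _ [:: g]) // => [|z]; last first.
  by rewrite /on_slice inE; have [//|_] := eqVneq (gelt z) g; rewrite eqxx.
rewrite big_seq1 restr_on_slice (calculus_mul fam ch); last first.
  by apply: continuous_pull; exact: cst_continuous.
by rewrite -cmulA (partial_iso_dom st fam).
Qed.

Lemma induced_lin k F F' : Cc F -> Cc F' ->
  induced (fun z => k * F z + F' z) = k *: induced F + induced F'.
Proof.
move=> FC F'C; have [r [ur hr]] := Cc_support FC; have [r' [ur' hr']] := Cc_support F'C.
pose t := undup (r ++ r'); have ut : uniq t := undup_uniq _.
have h z : F z != 0 -> gelt z \in t.
  by move=> /hr zr; rewrite mem_undup mem_cat zr.
have h' z : F' z != 0 -> gelt z \in t.
  by move=> /hr' zr; rewrite mem_undup mem_cat zr orbT.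
rewrite (inducedE ut h) (inducedE ut h') (inducedE (F := fun z => k * F z + F' z) ut).
  rewrite scaler_sumr -big_split; apply: eq_bigr => g _.
  change (D (restr_slice (fun z => k * F z + F' z) g) ⋆ V g =
    k *: (D (restr_slice F g) ⋆ V g) + D (restr_slice F' g) ⋆ V g).
  rewrite -cmulZl -cmulDl -(calculus_lin fam); first congr (D _ ⋆ _).
  - apply/funext => x; rewrite /restr_slice; case: pselect => // _.
    by rewrite mulr0 addr0.
  - exact: (continuous_restr_slice (proj1 FC)).
  - exact: (continuous_restr_slice (proj1 F'C)).
move=> z nz; apply: contraT => zt; move: nz.
have -> : F z = 0 by apply/eqP/negPn/negP => /h; rewrite (negbTE zt).
have -> : F' z = 0 by apply/eqP/negPn/negP => /h'; rewrite (negbTE zt).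
by rewrite mulr0 addr0 eqxx.
Qed.

(** The product of two slices: [x ⋆ y] and [z ⋆ t] stand for [D f ⋆ V g] and [D f' ⋆ V g'], [p] for
    [D (pull g f')], [r] for the indicator of the domain of [g], and [w] for [V] of the product. *)
Lemma crossed_mul (x y z t p q r w : A) :
  y ⋆ z = p ⋆ y -> x ⋆ p = q -> y ⋆ t = r ⋆ w -> q ⋆ r = q ->
  x ⋆ y ⋆ (z ⋆ t) = q ⋆ w.
Proof.
by move=> yz xp yt qr; rewrite cmulA -(cmulA x) yz (cmulA x) xp -cmulA yt cmulA qr.
Qed.

Lemma induced_rep : Cc_rep induced.
Proof.
split; first exact: induced_lin.
- move=> F F' FC F'C; have [r [_ FE]] := Cc_decomp FC.
  have [r' [_ F'E]] := Cc_decomp F'C.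
  pose f := restr_slice F; pose f' := restr_slice F'.
  have cf g : continuous (f g) by exact: (continuous_restr_slice (proj1 FC)).
  have cf' g : continuous (f' g) by exact: (continuous_restr_slice (proj1 F'C)).
  have cff g g' : continuous (fun x => f g x * pull g (f' g') x).
    by apply: (ccontinuousM (f := f g)); [exact: cf|exact: continuous_pull].
  have sums (t : seq G) (p : G -> MB -> C) : (forall g, continuous (p g)) ->
      induced (fun z => \sum_(g <- t) on_slice (p g) g z) = \sum_(g <- t) D (p g) ⋆ V g.
    move=> cp; have [_ ->] := rep_sum induced_lin t (fun g => Cc_on_slice g (cp g)).
    by apply: eq_bigr => g _; exact: induced_on_slice.
  rewrite [in LHS]FE [in LHS]F'E conv_sum.
  have inner g : Cc (fun z : K => \sum_(g' <- r') conv (on_slice (f g) g) (on_slice (f' g') g') z) /\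
      induced (fun z => \sum_(g' <- r') conv (on_slice (f g) g) (on_slice (f' g') g') z) =
      \sum_(g' <- r') D (f g) ⋆ V g ⋆ (D (f' g') ⋆ V g').
    have c g' : Cc (conv (on_slice (f g) g) (on_slice (f' g') g') : K -> C).
      by rewrite conv_on_slice; apply: Cc_on_slice; exact: cff.
    have [h ->] := rep_sum induced_lin r' c; split; first exact: h.
    apply: eq_bigr => g' _; rewrite conv_on_slice (induced_on_slice _ (cff g g')).
    have c1 : continuous (pull g (fun=> 1) : MB -> C).
      by apply: continuous_pull; exact: cst_continuous.
    have cp : continuous (pull g (f' g')) := continuous_pull (g := g) (cf' g').
    apply/esym; apply: (crossed_mul (partial_iso_D fam g (cf' g')) _ (partial_iso_mul st fam g g')).
      exact: (esym (calculus_mul fam (cf g) cp)).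
    (* [pull g (f' g')] vanishes off the domain of [g], so it absorbs the indicator of that
       domain. *)
    rewrite -(calculus_mul fam (cff g g') c1); congr D.
    apply/funext => x; rewrite -mulrA; congr (_ * _).
    have [[y xy]|n] := pull_cases g x.
      by rewrite (pullE (fun=> 1) xy) mulr1.
    by rewrite [in RHS](pullN _ n) (pullN _ n) mul0r.
  have [_ ->] := rep_sum induced_lin r (fun g => (inner g).1).
  rewrite [in RHS]FE [in RHS]F'E (sums _ _ cf) (sums _ _ cf') cmul_suml; apply: eq_bigr => g _.
  by rewrite (inner g).2 cmul_sumr.
- move=> F FC; have [r [_ FE]] := Cc_decomp FC.
  pose f := restr_slice F.
  have cf g : continuous (f g) by exact: (continuous_restr_slice (proj1 FC)).
  have cfc g : continuous (fun x => (f g x)^* ).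
    exact: (ccontinuous_comp (F := fun z => z^* ) (@continuous_conjC R) (cf g)).
  have -> : invol F = fun z => \sum_(g <- r) invol (on_slice (f g) g) z.
    by apply/funext => z; rewrite /invol {1}FE rmorph_sum.
  have c g : Cc (invol (on_slice (f g) g) : K -> C).
    by rewrite invol_on_slice; apply: Cc_on_slice; exact: continuous_pull.
  have [_ ->] := rep_sum induced_lin r c.
  rewrite [in RHS]FE; have [_ ->] := rep_sum induced_lin r (fun g => Cc_on_slice g (cf g)).
  have -> : cstar (\sum_(g <- r) induced (on_slice (f g) g)) =
      \sum_(g <- r) cstar (induced (on_slice (f g) g)).
    by apply: (big_morph (@cstar R A)) => [x y|]; [exact: cstarD|exact: cstar0].
  apply: eq_bigr => g _; rewrite invol_on_slice (induced_on_slice _ (cf g)).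
  rewrite (induced_on_slice _ (continuous_pull (g := g^-1%g) (cfc g))).
  by rewrite cstarM (partial_iso_star st fam) -(calculus_star fam (cf g)) (partial_iso_D fam _ (cfc g)).
Qed.

End InducedRepresentation.

(** * The family in the groupoid algebra *)

Section GroupoidFamily.
Variables (R : realType) (G : groupType) (N H M : set G) (st : CL_hypotheses N H M).
Local Notation PT := (set_type (Pset H M)).
Local Notation MT := (set_type M).
Local Notation MB := (Mbar st).
Local Notation C := (Complex R).
Local Notation K := (restricted_groupoid st).
Variables (B : cstarAlgType R) (iota : (K -> C) -> B).
Hypothesis rep : Cc_rep iota.
Hypothesis dense : closure [set iota F | F in @Cc R K] = setT.
Implicit Types (a b : PT) (m k : MT) (x y : MB) (g h : G) (f : MB -> C) (F : K -> C).

Local Notation cst1 := ((fun=> 1) : MB -> C).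

Lemma iota_lin l F F' : Cc F -> Cc F' ->
  iota (fun z => l * F z + F' z) = l *: iota F + iota F'.
Proof. by case: rep => h _ _; exact: h. Qed.

Lemma Cc_chi g : Cc (on_slice cst1 g : K -> C).
Proof. by apply: Cc_on_slice; exact: cst_continuous. Qed.

Definition chi g : B := iota (on_slice cst1 g).

Lemma pull1 f : pull 1%g f = f.
Proof. by apply/funext => x; exact: (pullE _ (arrow1 x)). Qed.

Lemma continuous_dom g : continuous (pull g (fun=> 1) : MB -> C).
Proof. by apply: continuous_pull; exact: cst_continuous. Qed.

Lemma iota_mul f f' g g' : continuous f -> continuous f' ->
  iota (on_slice f g) ⋆ iota (on_slice f' g') = iota (on_slice (fun x => f x * pull g f' x) (g * g')%g).
Proof.
move=> cf cf'; case: rep => _ mulP _.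
by rewrite -mulP ?conv_on_slice //; exact: Cc_on_slice.
Qed.

Lemma chi_mul g h : chi g ⋆ chi h = iota (on_slice (pull g (fun=> 1)) (g * h)%g).
Proof.
rewrite /chi iota_mul; [|exact: cst_continuous|exact: cst_continuous].
by congr (iota (on_slice _ _)); apply/funext => x; rewrite mul1r.
Qed.

Lemma chi_mulE g h : (forall x z, arrow (st := st) (g * h)%g x z -> exists y, arrow g x y) ->
  chi g ⋆ chi h = chi (g * h)%g.
Proof.
move=> gh; rewrite chi_mul; congr iota; apply/funext => z; rewrite /on_slice.
have [zg|//] := eqVneq (gelt z) (g * h)%g.
have [w zw] := gsp_ex z; rewrite zg in zw; have [y xy] := gh _ _ zw.
exact: (pullE _ xy).
Qed.

Lemma chi_mull g h : (forall x, exists y, arrow (st := st) g x y) ->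
  chi g ⋆ chi h = chi (g * h)%g.
Proof. by move=> tg; apply: chi_mulE. Qed.

(** If [x.(g h) = z], then [x.g] is [z.h^-1], which lies in Mbar by hypothesis; so the domain of
    [g h] is contained in that of [g]. *)
Lemma chi_mulr g h : (forall z, exists y, arrow (st := st) h y z) ->
  chi g ⋆ chi h = chi (g * h)%g.
Proof.
move=> th; apply: chi_mulE => x z xz; have [y yz] := th z; exists y.
by have := arrowM xz (arrowV yz); rewrite mulgK.
Qed.

Lemma arrow_P_total b z : exists y, arrow (st := st) (val b) y z.
Proof. by exists (conjMbar b z); apply/arrow_P. Qed.

Lemma arrow_PV_total b x : exists y, arrow (st := st) (val b)^-1%g x y.
Proof. by have [y xy] := arrow_P_total b x; exists y; exact: arrowV. Qed.

Lemma arrow_M_total m z : exists y, arrow (st := st) (val m) y z.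
Proof. by exists (translate m z); apply/arrow_M. Qed.

Lemma arrow_M_totalr m x : exists y, arrow (st := st) (val m) x y.
Proof.
have [y xy] := arrow_M_total (Minv st m) x.
by exists y; have := arrowV xy; rewrite /= invgK.
Qed.

Lemma chi_star g : cstar (chi g) = chi g^-1%g.
Proof.
case: rep => _ _ starP; rewrite -starP; last exact: Cc_chi.
rewrite invol_on_slice; congr iota; apply/funext => z; rewrite /on_slice.
have [zg|//] := eqVneq (gelt z) g^-1%g.
have [w zw] := gsp_ex z; rewrite zg in zw.
by rewrite (pullE _ zw) rmorph1.
Qed.

Lemma dense_near (x : B) (r : C) : 0 < r -> exists2 F, Cc F & `|x - iota F| <= r.
Proof.
move=> r0; have : closure [set iota F | F in @Cc R K] x by rewrite dense.
move=> /(_ (ball x r) (nbhsx_ballx x r r0))[_ [[F FC <-]]].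
by rewrite -ball_normE => xF; exists F => //; exact: ltW.
Qed.

(** Immediate on slice functions, hence on the image of C_c; density and [|chi 1| <= 1] give the
    rest. *)
Lemma chi_unitl (x : B) : chi 1%g ⋆ x = x.
Proof.
have c1 : `|chi 1%g| <= 1.
  apply: norm_proj; rewrite chi_star invg1 chi_mull ?mulg1 // => y.
  by exists y; exact: arrow1.
have unitF F : Cc F -> chi 1%g ⋆ iota F = iota F.
  move=> FC; have [r [_ FE]] := Cc_decomp FC.
  have cF g : continuous (restr_slice F g) := continuous_restr_slice (g := g) (proj1 FC).
  have [_ sumE] := rep_sum iota_lin r (fun g => Cc_on_slice g (cF g)).
  rewrite FE sumE cmul_sumr; apply: eq_bigr => g _.
  rewrite /chi iota_mul; [|exact: cst_continuous|exact: cF].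
  rewrite pull1 mul1g; congr (iota (on_slice _ _)).
  by apply/funext => y; rewrite mul1r.
apply/eqP; rewrite -subr_eq0 -normr_le0; apply/ler_addgt0Pr => r r0; rewrite add0r.
have [F FC xF] := dense_near x (divr_gt0 r0 (ltr0Sn _ 1)).
have -> : chi 1%g ⋆ x - x = chi 1%g ⋆ (x - iota F) + (iota F - x).
  by rewrite cmulBr (unitF F FC) addrA subrK.
rewrite (splitr r); apply: le_trans (ler_normD _ _) _; apply: lerD.
  apply: le_trans (cnormM _ _) _; rewrite -[leRHS]mul1r.
  by apply: ler_pM.
by rewrite distrC.
Qed.

Lemma chi_unitr (x : B) : x ⋆ chi 1%g = x.
Proof.
apply: (can_inj (@cstarK _ B)); rewrite cstarM chi_star invg1.
exact: chi_unitl.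
Qed.

(** Arrows with group part [m a] have ranges [m (a y a^-1)], whose coordinate at [a] is the coset of
    [m]; the converse is [conjMbar_range] after translation by [m^-1]. *)
Lemma pull_cosetE m a x : pull (val m * val a)%g (fun=> 1) x =
  (`[< mbar x a = mbar (mbar_of st m) a >])%:R :> C.
Proof.
have hk z : translate m (translate (Minv st m) z) = z.
  by rewrite (translateM (p := M1 st)) ?translate1 //= mulgV.
have domE y : arrow (val m * val a)%g x y <-> x = translate m (conjMbar a y).
  split=> [xy|->].
    have yz : arrow (val a) (conjMbar a y) y by apply/arrow_P.
    have := arrowM xy (arrowV yz); rewrite mulgK => h.
    exact: (arrow_M m x _).1 h.
  by apply: arrowM; [exact: (arrow_M _ _ _).2|apply/arrow_P].
case: asboolP => [xm|nx].
  have : mbar (translate (Minv st m) x) a 1%g.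
    rewrite -(mulVg (val m)); apply: mbar_translate.
    by rewrite xm; exact: mem_mbar_of.
  move=> /conjMbar_range[y xE].
  have xy : arrow (val m * val a)%g x y by apply/domE; rewrite -xE hk.
  exact: (pullE _ xy).
apply: pullN => y /domE xE; apply: nx; rewrite xE.
have y1 : mbar (conjMbar a y) a 1%g by apply/conjMbar_range; exists y.
have := mbar_translate m y1; rewrite mulg1 => h.
exact: mbar_mem_eq h (mem_mbar_of _ _ _).
Qed.

Lemma chi_coset m a :
  chi (val m) ⋆ chi (val a) ⋆ cstar (chi (val a)) ⋆ cstar (chi (val m)) =
  iota (on_slice (pull (val m * val a)%g (fun=> 1)) 1%g).
Proof.
rewrite -cmulA -cstarM chi_mull; last exact: arrow_M_totalr.
by rewrite chi_star chi_mul mulgV.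
Qed.

Lemma chi_family : CL_family H M (chi 1%g) chi chi.
Proof.
have PE (g : G) (Pg : Pset H M g) : exists p : PT, val p = g.
  by exists (exist _ g (mem_set Pg)).
have ME (g : G) (Mg : M g) : exists k : MT, val k = g.
  by exists (exist _ g (mem_set Mg)).
split.
- by move=> x; split; [exact: chi_unitl|exact: chi_unitr].
- move=> a /PE[p <-]; rewrite chi_star chi_mull ?mulVg //.
  exact: arrow_PV_total.
- move=> m /ME[k <-]; rewrite chi_star; split; rewrite chi_mulr ?mulVg ?mulgV //.
    exact: arrow_M_total.
  by move=> z; have [y zy] := arrow_M_totalr k z; exists y; exact: arrowV.
- move=> a b _ /PE[q <-]; rewrite chi_mulr //; exact: arrow_P_total.
- move=> m n _ /ME[k <-]; rewrite chi_mulr //; exact: arrow_M_total.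
- move=> a m /PE[p <-] /ME[k <-]; rewrite chi_mulr; last exact: arrow_M_total.
  by rewrite chi_mulr ?mulgVK //; exact: arrow_P_total.
- move=> a0 /PE[a <-]; have fin := st_finite st (set_valP a).
  rewrite fsbig_finite //.
  (* Each summand becomes the indicator, on the unit slice, of the cylinder of its coset; these
     cylinders partition Mbar. *)
  have -> : \sum_(D <- finmap.enum_fset (fset_set (Mcosets M (val a))))
      (let k := xget 1%g D in chi k ⋆ chi (val a) ⋆ cstar (chi (val a)) ⋆ cstar (chi k)) =
      \sum_(D <- finmap.enum_fset (fset_set (Mcosets M (val a))))
        iota (on_slice (fun x => (`[< mbar x a = D >])%:R) 1%g).
    rewrite big_seq [RHS]big_seq; apply: eq_bigr => D.
    rewrite in_fset_set // => /set_mem /(coset_rep st)[k [<- kD]].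
    rewrite -[LHS]/(chi (val k) ⋆ chi (val a) ⋆ cstar (chi (val a)) ⋆ cstar (chi (val k))).
    rewrite chi_coset; congr (iota (on_slice _ _)).
    by apply/funext => x; rewrite pull_cosetE kD.
  have cD D : Cc (on_slice (fun x => (`[< mbar x a = D >])%:R) 1%g : K -> C).
    apply: Cc_on_slice; apply/continuous_from_mbarP => x U _ Ux; exists a => y yx.
    by rewrite yx.
  have [_ <-] := rep_sum iota_lin (finmap.enum_fset (fset_set (Mcosets M (val a)))) cD.
  congr iota; apply/funext => z; rewrite /on_slice; have [zg|zg] := eqVneq (gelt z) 1%g.
    rewrite (bigD1_seq (mbar (gpt z) a)) ?finmap.fset_uniq //; last first.
      by rewrite in_fset_set //; apply/mem_set; exact: set_valP.
    rewrite asboolT // big1 => [|D /eqP Dz]; first exact: addr0.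
    by rewrite asboolF // => E; apply: Dz.
  by rewrite big1.
Qed.

End GroupoidFamily.

(** * Stability of C_c under convolution and involution *)

Section ConvolutionClosed.
Variables (R : realType) (G : groupType) (N H M : set G) (st : CL_hypotheses N H M).
Local Notation C := (Complex R).
Local Notation K := (restricted_groupoid st).

Lemma Cc_conv (F F' : K -> C) : Cc F -> Cc F' -> Cc (conv F F').
Proof.
move=> FC F'C; have [r [_ FE]] := Cc_decomp FC; have [r' [_ F'E]] := Cc_decomp F'C.
rewrite FE F'E conv_sum; apply: Cc_sum => g; apply: Cc_sum => g'.
rewrite conv_on_slice; apply: Cc_on_slice.
apply: (ccontinuousM (f := restr_slice F g)); first exact: (continuous_restr_slice (proj1 FC)).
exact: (continuous_pull (g := g) (continuous_restr_slice (g := g') (proj1 F'C))).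
Qed.

Lemma Cc_invol (F : K -> C) : Cc F -> Cc (invol F).
Proof.
move=> FC; have [r [_ FE]] := Cc_decomp FC.
have -> : invol F = fun z => \sum_(g <- r) invol (on_slice (restr_slice F g) g) z.
  by apply/funext => z; rewrite /invol {1}FE rmorph_sum.
apply: Cc_sum => g; rewrite invol_on_slice; apply: Cc_on_slice.
apply: continuous_pull.
exact: (ccontinuous_comp (F := fun z => z^* ) (@continuous_conjC R)
  (continuous_restr_slice (g := g) (proj1 FC))).
Qed.

End ConvolutionClosed.

(** * Representations restricted to the unit slice *)

Section RepresentationNorm.
Variables (R : realType) (G : groupType) (N H M : set G) (st : CL_hypotheses N H M).
Local Notation MB := (Mbar st).
Local Notation C := (Complex R).
Local Notation K := (restricted_groupoid st).
Variables (B : cstarAlgType R) (iota : (K -> C) -> B).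
Hypothesis rep : Cc_rep iota.

Lemma locally_const_continuous (l : MB -> C) : locally_const l -> continuous l.
Proof.
move=> [a la]; apply/continuous_from_mbarP => x U _ Ux; exists a => y yx.
by rewrite (la y x yx).
Qed.

Lemma on_slice_lin k (f h : MB -> C) g :
  on_slice (fun x => k * f x + h x) g = (fun z => k * on_slice f g z + on_slice h g z) :> (K -> C).
Proof.
apply/funext => z; rewrite /on_slice; case: (gelt z == g) => //.
by rewrite mulr0 addr0.
Qed.

Lemma iota_unit_lin k (f h : MB -> C) : continuous f -> continuous h ->
  iota (on_slice (fun x => k * f x + h x) 1%g) = k *: iota (on_slice f 1%g) + iota (on_slice h 1%g).
Proof. by move=> cf ch; rewrite on_slice_lin (iota_lin rep) //; exact: Cc_on_slice. Qed.

(** On the unit slice convolution is pointwise, so the contractivity result for function algebras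
    applies. *)
Lemma iota_unit_le (f : MB -> C) (c : C) : continuous f -> 0 <= c ->
  (forall x, `|f x| <= c) -> `|iota (on_slice f 1%g)| <= c.
Proof.
apply: (@norm_rho_le R MB B (fun f => continuous f) (fun f => iota (on_slice f 1%g))).
- by move=> F h cF ch; exact: ccontinuous_comp.
- exact: iota_unit_lin.
- by move=> h h' ch ch'; rewrite (iota_mul rep) // pull1 mulg1.
- move=> h ch; have [_ _ starP] := rep.
  by rewrite -starP ?invol_on_slice ?invg1 ?pull1 //; exact: Cc_on_slice.
Qed.

End RepresentationNorm.

(** * Extension of a dominated representation to the completion *)

Section RepresentationExtension.
Variables (R : realType) (G : groupType) (N H M : set G) (st : CL_hypotheses N H M).
Local Notation C := (Complex R).
Local Notation K := (restricted_groupoid st).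
Variables (A B : cstarAlgType R) (iota : (K -> C) -> B) (pi : (K -> C) -> A).
Hypothesis iota_rep : Cc_rep iota.
Hypothesis pi_rep : Cc_rep pi.
Hypothesis dense : closure [set iota F | F in @Cc R K] = setT.
Hypothesis pi_le : forall F, Cc F -> `|pi F| <= `|iota F|.

Let L : set B := [set iota F | F in @Cc R K].

(** [iota] is not assumed injective: a preimage is chosen, and [pi_le] makes the value independent
    of it. *)
Let pi0 (b : B) : A := pi (xget (fun=> 0) [set F | Cc F /\ iota F = b]).

Lemma pi_sub F F' : Cc F -> Cc F' -> `|pi F - pi F'| <= `|iota F - iota F'|.
Proof.
move=> FC F'C; have := pi_le (Cc_lin (-1) F'C FC).
by rewrite (iota_lin iota_rep) // (iota_lin pi_rep) // !scaleN1r
  ![- _ + _]addrC.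
Qed.

Lemma pi0E F : Cc F -> pi0 (iota F) = pi F.
Proof.
move=> FC; have [F'C F'E] : [set F' | Cc F' /\ iota F' = iota F]
    (xget (fun=> 0) [set F' | Cc F' /\ iota F' = iota F]) by apply: xgetPex; exists F.
apply/eqP; rewrite -subr_eq0 -normr_le0; apply: le_trans (pi_sub F'C FC) _.
by rewrite F'E subrr normr0.
Qed.

Lemma rep_extension : exists2 g : B -> A, cstar_hom g &
  forall F, Cc F -> g (iota F) = pi F.
Proof.
pose close (b l : B) (c : C) := `|b - l| <= c.
have close_mono b l c d : close b l c -> c <= d -> close b l d by exact: le_trans.
have contr v l m c d : L l -> L m -> close v l c -> close v m d ->
    `|pi0 l - pi0 m| <= c + d.
  move=> [F FC <-] [F' F'C <-] vl vm; rewrite !pi0E //.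
  apply: le_trans (pi_sub FC F'C) _.
  rewrite -(subrK v (iota F)) -addrA; apply: le_trans (ler_normD _ _) _.
  by apply: lerD => //; rewrite distrC.
have app b : approximable close L b.
  move=> r r0; have [F FC bF] := dense_near dense b r0.
  by exists (iota F); split => //; exists F.
have [g hg] := extension_ex contr.
have gE F : Cc F -> g (iota F) = pi F.
  move=> FC; rewrite -pi0E //; apply/eqP; rewrite -subr_eq0 -normr_le0.
  by apply: (hg _ (app _)); [exists F|rewrite /close subrr normr0].
exists g => //; split.
- move=> k x y.
  have := @extension_op R A B close L pi0 close_mono g hg
    (fun x y => k *: x + y) (fun x y => k *: x + y) x y.
  case=> [_ _ [F FC <-] [F' F'C <-]|r r0|v w r r0|||_ //]; [| |exact: clin_near|exact: app|exact: app]; last first.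
    by have [d d0 hd] := clin_near k x y r0; exists d => // l m _ _; exact: hd.
  rewrite !pi0E // -(iota_lin iota_rep) // pi0E ?(iota_lin pi_rep) //.
    by split => //; exists (fun z => k * F z + F' z) => //; exact: Cc_lin.
  exact: Cc_lin.
- move=> x y; have := @extension_op R A B close L pi0 close_mono g hg (@cmul R B) (@cmul R A) x y.
  case=> [_ _ [F FC <-] [F' F'C <-]|r r0|v w r r0|||_ //]; [| |exact: cmul_near|exact: app|exact: app]; last first.
    by have [d d0 hd] := cmul_near x y r0; exists d => // l m _ _; exact: hd.
  have [_ mulB _] := iota_rep; have [_ mulA _] := pi_rep.
  have FF' : Cc (conv F F') by exact: Cc_conv.
  by rewrite !pi0E // -mulB // pi0E // mulA //; split => //; exists (conv F F').
- move=> x; have := @extension_op R A B close L pi0 close_mono g hg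
    (fun x _ => cstar x) (fun x _ => cstar x) x x.
  case=> [_ _ [F FC <-] _|r r0|v w r r0|||_ //].
  + have [_ _ starB] := iota_rep; have [_ _ starA] := pi_rep.
    have FS : Cc (invol F) by exact: Cc_invol.
    by rewrite !pi0E // -starB // pi0E // starA //; split => //; exists (invol F).
  + by have [d d0 hd] := cstar_near x r0; exists d => // l m _ _ xl _; exact: hd.
  + by have [d d0 hd] := cstar_near v r0; exists d => // v' w' vv' _; exact: hd.
  + exact: app.
  + exact: app.
Qed.

End RepresentationExtension.

(** * The homomorphism from A to B on the calculus and on the V_g *)

Section Comparison.
Variables (R : realType) (G : groupType) (N H M : set G) (st : CL_hypotheses N H M).
Local Notation PT := (set_type (Pset H M)).
Local Notation MT := (set_type M).
Local Notation MB := (Mbar st).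
Local Notation C := (Complex R).
Local Notation K := (restricted_groupoid st).
Variables (A : cstarAlgType R) (e : A) (s u : G -> A).
Hypothesis fam : CL_family H M e s u.
Variables (B : cstarAlgType R) (iota : (K -> C) -> B).
Hypothesis rep : Cc_rep iota.
Hypothesis dense : closure [set iota F | F in @Cc R K] = setT.
Variable f : A -> B.
Hypothesis fhom : cstar_hom f.
Hypothesis fs : forall a, Pset H M a -> f (s a) = chi iota a.
Hypothesis fu : forall m, M m -> f (u m) = chi iota m.

Local Notation D := (@calculus R G N H M st A e s u fam).
Local Notation V := (@partial_iso R G N H M st A s u).
Local Notation D0 := (@lc_calculus R G N H M st A s u).

Lemma hom_sub x y : f (x - y) = f x - f y.
Proof. by have [flin _ _] := fhom; rewrite -scaleN1r addrC flin scaleN1r addrC. Qed.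

Lemma hom_scale k x : f (k *: x) = k *: f x.
Proof.
by have [flin _ _] := fhom; rewrite -[_ *: x]addr0 flin -(subrr 0) hom_sub subrr addr0.
Qed.

Lemma hom_sum (I : Type) (r : seq I) (F : I -> A) :
  f (\sum_(i <- r) F i) = \sum_(i <- r) f (F i).
Proof.
apply: (big_morph f) => [x y|]; last by rewrite -(subrr 0) hom_sub subrr.
by have [flin _ _] := fhom; rewrite -[x]scale1r flin !scale1r.
Qed.

Lemma hom_partial_iso g : f (V g) = chi iota g.
Proof.
have [_ fM fS] := fhom; have [a [m [b [gE VgE]]]] := partial_iso_ex st fam g.
rewrite VgE !fM fS (fs (set_valP a)) (fs (set_valP b)) (fu (set_valP m)).
rewrite (chi_star rep) (chi_mulr rep); last exact: arrow_M_total.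
by rewrite (chi_mulr rep) ?gE //; exact: arrow_P_total.
Qed.

Lemma hom_coset_proj (m : MT) (a : PT) : f (coset_proj s u m a) = coset_proj (chi iota) (chi iota) m a.
Proof.
have [_ fM fS] := fhom.
by rewrite /coset_proj !fM !fS (fs (set_valP a)) (fu (set_valP m)).
Qed.

Lemma acts_as_hom (l : MB -> C) a T : acts_as s u l a T -> acts_as (chi iota) (chi iota) l a (f T).
Proof.
have [_ fM fS] := fhom; move=> [la hl]; split; first exact: la.
by move=> m x xm; rewrite -hom_coset_proj -fM (hl m x xm) hom_scale.
Qed.

Lemma acts_as_iota (l : MB -> C) a : level_fun l a ->
  acts_as (chi iota) (chi iota) l a (iota (on_slice l 1%g)).
Proof.
move=> la; split; first exact: la.
move=> m x xm; have cl : continuous l by apply: locally_const_continuous; exists a.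
have cd := @continuous_dom R G N H M st (val m * val a)%g.
rewrite /coset_proj (chi_coset rep) (iota_mul rep _ _ cl cd) pull1 mul1g.
rewrite -(rho_scale (L := @Cc R K) (iota_lin rep) _ (Cc_on_slice _ cd)).
congr iota; apply/funext => z; rewrite /on_slice; case: (gelt z == 1%g); last by rewrite mulr0.
rewrite pull_cosetE; case: asboolP => [zm|_]; last by rewrite !mulr0.
congr (_ * _); apply: la; rewrite zm; apply/esym.
exact: mbar_mem_eq xm (mem_mbar_of _ _ _).
Qed.

(** Both sides act by the values of [l] on the coset projections of the family [chi] in [B], and
    such an element is unique. *)
Lemma hom_lc_calculus (l : MB -> C) : locally_const l -> f (D0 l) = iota (on_slice l 1%g).
Proof.
move=> ll; have [a hl] := lc_calculusP fam ll; have [la _] := hl.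
exact: (acts_as_unique (chi_family rep dense) (acts_as_hom hl) (acts_as_iota la)).
Qed.

Lemma hom_calculus (h : MB -> C) : continuous h -> f (D h) = iota (on_slice h 1%g).
Proof.
move=> ch; apply/eqP; rewrite -subr_eq0 -normr_le0; apply/ler_addgt0Pr => r r0.
(* [f] is bounded by 2 and [iota] is contractive on the unit slice: the error is [2 r/3 + r/3]. *)
rewrite add0r; have r30 : 0 < r / 3 by rewrite divr_gt0.
have [l [ll hl]] := unif_approx ch r30.
have cl := locally_const_continuous ll.
have -> : f (D h) - iota (on_slice h 1%g) =
    f (D h - D0 l) + (iota (on_slice l 1%g) - iota (on_slice h 1%g)).
  by rewrite hom_sub (hom_lc_calculus ll) addrA subrK.
apply: (@le_trans _ _ (2 * (r / 3) + r / 3)); last first.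
  by rewrite le_eqVlt; apply/orP; left; apply/eqP; field.
apply: le_trans (ler_normD _ _) _; apply: lerD.
  apply: le_trans (cstar_hom_bounded (clf_unit fam) fhom _) _.
  by apply: ler_wpM2l => //; exact: (calculus_close fam ch ll hl).
have -> : iota (on_slice l 1%g) - iota (on_slice h 1%g) = iota (on_slice (fun x => -1 * h x + l x) 1%g).
  by rewrite (iota_unit_lin rep _ ch cl) scaleN1r addrC.
apply: (iota_unit_le rep); last 1 first.
- by move=> x; rewrite mulN1r addrC distrC; exact: hl.
- have c1 : continuous (fun x : MB => -1 * h x).
    apply: (ccontinuousM (f := fun=> -1) (g := h)); last exact: ch.
    exact: cst_continuous.
  exact: (ccontinuousD c1 cl).
- exact: ltW.
Qed.

(** A slice function is its copy on the unit slice times [chi g], and these two factors are the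
    images of [D h] and [V g]. *)
Lemma hom_induced F : Cc F -> f (induced fam F) = iota F.
Proof.
move=> FC; have [r [_ FE]] := Cc_decomp FC; have [_ fM _] := fhom.
have cF g : continuous (restr_slice F g) := continuous_restr_slice (g := g) (proj1 FC).
have [_ iE] := rep_sum (iota_lin rep) r (fun g => Cc_on_slice g (cF g)).
have [_ pE] := rep_sum (induced_lin fam) r (fun g => Cc_on_slice g (cF g)).
rewrite FE iE pE hom_sum; apply: eq_bigr => g _.
rewrite (induced_on_slice fam g (cF g)) fM (hom_calculus (cF g)) hom_partial_iso.
rewrite /chi (iota_mul rep _ _ (cF g)); last exact: cst_continuous.
rewrite pull1 mul1g; congr (iota (on_slice _ _)).
by apply/funext => x; rewrite mulr1.
Qed.

Lemma induced_chi g : induced fam (on_slice ((fun=> 1) : MB -> C) g) = V g.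
Proof.
rewrite (induced_on_slice fam g); last exact: cst_continuous.
by rewrite (calculus_1 st fam) (CL_unitl fam).
Qed.

End Comparison.

Theorem corollary6p6 (R : realType) (G : groupType) (N H M : set G)
    (hyp : CL_hypotheses N H M)
    (A : cstarAlgType R) (e : A) (s u : G -> A)
    (hA : is_universal_CL H M e s u)
    (B : cstarAlgType R)
    (iota : (restricted_groupoid hyp -> Complex R) -> B)
    (hB : is_full_groupoid_cstar iota) :
  cstar_isomorphic A B.
Proof.
have [fam univ] := hA; have [rep dense full] := hB.
have famB := chi_family rep dense.
have [f [[fhom fe fs fu] _]] := univ _ _ _ _ famB.
(* The representation on [A] is one of those over which the full norm is a supremum. *)
have pi_le F : Cc F -> `|induced fam F| <= `|iota F|.
  move=> FC; have [ub _] := full F FC; apply: ub.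
  by exists A, (induced fam); split; [exact: induced_rep|].
have [g ghom gE] := rep_extension rep (induced_rep hyp fam) dense pi_le.
have [[flin fM fS] [glin gM gS]] := (fhom, ghom).
have g_chi h : g (chi iota h) = partial_iso hyp s u h.
  by rewrite /chi (gE _ (Cc_chi R hyp h)) induced_chi.
have gf x : g (f x) = x.
  have [id' [_ uniq_id]] := univ A e s u fam.
  have idE : id' = id by apply: uniq_id; split.
  suff : id' = g \o f by rewrite idE => /(congr1 (fun k => k x)).
  apply: uniq_id; split.
  - split=> [k y z|y z|y]; rewrite !compE.
    + by rewrite flin glin.
    + by rewrite fM gM.
    + by rewrite fS gS.
  - by rewrite compE fe g_chi; have := partial_iso_M hyp fam (M1 hyp); rewrite (CL_u1 hyp fam).
  - move=> a Pa; rewrite compE fs // g_chi.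
    exact: (partial_iso_P hyp fam (exist _ a (mem_set Pa))).
  - move=> m Mm; rewrite compE fu // g_chi.
    exact: (partial_iso_M hyp fam (exist _ m (mem_set Mm))).
have fg y : f (g y) = y.
  apply/eqP; rewrite -subr_eq0 -normr_le0; apply/ler_addgt0Pr => r r0.
  (* [f] and [g] are each bounded by 2, so the error is [4 r/5 + r/5]. *)
  rewrite add0r; have r5 : 0 < r / 5 by rewrite divr_gt0.
  have [F FC yF] := dense_near dense y r5.
  have -> : f (g y) - y = f (g (y - iota F)) - (y - iota F).
    rewrite (hom_sub ghom) (hom_sub fhom) (gE F FC).
    by rewrite (hom_induced fam rep dense fhom fs fu FC) opprB addrA subrK.
  apply: le_trans (ler_normB _ _) _.
  apply: (@le_trans _ _ (2 * (2 * (r / 5)) + r / 5)); last first.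
    by rewrite le_eqVlt; apply/orP; left; apply/eqP; field.
  apply: lerD; last exact: yF.
  apply: le_trans (cstar_hom_bounded (clf_unit fam) fhom _) _.
  apply: ler_wpM2l => //.
  apply: le_trans (cstar_hom_bounded (clf_unit famB) ghom _) _.
  exact: ler_wpM2l.
by exists f; split => //; exists g.
Qed.
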